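(* Let $s\in(0,1)$, let $\Omega\subset\mathbb{R}^N$ be a bounded strictly convex domain of class $C^2$, and let $g\colon\mathbb{R}^N\setminus\Omega\to\mathbb{R}$ be continuous and bounded. Then there is a unique viscosity solution $u$ (in the sense described in the context) of \[ \begin{cases} \displaystyle \Lambda_1^s u(x)\coloneqq \inf\left\{\int_{\mathbb{R}}\frac{u(x+tz)-u(x)}{|t|^{1+2s}}\,dt\colon z\in\mathbb{S}^{N-1}\right\}=0, & x\in\Omega,\\[6pt] u(x)=g(x), & x\in\mathbb{R}^N\setminus\Omega. \end{cases} \] This solution is continuous in $\overline\Omega$ and the datum is taken with continuity, that is, $u|_{\partial\Omega}=g|_{\partial\Omega}$.
   Context: Integrals are principal value integrals; $\mathbb{S}^{N-1}$ is the unit sphere. For $u\colon\overline\Omega\to\mathbb{R}$ let the upper $g$-extension be $u^g=u$ in $\Omega$, $u^g=g$ in $\mathbb{R}^N\setminus\overline\Omega$, $u^g=\max\{u,g\}$ on $\partial\Omega$; the lower $g$-extension $u_g$ uses $\min$ instead. For $\delta>0$, $z\in\mathbb{S}^{N-1}$, a $C^2$ function $\phi$ and a function $w$, set $E_{z,\delta}(w,\phi,x)\coloneqq\int_{-\delta}^{\delta}\frac{\phi(x+tz)-\phi(x)}{|t|^{1+2s}}dt+\int_{\mathbb{R}\setminus(-\delta,\delta)}\frac{w(x+tz)-u(x)}{|t|^{1+2s}}dt$ and $E_\delta(w,\phi,x)\coloneqq-\inf_{z\in\mathbb{S}^{N-1}}E_{z,\delta}(w,\phi,x)$. A bounded upper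 semicontinuous $u\colon\mathbb{R}^N\to\mathbb{R}$ is a viscosity subsolution if $u\le g$ in $\mathbb{R}^N\setminus\overline\Omega$ and for every $\delta>0$ and $\phi\in C^2(\mathbb{R}^N)$ such that $x_0$ is a maximum point of $u-\phi$ in $B_\delta(x_0)$: $E_\delta(u^g,\phi,x_0)\le0$ if $x_0\in\Omega$, and $\min\{E_\delta(u^g,\phi,x_0),u(x_0)-g(x_0)\}\le 0$ if $x_0\in\partial\Omega$ (if $u$ is not upper semicontinuous, this is required of its upper semicontinuous envelope). Viscosity supersolutions are defined analogously, with lower semicontinuity, $u_g$, minimum points and reversed inequalities (with $\max$ instead of $\min$ on $\partial\Omega$). A viscosity solution is both a sub- and a supersolution. *)

(* Defs.v *)
From HB Require Import structures.
From mathcomp Require Import all_boot all_order all_algebra.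
From mathcomp Require Import all_classical all_reals all_analysis.
Set Implicit Arguments. Unset Strict Implicit. Unset Printing Implicit Defensive.
Import Order.TTheory GRing.Theory Num.Theory.
Import numFieldNormedType.Exports.
Local Open Scope classical_set_scope.
Local Open Scope ring_scope.

Section Defs.
Variables (R : realType) (N : nat).
Local Notation V := 'rV[R]_N.

(* Euclidean norm on R^N (the library norm on matrices is the sup norm). *)
Definition enorm (x : V) : R := Num.sqrt (\sum_(i < N) x ord0 i ^+ 2).

Definition eball (x : V) (r : R) : set V := [set y | enorm (y - x) < r].

Definition sphere : set V := [set z | enorm z = 1].

Definition e_ (i : 'I_N) : V := delta_mx ord0 i.

Definition C2 (f : V -> R) : Prop :=
  [/\ continuous f,
      (forall i x, derivable f x (e_ i)),
      (forall i, continuous ('D_(e_ i) f)),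
      (forall i j x, derivable ('D_(e_ i) f) x (e_ j)) &
      (forall i j, continuous ('D_(e_ j) ('D_(e_ i) f)))].

Definition C2_domain (O : set V) : Prop :=
  exists rho : V -> R, [/\ C2 rho, O = [set x | rho x < 0] &
    forall x, rho x = 0 -> exists i, 'D_(e_ i) rho x != 0].

Definition strictly_convex (O : set V) : Prop :=
  forall x y (l : R), closure O x -> closure O y -> x != y -> 0 < l < 1 ->
    O (l *: x + (1 - l) *: y).

Definition usc_env (u : V -> R) (x : V) : R :=
  inf [set sup [set u y | y in eball x r] | r in [set r : R | 0 < r]].
Definition lsc_env (u : V -> R) (x : V) : R :=
  sup [set inf [set u y | y in eball x r] | r in [set r : R | 0 < r]].

Definition usc (u : V -> R) : Prop :=
  forall x, forall e, 0 < e -> exists2 r, 0 < r & forall y, eball x r y -> u y < u x + e.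
Definition lsc (u : V -> R) : Prop :=
  forall x, forall e, 0 < e -> exists2 r, 0 < r & forall y, eball x r y -> u x - e < u y.

Definition bounded_fun (u : V -> R) : Prop := exists M : R, forall x, `|u x| <= M.

Definition upper_ext (O : set V) (g u : V -> R) (x : V) : R :=
  if `[< O x >] then u x
  else if `[< closure O x >] then Num.max (u x) (g x) else g x.
Definition lower_ext (O : set V) (g u : V -> R) (x : V) : R :=
  if `[< O x >] then u x
  else if `[< closure O x >] then Num.min (u x) (g x) else g x.

Definition kern (s t : R) : R := (`|t| `^ (1 + 2 * s))^-1.

(* E_{z,delta}(w, phi, x), with the principal value integral near 0
   taken as lim_{eps -> 0+} of the integral over eps < |t| < delta *)
Definition Ezd (s : R) (u w phi : V -> R) (x z : V) (d : R) : R :=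
  lim ((fun eps : R =>
          \int[lebesgue_measure]_(t in [set t : R | eps < `|t| < d])
             ((phi (x + t *: z) - phi x) * kern s t)) @ 0^'+)
  + \int[lebesgue_measure]_(t in [set t : R | d <= `|t|])
       ((w (x + t *: z) - u x) * kern s t).

Definition Ed (s : R) (u w phi : V -> R) (x : V) (d : R) : \bar R :=
  (- ereal_inf [set (Ezd s u w phi x z d)%:E | z in sphere])%E.

Definition subsol_usc (s : R) (O : set V) (g u : V -> R) : Prop :=
  (forall x, ~ closure O x -> u x <= g x) /\
  forall (d : R) (phi : V -> R) (x0 : V), 0 < d -> C2 phi ->
    (forall y, eball x0 d y -> u y - phi y <= u x0 - phi x0) ->
    (O x0 -> (Ed s u (upper_ext O g u) phi x0 d <= 0)%E) /\
    (closure O x0 -> ~ O x0 ->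
       (Order.min (Ed s u (upper_ext O g u) phi x0 d) (u x0 - g x0)%:E <= 0)%E).

Definition supersol_lsc (s : R) (O : set V) (g u : V -> R) : Prop :=
  (forall x, ~ closure O x -> g x <= u x) /\
  forall (d : R) (phi : V -> R) (x0 : V), 0 < d -> C2 phi ->
    (forall y, eball x0 d y -> u x0 - phi x0 <= u y - phi y) ->
    (O x0 -> (0 <= Ed s u (lower_ext O g u) phi x0 d)%E) /\
    (closure O x0 -> ~ O x0 ->
       (0 <= Order.max (Ed s u (lower_ext O g u) phi x0 d) (u x0 - g x0)%:E)%E).

Definition visc_subsol (s : R) (O : set V) (g u : V -> R) : Prop :=
  bounded_fun u /\ subsol_usc s O g (if `[< usc u >] then u else usc_env u).
Definition visc_supersol (s : R) (O : set V) (g u : V -> R) : Prop :=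
  bounded_fun u /\ supersol_lsc s O g (if `[< lsc u >] then u else lsc_env u).
Definition visc_solution (s : R) (O : set V) (g u : V -> R) : Prop :=
  visc_subsol s O g u /\ visc_supersol s O g u.

End Defs.

(* Main.v *)
Require Import Defs.
From HB Require Import structures.
From mathcomp Require Import all_boot all_order all_algebra.
From mathcomp Require Import all_classical all_reals all_analysis.
From mathcomp Require Import measurable_realfun lra ring.
Set Implicit Arguments. Unset Strict Implicit. Unset Printing Implicit Defensive.
Import Order.TTheory GRing.Theory Num.Theory.
Import numFieldNormedType.Exports.
Local Open Scope classical_set_scope.
Local Open Scope ring_scope.

(* Existence.  Truncating the integrals to |t| >= eps gives a monotone averaging
   problem, solved by Knaster-Tarski because upper semicontinuity is stable under
   infima.  As eps -> 0, the half-relaxed limits of these solutions are a sub- and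
   a supersolution: one passes to the limit with a reverse Fatou lemma and the
   compactness of the sphere of directions.
   Boundary.  By strict convexity the closure of O touches a supporting hyperplane
   only at the given boundary point.  Testing with a steep multiple of the
   supporting functional, every line leaves O on one side before the slope matters,
   so a gap between the function and the datum would dominate all the directional
   integrals; hence the datum is attained.
   Comparison.  Double the variables with the penalty |x - y|^2 and subtract the
   two nonlocal inequalities written in the same direction z.  Every line leaves
   the bounded set O, which produces a strictly negative contribution.
   Comparison then identifies the two half-relaxed limits and gives uniqueness. *)

(** * The singular kernel on the half-line *)

Section Kernel.
Variables (R : realType) (s : R).
Hypothesis hs : 0 < s < 1.
Local Notation mu := (@lebesgue_measure R).

(** Real integrals and infima take default values when they do not exist, and a principal value is
    only a limit. So each directional operator is rewritten as [J s] of a second difference on the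
    half-line, where a bound by C min(1, t^2) ([adm]) gives absolute convergence and justifies
    linearity, monotonicity and limits. Since the operator is minus an infimum over directions, a
    subsolution satisfies its inequality in every direction, a supersolution only in one nearly
    optimal direction. The boundary argument asks for one direction only, hence serves both after a
    change of sign; comparison takes its direction from the supersolution; stability is relative to
    a compact set of directions, a singleton or the whole sphere. Lower half-relaxed limits are
    handled as minus the upper limit of the opposite functions. The explicit test functions and
    penalties are paraboloids plus linear terms: their second difference 2 a t^2 depends neither on
    the point nor on the direction. *)

Lemma kern_ge0 (t : R) : 0 <= kern s t.
Proof. by rewrite /kern invr_ge0 powR_ge0. Qed.

Lemma kernN (t : R) : kern s (- t) = kern s t.
Proof. by rewrite /kern normrN. Qed.

Lemma kern_gt0 (t : R) : 0 < t -> kern s t = t `^ (- (1 + 2 * s)).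
Proof. by move=> t0; rewrite /kern gtr0_norm// powRN. Qed.

Lemma measurable_kern (D : set R) : measurable_fun D (kern s).
Proof.
apply: measurable_funTS.
have -> : kern s = (fun t : R => (`|t| `^ (- (1 + 2 * s)))).
  by apply/funext => t; rewrite powRN.
apply: (@measurableT_comp _ _ _ _ _ _ (@powR R ^~ _)) => //.
Qed.

Lemma cvg_powRN_pinfty (p : R) : 0 < p -> t `^ (- p) @[t --> +oo] --> (0:R).
Proof.
move=> p0; apply/cvgrPdist_le => e e0; near=> t.
have t0 : 0 < t by near: t; exact: nbhs_pinfty_gt.
have te : e `^ (- p^-1) <= t by near: t; exact: nbhs_pinfty_ge.
rewrite sub0r normrN ger0_norm ?powR_ge0//.
rewrite powRN -[leRHS]invrK lef_pV2 ?posrE ?invr_gt0 ?powR_gt0//.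
apply: le_trans (ge0_ler_powR (ltW p0) _ _ te); rewrite ?nnegrE ?powR_ge0 ?(ltW t0)//.
by rewrite -powRrM mulNr mulVf ?gt_eqF// powR_inv1// ltW.
Unshelve. all: by end_near. Qed.


Lemma continuous_powR_gt0 (p x : R) : 0 < x -> {for x, continuous (fun t => t `^ p)}.
Proof.
move=> x0; apply/differentiable_continuous/derivable1_diffP.
by apply: derivable_powR; rewrite in_itv/= andbT.
Qed.

Lemma is_derive_powR_div (p x : R) : p != 0 -> 0 < x ->
  is_derive x 1 (fun t => p^-1 * t `^ p) (x `^ (p - 1)).
Proof.
move=> p0 x0; have H := is_derive1_powR p x0.
apply: is_derive_eq.
by rewrite /GRing.scale /= mulrA mulVf// mul1r.
Qed.

Lemma integral_kern_tail (a : R) : 0 < a ->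
  (\int[mu]_(t in `[a, +oo[) (kern s t)%:E = (a `^ (- (2 * s)) / (2 * s))%:E)%E.
Proof.
move=> a0; have /andP[s0 s1] := hs.
have p0 : - (2 * s) != 0 by rewrite lt_eqF//; lra.
transitivity (\int[mu]_(t in `[a, +oo[) (t `^ (- (2 * s) - 1))%:E)%E.
  apply: eq_integral => t; rewrite inE /= in_itv /= andbT => at_.
  rewrite kern_gt0 ?(lt_le_trans a0)//; congr ((_ `^ _)%:E); lra.
rewrite (@ge0_continuous_FTC2y _ _ (fun t => (- (2 * s))^-1 * t `^ (- (2 * s))) a 0).
- by rewrite -EFinD add0r invrN mulNr opprK mulrC.
- by move=> x _; exact: powR_ge0.
- apply: continuous_in_subspaceT => x; rewrite inE /= in_itv /= andbT => ax.
  exact/continuous_powR_gt0/(lt_le_trans a0).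
- rewrite -[X in _ --> X](mulr0 ((- (2 * s))^-1)).
  by apply: cvgMl_tmp; apply: cvg_powRN_pinfty; lra.
- by move=> x ax; have [] := is_derive_powR_div p0 (lt_trans a0 ax).
- apply: cvg_at_right_filter; apply: cvgMl_tmp; exact: continuous_powR_gt0.
- move=> x; rewrite in_itv /= andbT => ax; rewrite derive1E.
  by have [_ ->] := is_derive_powR_div p0 (lt_trans a0 ax).
Qed.

(** The primitive t^(2-2s) / (2-2s) is used away from the singularity, on [d/(n+2), d], and monotone
    convergence along these increasing sets reaches 0. *)
Lemma integral_sqr_kern_le (d : R) : 0 < d ->
  (\int[mu]_(t in `]0%R, d]) (t ^+ 2 * kern s t)%:E
     <= (d `^ (2 - 2 * s) / (2 - 2 * s))%:E)%E.
Proof.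
move=> d0; have /andP[s0 s1] := hs.
have p0 : 2 - 2 * s != 0 by rewrite gt_eqF//; lra.
(* With [n.+2] the left endpoint is strictly below d already for n = 0, so no interval
   degenerates. *)
pose F n : set (measurableTypeR R) := `[d / n.+2%:R, d]%classic.
have Fn0 n : 0 < d / n.+2%:R by rewrite divr_gt0.
have Fnd n : d / n.+2%:R < d by rewrite ltr_pdivrMr// ltr_pMr// ltr1n.
have -> : `]0%R, d]%classic = \bigcup_i F i.
  apply/seteqP; split => t.
    rewrite /= in_itv /= => /andP[t0 td].
    exists (Num.trunc (d / t)) => //; rewrite /F /= in_itv /= td andbT.
    rewrite ler_pdivrMr// -ler_pdivrMl//.
    rewrite (@le_trans _ _ ((Num.trunc (d / t)).+1%:R))// ?ler_nat//.
    by rewrite mulrC ltW// truncnS_gt.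
  move=> [n _]; rewrite /F /= !in_itv /= => /andP[nt ->]; rewrite andbT.
  exact: lt_le_trans nt.
have mf (D : set R) : measurable_fun D (fun t : R => (t ^+ 2 * kern s t)%:E).
  apply/measurable_EFinP/measurable_funM; last exact: measurable_kern.
  exact: measurable_funX.
have f0 t : (0 <= (t ^+ 2 * kern s t)%:E)%E.
  by rewrite lee_fin mulr_ge0// ?sqr_ge0 ?kern_ge0.
have FF : nondecreasing_seq F.
  move=> m n mn; rewrite subsetEset; apply: subset_itvr; rewrite bnd_simp.
  by rewrite ler_pM2l// lef_pV2 ?posrE// ler_nat.
have mF i : measurable (F i) by exact: measurable_itv.
have := @ge0_nondecreasing_set_cvg_integral _ _ _ F _ mu FF mF
  (fun i => mf (F i)) (fun i x _ => f0 x).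
move=> /cvg_lim => /(_ (@ereal_hausdorff _)) <-.
apply: lime_le.
  apply: ereal_nondecreasing_is_cvgn.
  exact: (@ge0_nondecreasing_set_nondecreasing_integral _ _ _ F _ mu FF mF
  (fun i => mf (F i)) (fun i x _ => f0 x)).
apply: nearW => n.
have -> : (\int[mu]_(t in F n) (t ^+ 2 * kern s t)%:E =
    \int[mu]_(t in `[(d / n.+2%:R)%R, d]) (t `^ (2 - 2 * s - 1))%:E)%E.
  apply: eq_integral => t; rewrite inE /F /= in_itv /= => /andP[nt _].
  have t0 := lt_le_trans (Fn0 n) nt.
  rewrite kern_gt0// -powR_mulrn ?(ltW t0)// -powRD; last by rewrite (gt_eqF t0) implybT.
  by congr ((_ `^ _)%:E); lra.
rewrite (@continuous_FTC2 _ _ (fun t => (2 - 2 * s)^-1 * t `^ (2 - 2 * s)))//.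
- rewrite -EFinD lee_fin [X in _ <= X]mulrC gerDl oppr_le0 mulr_ge0 ?powR_ge0//.
  by rewrite invr_ge0; lra.
- apply: continuous_in_subspaceT => x; rewrite inE /= in_itv /= => /andP[ax _].
  exact/continuous_powR_gt0/(lt_le_trans (Fn0 n)).
- split.
  + move=> x; rewrite in_itv /= => /andP[ax _].
    by have [] := is_derive_powR_div p0 (lt_trans (Fn0 n) ax).
  + apply: cvg_at_right_filter; apply: cvgMl_tmp; exact: continuous_powR_gt0.
  + apply: cvg_at_left_filter; apply: cvgMl_tmp; exact: continuous_powR_gt0.
- move=> x; rewrite in_itv /= => /andP[ax _]; rewrite derive1E.
  by have [_ ->] := is_derive_powR_div p0 (lt_trans (Fn0 n) ax).
Qed.

(** Real-valued, with a default value when the integral diverges; hence the [adm] hypotheses carried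
    by the rules of calculus below. *)
Definition J (f : R -> R) : R := \int[mu]_(t in `]0, +oo[) (f t * kern s t).

Definition qmin (t : R) : R := Num.min 1 (t ^+ 2).

(* Measurable functions with |f t| <= C min(1, t^2): those for which the
   integral against |t|^-(1+2s) on (0, oo) converges absolutely. *)
Definition adm (C : R) (f : R -> R) : Prop :=
  measurable_fun [set: R] f /\ forall t, 0 < t -> `|f t| <= C * qmin t.

Lemma qmin_ge0 t : 0 <= qmin t.
Proof. by rewrite /qmin le_min ler01 sqr_ge0. Qed.

Lemma measurable_qmin : measurable_fun [set: R] qmin.
Proof.
apply: measurable_minr; first exact: measurable_cst.
exact: measurable_funX.
Qed.

Lemma measurable_mulkern (f : R -> R) (D : set R) : measurable_fun [set: R] f ->
  measurable_fun D (fun t => f t * kern s t).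
Proof.
move=> mf; apply: measurable_funM; last exact: measurable_kern.
exact: measurable_funTS.
Qed.

Lemma integrable_qmin : mu.-integrable `]0, +oo[ (EFin \o (fun t => qmin t * kern s t)).
Proof.
have m0 := measurable_mulkern (D := `]0, +oo[) measurable_qmin.
have ge0 t : 0 <= qmin t * kern s t by rewrite mulr_ge0 ?qmin_ge0 ?kern_ge0.
apply/integrableP; split; first exact/measurable_EFinP.
under eq_integral do rewrite /= ger0_norm//.
have -> : `]0, +oo[%classic = `]0, 1]%classic `|` `]1, +oo[%classic :> set R.
  by rewrite -itv_bndbnd_setU// bnd_simp.
rewrite ge0_integral_setU//=; last 3 first.
- rewrite -itv_bndbnd_setU ?bnd_simp//; exact/measurable_EFinP.
- by move=> x _; rewrite lee_fin.
- apply/disj_setPS => x []/=; rewrite !in_itv /= => /andP[_ x1] /andP[x1' _].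
  by move: (lt_le_trans x1' x1); rewrite ltxx.
rewrite lte_add_pinfty//.
- apply: le_lt_trans (le_lt_trans (integral_sqr_kern_le ltr01) (ltry _)).
  apply: ge0_le_integral => //=.
  + by move=> x _; rewrite lee_fin.
  + apply/measurable_EFinP; exact: measurable_mulkern measurable_qmin.
  + apply/measurable_EFinP; apply: measurable_mulkern; exact: measurable_funX.
  + move=> x _; rewrite lee_fin ler_wpM2r ?kern_ge0//.
    by rewrite /qmin ge_min lexx orbT.
- apply: (@le_lt_trans _ _ (\int[mu]_(t in `[1%R, +oo[) (kern s t)%:E)%E);
    last by rewrite integral_kern_tail// ltry.
  apply: (@le_trans _ _ (\int[mu]_(t in `]1%R, +oo[) (kern s t)%:E)%E).
    apply: ge0_le_integral => //=.
    + by move=> x _; rewrite lee_fin.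
    + apply/measurable_EFinP; exact: measurable_mulkern measurable_qmin.
    + by apply/measurable_EFinP; exact: measurable_kern.
    + move=> x _; rewrite lee_fin ler_piMl ?kern_ge0//.
      by rewrite /qmin ge_min lexx.
  apply: ge0_subset_integral => //=.
  + by apply/measurable_EFinP; exact: measurable_kern.
  + by move=> x _; rewrite lee_fin kern_ge0.
  + by apply: subset_itvr; rewrite bnd_simp.
Qed.

Lemma adm_integrable C (f : R -> R) : adm C f ->
  mu.-integrable `]0, +oo[ (EFin \o (fun t => f t * kern s t)).
Proof.
move=> [mf fC].
apply: (@le_integrable _ _ _ mu _ _ _ (EFin \o (fun t => C * (qmin t * kern s t)))) => //.
- by apply/measurable_EFinP; apply: measurable_mulkern.
- move=> t; rewrite /= in_itv /= andbT => t0; rewrite lee_fin.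
  rewrite normrM (ger0_norm (kern_ge0 _)) mulrA.
  rewrite [leRHS]ger0_norm; first by rewrite ler_wpM2r ?kern_ge0// fC.
  by rewrite mulr_ge0 ?kern_ge0// (le_trans _ (fC _ t0)).
- exact: (integrableZl _ _ integrable_qmin).
Qed.

Lemma adm_add C D f g : adm C f -> adm D g -> adm (C + D) (fun t => f t + g t).
Proof.
move=> [mf fC] [mg gD]; split; first exact: measurable_funD.
move=> t t0; rewrite (le_trans (ler_normD _ _))// mulrDl lerD// ?fC ?gD//.
Qed.

Lemma adm_scale C a f : adm C f -> adm (`|a| * C) (fun t => a * f t).
Proof.
move=> [mf fC]; split; first exact: measurable_funM.
by move=> t t0; rewrite normrM -mulrA ler_wpM2l// fC.
Qed.

Lemma JD C D f g : adm C f -> adm D g -> J (fun t => f t + g t) = J f + J g.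
Proof.
move=> /adm_integrable fi /adm_integrable gi; rewrite /J -RintegralD//.
by apply: eq_Rintegral => t _; rewrite mulrDl.
Qed.

Lemma JZ C a f : adm C f -> J (fun t => a * f t) = a * J f.
Proof.
move=> /adm_integrable fi; rewrite /J -RintegralZl//.
by apply: eq_Rintegral => t _; rewrite mulrA.
Qed.

Lemma le_J C D f g : adm C f -> adm D g -> (forall t, 0 < t -> f t <= g t) ->
  J f <= J g.
Proof.
move=> /adm_integrable fi /adm_integrable gi fg; apply: le_Rintegral => // t.
by rewrite /= in_itv /= andbT => t0; rewrite ler_wpM2r ?kern_ge0 ?fg.
Qed.

Lemma eq_J f g : (forall t, 0 < t -> f t = g t) -> J f = J g.
Proof.
move=> fg; apply: eq_Rintegral => t; rewrite inE /= in_itv /= andbT => t0.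
by rewrite fg.
Qed.

Lemma JN C f : adm C f -> J (fun t => - f t) = - J f.
Proof.
move=> fC; rewrite -mulN1r -(JZ _ fC).
by apply: eq_J => t _; rewrite mulN1r.
Qed.


Lemma measurable_cut (d : R) (f1 f2 : R -> R) :
  measurable_fun [set: R] f1 -> measurable_fun [set: R] f2 ->
  measurable_fun [set: R] (fun t => if t < d then f1 t else f2 t).
Proof.
move=> m1 m2; apply: measurable_fun_ifT => //.
exact: measurable_fun_ltr.
Qed.

(** Both factors come from comparison with min(1, t^2): t^2 <= (1 + d^2) min(1, t^2) when t < d, and
    1 <= (1 + d^-2) min(1, t^2) when t >= d. *)
Lemma adm_cut (A B d : R) (f1 f2 : R -> R) : 0 < d -> 0 <= A -> 0 <= B ->
  measurable_fun [set: R] f1 -> measurable_fun [set: R] f2 ->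
  (forall t, 0 < t < d -> `|f1 t| <= A * t ^+ 2) ->
  (forall t, d <= t -> `|f2 t| <= B) ->
  adm (A * (1 + d ^+ 2) + B * (1 + d ^- 2)) (fun t => if t < d then f1 t else f2 t).
Proof.
move=> d0 A0 B0 m1 m2 fA fB; split; first exact: measurable_cut.
have d2 : 0 < d ^+ 2 by rewrite exprn_gt0.
have dV : 0 < d ^- 2 by rewrite invr_gt0.
move=> t t0; have q0 := qmin_ge0 t; rewrite mulrDl.
have t20 : 0 < t ^+ 2 by rewrite exprn_gt0.
have [td|dt] := ltP t d.
  rewrite (le_trans (fA _ _)) ?t0//.
  rewrite -[leLHS]addr0 lerD//; last by rewrite !mulr_ge0//; lra.
  rewrite -mulrA ler_wpM2l// /qmin minEle.
  have td2 : t ^+ 2 <= d ^+ 2 by rewrite lerXn2r ?nnegrE ?ltW.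
  case: ifP => _; first lra.
  by rewrite mulrDl mul1r lerDl mulr_ge0 ?ltW.
rewrite (le_trans (fB _ _))//.
rewrite -[leLHS]add0r lerD//; first by rewrite !mulr_ge0//; lra.
rewrite -mulrA -[leLHS]mulr1 ler_wpM2l// /qmin minEle.
case: ifP => _; first lra.
have td2 : d ^+ 2 <= t ^+ 2 by rewrite lerXn2r ?nnegrE ?(ltW d0) ?(ltW t0).
rewrite mulrDl mul1r -[leLHS]add0r lerD ?(ltW t20)//.
by rewrite -ler_pdivrMl ?invr_gt0// invrK mulr1.
Qed.

(** The mass of the kernel on [a, oo), by [integral_kern_tail]. Its scaling law [tailmM] makes the
    mass beyond a large multiple of a scale negligible uniformly in that scale. *)
Definition tailm (a : R) : R := a `^ (- (2 * s)) / (2 * s).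

Lemma tailm_gt0 a : 0 < a -> 0 < tailm a.
Proof.
by move=> a0; have /andP[s0 _] := hs; rewrite /tailm divr_gt0 ?powR_gt0//; lra.
Qed.

Lemma tailmM a b : 0 < a -> 0 < b -> tailm (a * b) = a `^ (- (2 * s)) * tailm b.
Proof. by move=> a0 b0; rewrite /tailm powRM ?ltW// mulrA. Qed.

Lemma tailm_small (e : R) : 0 < e ->
  exists2 L : R, 1 < L & forall T, L <= T -> T `^ (- (2 * s)) <= e.
Proof.
move=> e0; have /andP[s0 _] := hs.
have p0 : 0 < 2 * s by lra.
have /cvgrPdist_le /(_ _ e0)[A [_ AP]] := cvg_powRN_pinfty p0.
exists (2 + `|A|) => [|T AT]; first by have := normr_ge0 A; lra.
have /AP : A < T by have := ler_norm A; lra.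
by rewrite sub0r normrN ger0_norm ?powR_ge0.
Qed.

Definition cutR (a : R) : R -> R := fun t => if t < a then 0 else 1.

Lemma adm_cutR a : 0 < a -> adm (1 + a ^- 2) (cutR a).
Proof.
move=> a0; have := @adm_cut 0 1 a (fun=> 0) (fun=> 1) a0 (lexx 0) ler01.
rewrite mul0r add0r mul1r; apply => //.
- by move=> t _; rewrite normr0 mul0r.
- by move=> t _; rewrite normr1.
Qed.

Lemma J_cutR a : 0 < a -> J (cutR a) = tailm a.
Proof.
move=> a0; rewrite /tailm -[RHS]/(fine (_%:E)) -integral_kern_tail//.
rewrite -[RHS]/(\int[mu]_(t in `[a, +oo[) (kern s t)).
have -> : `[a, +oo[%classic = `]0, +oo[ `&` `[a, +oo[ :> set R.
  apply/esym/setIidPr => t; rewrite /= !in_itv /= !andbT => at_.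
  exact: lt_le_trans at_.
rewrite Rintegral_mkcondr; apply: eq_Rintegral => t _.
rewrite /cutR patchE; have [ta|at_] := ltP t a.
  by rewrite memNset ?mul0r// /= in_itv /= andbT leNgt ta.
by rewrite mem_set ?mul1r// /= in_itv /= andbT.
Qed.

Definition cutsq (d : R) : R -> R := fun t => if t < d then t ^+ 2 else 0.

Lemma adm_cutsq d : 0 < d -> adm (1 + d ^+ 2) (cutsq d).
Proof.
move=> d0; have := @adm_cut 1 0 d (fun t => t ^+ 2) (fun=> 0) d0 ler01 (lexx 0).
rewrite mul0r addr0 mul1r; apply => //.
- by move=> t _; rewrite mul1r ger0_norm// sqr_ge0.
- by move=> t _; rewrite normr0.
Qed.

Lemma J_cutsq_le d : 0 < d -> J (cutsq d) <= d `^ (2 - 2 * s) / (2 - 2 * s).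
Proof.
move=> d0; rewrite -lee_fin; apply: le_trans (integral_sqr_kern_le d0).
rewrite /J /Rintegral fineK; last first.
  exact: (integrable_fin_num _ (adm_integrable (adm_cutsq d0))).
have -> : `]0, d]%classic = `]0, +oo[ `&` `]0, d] :> set R.
  apply/esym/setIidPr => t; rewrite /= !in_itv /= !andbT => /andP[]//.
rewrite integral_mkcondr; apply: ge0_le_integral => //=.
- move=> t _; rewrite lee_fin mulr_ge0 ?kern_ge0// /cutsq.
  by case: ifP; rewrite ?sqr_ge0.
- by apply/measurable_EFinP; apply: measurable_mulkern; case: (adm_cutsq d0).
- apply: measurable_funTS; apply/(measurable_restrictT _ _).1 => //.
  apply/measurable_EFinP; apply: measurable_mulkern; exact: measurable_funX.
- move=> t; rewrite in_itv /= andbT => t0; rewrite patchE /cutsq.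
  have [td|dt] := ltP t d; first by rewrite mem_set//= in_itv /= t0 ltW.
  rewrite mul0r; case: ifP => // _.
  by rewrite lee_fin mulr_ge0 ?kern_ge0 ?sqr_ge0.
Qed.

Lemma J_cutsq_ge0 d : 0 <= J (cutsq d).
Proof.
apply: Rintegral_ge0 => t _; rewrite mulr_ge0 ?kern_ge0// /cutsq.
by case: ifP; rewrite ?sqr_ge0.
Qed.

(** Because 2 - 2s > 0, a second difference of size t^2 contributes little near 0; this controls
    both the principal value and the inner integrals in comparison. *)
Lemma J_cutsq_small (e : R) : 0 < e ->
  exists2 d0, 0 < d0 & forall d, 0 < d < d0 -> J (cutsq d) <= e.
Proof.
move=> e0; have /andP[s0 s1] := hs.
have p0 : 0 < 2 - 2 * s by lra.
have ep : 0 < e * (2 - 2 * s) by rewrite mulr_gt0.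
have /cvgrPdist_le /(_ _ ep)[r /= r0 rP] := powR_cvg0 p0.
exists r => // d /andP[d0 dr]; apply: le_trans (J_cutsq_le d0) _.
rewrite ler_pdivrMr//; apply: le_trans (rP d _ d0) => /=; last first.
  by rewrite sub0r normrN gtr0_norm.
by rewrite sub0r normrN ger0_norm// powR_ge0.
Qed.

Lemma le_limn_einf (u : (\bar R)^nat) (c : \bar R) n0 :
  (forall n, (n0 <= n)%N -> (c <= u n)%E) -> (c <= limn_einf u)%E.
Proof.
move=> cu; rewrite limn_einf_lim (cvg_lim (@ereal_hausdorff _) (@cvg_einfs_sup _ u)).
apply: (@le_trans _ _ (einfs u n0)); last by apply: ereal_sup_ubound; exists n0.
by apply: le_ereal_inf_tmp => _ /= [n n0n <-]; exact: cu.
Qed.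

Lemma limn_einf_le (u : (\bar R)^nat) (c : \bar R) n0 :
  (forall n, (n0 <= n)%N -> (u n <= c)%E) -> (limn_einf u <= c)%E.
Proof.
move=> cu; rewrite limn_einf_lim (cvg_lim (@ereal_hausdorff _) (@cvg_einfs_sup _ u)).
apply: ge_ereal_sup => _ [m _ <-].
apply: (@le_trans _ _ (u (maxn n0 m))); last by apply: cu; exact: leq_maxl.
by apply: ereal_inf_lbound; exists (maxn n0 m) => //=; exact: leq_maxr.
Qed.

(** With a common constant C the functions C min(1, t^2) - h_n are nonnegative on the half-line, so
    Fatou's lemma applies to them and the sign reverses its conclusion. Only an upper bound on the
    pointwise limsup is required, which is what upper semicontinuity provides. *)
Lemma J_reverse_fatou (C b : R) (h : nat -> R -> R) (h0 : R -> R) :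
  (forall n, adm C (h n)) -> adm C h0 ->
  (forall t, 0 < t -> forall e, 0 < e ->
     exists n0, forall n, (n0 <= n)%N -> h n t <= h0 t + e) ->
  (forall e, 0 < e -> exists n0, forall n, (n0 <= n)%N -> b - e <= J (h n)) ->
  b <= J h0.
Proof.
move=> ah ah0 hh0 hb.
have aC : adm `|C| (fun t => C * qmin t).
  split; first by apply: measurable_funM => //; exact: measurable_qmin.
  by move=> t t0; rewrite normrM (ger0_norm (qmin_ge0 t)).
pose G (f : R -> R) t := C * qmin t + - f t.
have aG f : adm C f -> adm (`|C| + `|-1| * C) (G f).
  move=> af; apply: adm_add => //.
  by have := adm_scale (-1) af; under eq_fun do rewrite mulN1r.
have JG f : adm C f -> J (G f) = J (fun t => C * qmin t) - J f.
  move=> af; rewrite -(JN af); apply: (JD aC (D := `|-1| * C)).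
  by have := adm_scale (-1) af; under eq_fun do rewrite mulN1r.
have G0 f t : adm C f -> 0 < t -> 0 <= G f t.
  by move=> [_ fC] t0; rewrite /G subr_ge0; exact: le_trans (ler_norm _) (fC _ t0).
have JE f : adm C f -> (\int[mu]_(t in `]0%R, +oo[) (G f t * kern s t)%:E = (J (G f))%:E)%E.
  by move=> af; rewrite /J /Rintegral fineK//; exact: integrable_fin_num (adm_integrable (aG _ af)).
pose F n (t : measurableTypeR R) := (G (h n) t * kern s t)%:E.
pose D : set (measurableTypeR R) := `]0, +oo[%classic.
have mF n : measurable_fun D (F n).
  by apply/measurable_EFinP; apply: measurable_mulkern; case: (aG _ (ah n)).
have F0 n t : D t -> (0 <= F n t)%E.
  rewrite /D /= in_itv /= andbT => t0; rewrite lee_fin mulr_ge0 ?kern_ge0//.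
  exact: G0.
have fat := fatou mu (measurable_itv `]0, +oo[) mF F0.
apply/ler_addgt0Pr => e e0; have [n0 n0P] := hb _ e0.
suff : ((J (G h0))%:E <= (J (fun t => C * qmin t) - (b - e))%:E)%E.
  by rewrite lee_fin JG//; lra.
rewrite -JE//; apply: le_trans.
  apply: le_trans fat.
  apply: ge0_le_integral => //=.
  - move=> t; rewrite in_itv /= andbT => t0; rewrite lee_fin mulr_ge0 ?kern_ge0//.
    exact: G0.
  - by apply/measurable_EFinP; apply: measurable_mulkern; case: (aG _ ah0).
  - apply: measurableT_comp => //; apply: measurable_fun_limn_esup => n.
    exact: measurableT_comp.
  - move=> t; rewrite in_itv /= andbT => t0.
    apply/lee_addgt0Pr => e1 e10.
    (* Dividing by [kern s t + 1] needs only a nonnegative kernel, and multiplying back by the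
       kernel leaves at most e1. *)
    have k1 : 0 < kern s t + 1 by rewrite ltr_wpDl ?kern_ge0.
    have [n1 n1P] := hh0 t t0 (e1 / (kern s t + 1)) (divr_gt0 e10 k1).
    rewrite -leeBlDr//; apply: (@le_limn_einf _ _ n1) => n nn1.
    rewrite /F -EFinB lee_fin lerBlDr.
    apply: (@le_trans _ _ (G (h n) t * kern s t + e1 / (kern s t + 1) * kern s t)).
      by rewrite -mulrDl ler_wpM2r ?kern_ge0// /G; have := n1P n nn1; lra.
    rewrite lerD2l mulrAC ler_pdivrMr// ler_pM2l//; have := kern_ge0 t; lra.
apply: (@limn_einf_le _ _ n0) => n nn0.
rewrite /F JE// lee_fin JG//; have := n0P n nn0; lra.
Qed.

End Kernel.

(** * Euclidean norm and semicontinuity *)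

Section Euclid.
Variables (R : realType) (N : nat).
Local Notation V := 'rV[R]_N.
Implicit Types (x y z : V) (r t : R).

Definition dot x y : R := \sum_(i < N) x ord0 i * y ord0 i.

Lemma dotC x y : dot x y = dot y x.
Proof. by apply: eq_bigr => i _; rewrite mulrC. Qed.

Lemma dotDl x y z : dot (x + y) z = dot x z + dot y z.
Proof. by rewrite -big_split; apply: eq_bigr => i _; rewrite mxE mulrDl. Qed.

Lemma dotZl t x y : dot (t *: x) y = t * dot x y.
Proof. by rewrite mulr_sumr; apply: eq_bigr => i _; rewrite mxE mulrA. Qed.

Lemma dotDr x y z : dot x (y + z) = dot x y + dot x z.
Proof. by rewrite dotC dotDl !(dotC x). Qed.

Lemma dotZr t x y : dot x (t *: y) = t * dot x y.
Proof. by rewrite dotC dotZl dotC. Qed.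

Lemma dotNl x y : dot (- x) y = - dot x y.
Proof. by rewrite -scaleN1r dotZl mulN1r. Qed.

Lemma dotNr x y : dot x (- y) = - dot x y.
Proof. by rewrite dotC dotNl dotC. Qed.

Lemma dot0r x : dot x 0 = 0.
Proof. by rewrite -(scale0r 0) dotZr mul0r. Qed.

Lemma dot_ge0 x : 0 <= dot x x.
Proof. by apply: sumr_ge0 => i _; rewrite -expr2 sqr_ge0. Qed.

Lemma enormE x : enorm x = Num.sqrt (dot x x).
Proof. by congr Num.sqrt; apply: eq_bigr => i _; rewrite expr2. Qed.

Lemma enorm_sqr x : enorm x ^+ 2 = dot x x.
Proof. by rewrite enormE sqr_sqrtr// dot_ge0. Qed.

Lemma enorm_ge0 x : 0 <= enorm x.
Proof. exact: sqrtr_ge0. Qed.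

Lemma enormZ t x : enorm (t *: x) = `|t| * enorm x.
Proof.
by rewrite !enormE dotZl dotZr mulrA -expr2 sqrtrM ?sqr_ge0// sqrtr_sqr.
Qed.

Lemma enormN x : enorm (- x) = enorm x.
Proof. by rewrite -scaleN1r enormZ normrN1 mul1r. Qed.

Lemma enorm0 : enorm (0 : V) = 0.
Proof. by rewrite -(scale0r 0) enormZ normr0 mul0r. Qed.

Lemma enormBC x y : enorm (x - y) = enorm (y - x).
Proof. by rewrite -enormN opprB. Qed.

Lemma coord_le_enorm x i : `|x ord0 i| <= enorm x.
Proof.
rewrite -sqrtr_sqr enormE ler_sqrt ?dot_ge0// /dot (bigD1 i)//= -expr2 lerDl.
by apply: sumr_ge0 => j _; rewrite -expr2 sqr_ge0.
Qed.

Lemma enorm_eq0 x : enorm x = 0 -> x = 0.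
Proof.
move=> x0; apply/rowP => i; rewrite mxE; apply/eqP; rewrite -normr_le0 -x0.
exact: coord_le_enorm.
Qed.

Lemma cauchy_schwarz x y : `|dot x y| <= enorm x * enorm y.
Proof.
have [y0|yn0] := eqVneq (enorm y) 0.
  by rewrite (enorm_eq0 y0) -(scale0r 0) dotZr mul0r normr0 mulr_ge0 ?enorm_ge0.
have yp : 0 < enorm y by rewrite lt_def yn0 enorm_ge0.
have := dot_ge0 (enorm y ^+ 2 *: x - dot x y *: y).
rewrite dotDl !dotDr !dotNl !dotNr !dotZl !dotZr -!enorm_sqr (dotC y x).
set c := dot x y => h.
rewrite -(@ler_pXn2r _ 2) ?nnegrE ?mulr_ge0 ?enorm_ge0// real_normK ?num_real//.
rewrite exprMn -(ler_pM2l (exprn_gt0 2 yp)); nra.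
Qed.

Lemma ler_enormD x y : enorm (x + y) <= enorm x + enorm y.
Proof.
rewrite -(@ler_pXn2r _ 2) ?nnegrE ?addr_ge0 ?enorm_ge0//.
rewrite enorm_sqr dotDl !dotDr (dotC y x) -!enorm_sqr.
have := cauchy_schwarz x y; have := ler_norm (dot x y); nra.
Qed.

Lemma ler_enormB x y z : enorm (x - z) <= enorm (x - y) + enorm (y - z).
Proof. by have := ler_enormD (x - y) (y - z); rewrite addrA subrK. Qed.

Lemma norm_le_enorm x : `|x| <= enorm x.
Proof.
rewrite [leLHS]/Num.Def.normr /= mx_normrE; apply: bigmax_le; first exact: enorm_ge0.
by move=> [i j] _ /=; rewrite ord1 coord_le_enorm.
Qed.

Lemma enorm_le_norm x : enorm x <= N%:R * `|x|.
Proof.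
have c i : `|x ord0 i| <= `|x|.
  by rewrite [leRHS]/Num.Def.normr /= mx_normrE; apply/bigmax_geP; right; exists (ord0, i).
rewrite -(@ler_pXn2r _ 2) ?nnegrE ?mulr_ge0 ?enorm_ge0//.
rewrite enorm_sqr /dot (@le_trans _ _ (\sum_(i < N) `|x| ^+ 2))//.
  apply: ler_sum => i _; rewrite -expr2 -real_normK ?num_real//.
  by rewrite lerXn2r ?nnegrE.
rewrite sumr_const card_ord exprMn -[leLHS]mulr_natl ler_wpM2r ?sqr_ge0//.
by rewrite -natrX ler_nat; case: N => // n; rewrite expnS expn1 leq_pmull.
Qed.

Lemma nbhs_eball (x : V) r : 0 < r -> nbhs x (eball x r).
Proof.
move=> r0; have N0 : 0 < N%:R + 1 :> R by rewrite ltr_wpDl.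
apply/nbhs_ballP; exists (r / (N%:R + 1)) => /=; first by rewrite divr_gt0.
move=> y; rewrite -ball_normE /ball_ /= distrC ltr_pdivlMr// => h.
rewrite /eball /=; apply: le_lt_trans (enorm_le_norm _) _.
by apply: le_lt_trans h; rewrite mulrC ler_wpM2l// lerDl.
Qed.

(** The ambient topology is that of the sup norm, comparable to the Euclidean one up to a factor N,
    so neighbourhoods can be tested on Euclidean balls. *)
Lemma nbhs_eballP (x : V) (A : set V) :
  nbhs x A <-> exists2 r, 0 < r & eball x r `<=` A.
Proof.
split=> [/nbhs_ballP[r /= r0 rA]|[r r0 rA]]; last first.
  exact: filterS rA (nbhs_eball _ r0).
exists r => // y; rewrite /eball /= => yr; apply: rA => /=.
rewrite -ball_normE /ball_ /= distrC; apply: le_lt_trans yr; exact: norm_le_enorm.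
Qed.

Lemma eball_center x r : 0 < r -> eball x r x.
Proof. by rewrite /eball /= subrr enorm0. Qed.

Lemma continuousVP (f : V -> R) : continuous f <->
  forall x e, 0 < e -> exists2 r, 0 < r & forall y, eball x r y -> `|f x - f y| < e.
Proof.
split=> [cf x e e0|cf x].
  have FF : Filter (nbhs x) := nbhs_filter (x : V).
  by have /cvgrPdist_lt /(_ _ e0) /nbhs_eballP := cf x.
have FF : Filter (nbhs x) := nbhs_filter (x : V).
by apply/cvgrPdist_lt => e e0; apply/nbhs_eballP; exact: cf.
Qed.

Lemma continuous_enormB (p : V) : continuous (fun y : V => enorm (y - p)).
Proof.
apply/continuousVP => x e e0; exists e => // y; rewrite /eball /= => xy.
apply: le_lt_trans xy; rewrite ler_norml.
have := ler_enormB x y p; have := ler_enormB y x p; rewrite (enormBC x y); lra.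
Qed.

Definition ecball (p : V) r : set V := [set y | enorm (y - p) <= r].

Lemma compact_ecball p r : compact (ecball p r).
Proof.
apply: bounded_closed_compact.
  exists (r + enorm p); split; first exact: num_real.
  move=> M rM y /= yp; apply: le_trans (norm_le_enorm _) _.
  have := ler_enormD (y - p) p; rewrite subrK; move: yp rM; rewrite /ecball /=; lra.
rewrite [X in closed X](_ : _ = (fun y => enorm (y - p)) @^-1` [set t | t <= r])//.
by apply: closed_comp => [? _|]; [exact: continuous_enormB|exact: closed_le].
Qed.

Lemma compact_sphere : compact (@sphere R N).
Proof.
rewrite [X in compact X](_ : _ = ecball 0 1 `&` [set z | enorm (z - 0) = 1]); last first.
  apply/seteqP; split=> z; rewrite /sphere /ecball /= subr0; last by case.
  by move=> ->.
apply: compact_closedI; first exact: compact_ecball.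
rewrite [X in closed X](_ : _ = (fun y : V => enorm (y - 0)) @^-1` [set t | t = 1])//.
by apply: closed_comp => [? _|]; [exact: continuous_enormB|exact: closed_eq].
Qed.

Lemma continuous_line x z : continuous (fun t : R => x + t *: z).
Proof.
move=> t; apply: cvgD; first exact: cvg_cst.
by apply: cvgZr_tmp; exact: cvg_id.
Qed.

End Euclid.

Section Semicontinuity.
Variables (R : realType) (N : nat).
Local Notation V := 'rV[R]_N.
(** If the supremum S were not attained, f would be below (f x + S) / 2 near each x of K, and
    compactness would give a single c < S bounding f on K. The space is general because the lemma is
    also applied to pairs of points. *)
Lemma usc_max_compact (T : topologicalType) (K : set T) (f : T -> R) (M : R) :
  compact K -> K !=set0 -> (forall x, K x -> f x <= M) ->
  (forall x a, K x -> f x < a -> \forall y \near x, f y < a) ->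
  exists2 x, K x & forall y, K y -> f y <= f x.
Proof.
move=> cK [k0 Kk0] fM fusc; apply: contrapT => nex.
pose S := sup (f @` K).
have hS : has_sup (f @` K).
  by split; [exists (f k0), k0|exists M => _ [x Kx <-]; exact: fM].
have fS x : K x -> f x < S.
  move=> Kx; rewrite lt_neqAle; apply/andP; split; last first.
    by apply: ub_le_sup; [case: hS|exists x].
  apply/eqP => fxS; apply: nex; exists x => // y Ky; rewrite fxS.
  by apply: ub_le_sup; [case: hS|exists y].
have : \forall c \near S^'-, K `<=` (fun x => f x < c).
  move/compact_near_coveringP : cK; apply => x Kx.
  have [m1 m2] := midf_lt (fS _ Kx).
  near=> y c => /=; apply: (@lt_trans _ _ ((f x + S) / 2)).
    by near: y; exact: fusc.
  by near: c; exact: nbhs_left_gt.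
move=> near_c; near S^'- => c.
have fc : K `<=` (fun x => f x < c) by near: c.
have : S <= c by apply: ge_sup; [case: hS|move=> _ [x Kx <-]; exact/ltW/fc].
by apply/negP; rewrite -ltNge; near: c; exact: nbhs_left_lt.
Unshelve. all: by end_near. Qed.

Implicit Types (x y z : V) (r t : R).

Lemma usc_near (u : V -> R) x a : usc u -> u x < a -> \forall y \near x, u y < a.
Proof.
move=> uu xa; have := uu x (a - u x); rewrite subr_gt0 => /(_ xa)[r r0 rP].
by apply/nbhs_eballP; exists r => // y /rP; rewrite addrC subrK.
Qed.

Lemma near_usc (u : V -> R) :
  (forall x a, u x < a -> \forall y \near x, u y < a) -> usc u.
Proof.
by move=> uu x e e0; apply/nbhs_eballP; apply: uu; rewrite ltrDl.
Qed.

Lemma lscN (u : V -> R) : lsc u -> usc (fun x => - u x).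
Proof.
by move=> lu x e /(lu x)[r r0 rP]; exists r => // y /rP; lra.
Qed.

Lemma uscN (u : V -> R) : usc u -> lsc (fun x => - u x).
Proof.
by move=> lu x e /(lu x)[r r0 rP]; exists r => // y /rP; lra.
Qed.

(** Strict sublevel sets are open, and so are their preimages under the line; semicontinuity thus
    suffices for every integrand to be measurable. *)
Lemma usc_line (u : V -> R) x z : usc u ->
  measurable_fun [set: R] (fun t => u (x + t *: z)).
Proof.
move=> uu; apply: (measurability _ (RGenInftyO.measurableE R)) => //.
move=> /= _ [_ [a ->] <-]; rewrite setTI.
rewrite [X in measurable X](_ : _ = (fun t => x + t *: z) @^-1` [set y | u y < a]); last first.
  by apply/seteqP; split=> t; rewrite /= in_itv.
apply: open_measurable; apply: open_comp => [t _|]; first exact: continuous_line.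
by rewrite openE => y /= ya; exact: usc_near.
Qed.

Lemma lsc_line (u : V -> R) x z : lsc u ->
  measurable_fun [set: R] (fun t => u (x + t *: z)).
Proof.
move=> /lscN /(@usc_line _ x z) m.
rewrite (_ : (fun t => _) = -%R \o (fun t => - u (x + t *: z))).
  exact: measurableT_comp.
by apply/funext => t /=; rewrite opprK.
Qed.

Lemma continuous_usc (u : V -> R) : continuous u -> usc u.
Proof.
move=> /continuousVP cu x e e0; have [r r0 rP] := cu x e e0.
by exists r => // y /rP; rewrite ltr_norml => /andP[]; lra.
Qed.

Lemma continuous_lsc (u : V -> R) : continuous u -> lsc u.
Proof.
move=> /continuousVP cu x e e0; have [r r0 rP] := cu x e e0.
by exists r => // y /rP; rewrite ltr_norml => /andP[]; lra.
Qed.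

Lemma usc_lsc_continuous (u : V -> R) : usc u -> lsc u -> continuous u.
Proof.
move=> uu lu; apply/continuousVP => x e e0.
have [r r0 rP] := uu x e e0; have [r' r'0 rP'] := lu x e e0.
exists (Num.min r r'); first by rewrite lt_min r0.
move=> y; rewrite /eball /= lt_min => /andP[/rP h /rP' h'].
by rewrite ltr_norml; apply/andP; split; lra.
Qed.

End Semicontinuity.

(** * Second differences of test functions *)

Section DirectionalDerivatives.
Variables (R : realType) (N : nat).
Local Notation V := 'rV[R]_N.
Implicit Types (x y z w : V) (r t : R) (f : V -> R).

Lemma is_derive_lineP f x z t (l : R) :
  is_derive t 1 (fun t => f (x + t *: z)) l <-> is_derive (x + t *: z) z f l.
Proof.
have E : (fun h : R => h^-1 *: (((fun t => f (x + t *: z)) \o shift t) (h *: 1) -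
       f (x + t *: z))) = (fun h : R => h^-1 *: ((f \o shift (x + t *: z)) (h *: z)
         - f (x + t *: z))).
  apply/funext => h /=; congr (_ *: (f _ - _)).
  by rewrite [h *: 1]mulr1 scalerDl addrCA.
split=> -[d D]; split.
- by move: d; rewrite /derivable E.
- by move: D; rewrite /derive E.
- by rewrite /derivable E.
- by rewrite /derive E.
Qed.

Lemma is_derive_dirZ f x z a (l : R) :
  is_derive x z f l -> is_derive x (a *: z) f (a * l).
Proof.
move=> h.
have /is_derive_lineP h0 : is_derive (x + 0 *: z) z f l by rewrite scale0r addr0.
rewrite -[x]addr0 -(scale0r (a *: z)); apply/is_derive_lineP.
have -> : (fun t => f (x + t *: (a *: z))) = (fun t => f (x + t *: z)) \o (fun t => a * t).
  by apply/funext => t /=; rewrite scalerA mulrC.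
have h0' : is_derive (a * 0) 1 (fun t : R => f (x + t *: z)) l by rewrite mulr0.
have ha : is_derive (0 : R) 1 (fun t : R => a * t) a.
  by apply: is_derive_eq; rewrite /GRing.scale /= mulr1.
have := is_derive1_comp h0' ha.
by rewrite mulrC.
Qed.

(** The increment along h(z + w) is split at x + hz. The second half is treated by the mean value
    theorem and continuity of the derivative along w, so along z nothing beyond differentiability at
    x is assumed: the form required by an induction on coordinates. *)
Lemma is_derive_dirD f x z w (l : R) : is_derive x z f l ->
  (forall y, derivable f y w) -> continuous ('D_w f) ->
  is_derive x (z + w) f (l + 'D_w f x).
Proof.
move=> dz dw /continuousVP cw.
suff : h^-1 *: (f (h *: (z + w) + x) - f x) @[h --> (0:R)^'] --> l + 'D_w f x.
  move=> H; split; first by apply/cvg_ex; eexists; exact: H.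
  exact: cvg_lim H.
have Hz : h^-1 *: (f (h *: z + x) - f x) @[h --> (0:R)^'] --> l.
  by case: dz => d <-; exact: d.
suff Hw : h^-1 *: (f (h *: (z + w) + x) - f (h *: z + x)) @[h --> (0:R)^'] --> 'D_w f x.
  apply: cvg_trans (cvgD Hz Hw); apply: near_eq_cvg; near=> h => /=.
  by rewrite !fctE -scalerDr addrC subrKA.
apply/cvgrPdist_lt => e e0; have [r r0 rP] := cw x e e0.
have W0 : 0 < enorm z + enorm w + 1 by rewrite ltr_wpDl ?addr_ge0 ?enorm_ge0.
near=> h.
have h0 : h != 0 by near: h; exact: nbhs_dnbhs_neq.
pose g t := f (h *: z + x + t *: w).
have dg t : is_derive t 1 g ('D_w f (h *: z + x + t *: w)).
  by apply/is_derive_lineP; exact: derivableP.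
have cg a b : {within `[a, b], continuous g}.
  by apply: derivable_within_continuous => t _; case: (dg t).
have [c cr ->] : exists2 c, `|c| <= `|h| &
    h^-1 *: (f (h *: (z + w) + x) - f (h *: z + x)) = 'D_w f (h *: z + x + c *: w).
  have -> : f (h *: (z + w) + x) = g h by rewrite /g scalerDr addrAC.
  have -> : f (h *: z + x) = g 0 by rewrite /g scale0r addr0.
  have [h1|h1|h1] := ltgtP h 0; last by rewrite h1 eqxx in h0.
  - have [c] := MVT h1 (fun t _ => dg t) (cg _ _); rewrite in_itv /= => /andP[c1 c2] E.
    exists c; first by rewrite (ltr0_norm c2) (ltr0_norm h1); lra.
    by rewrite -opprB E /GRing.scale /=; field.
  - have [c] := MVT h1 (fun t _ => dg t) (cg _ _); rewrite in_itv /= => /andP[c1 c2] E.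
    exists c; first by rewrite !gtr0_norm//; lra.
    by rewrite E /GRing.scale /= subr0 mulrCA mulVf// mulr1.
apply: rP; rewrite /eball /=.
rewrite (_ : h *: z + x + c *: w - x = h *: z + c *: w); last first.
  by rewrite addrAC addrK.
apply: le_lt_trans (ler_enormD _ _) _; rewrite !enormZ.
apply: (@le_lt_trans _ _ (`|h| * (enorm z + enorm w))).
  by rewrite mulrDr lerD2l ler_wpM2r ?enorm_ge0.
have hr : `|h| < r / (enorm z + enorm w + 1).
  by near: h; apply: dnbhs0_lt; rewrite divr_gt0.
rewrite ltr_pdivlMr// in hr; apply: le_lt_trans hr.
by rewrite ler_wpM2l// lerDl.
Unshelve. all: by end_near. Qed.

(** [C2] speaks of partial derivatives only; this recovers all directional derivatives by adding the
    coordinates of z one at a time. *)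
Lemma is_derive_partials f x z :
  (forall i y, derivable f y (e_ R i)) -> (forall i, continuous ('D_(e_ R i) f)) ->
  is_derive x z f (\sum_(i < N) z ord0 i * 'D_(e_ R i) f x).
Proof.
move=> df cf.
rewrite {1}(row_sum_delta z).
elim: (index_enum _) => [|i r IH]; first by rewrite !big_nil; exact: is_derive0.
rewrite !big_cons [X in is_derive _ X](addrC) [X in is_derive _ _ _ X]addrC.
have dZ y : is_derive y (z ord0 i *: delta_mx ord0 i) f (z ord0 i * 'D_(e_ R i) f y).
  by apply: is_derive_dirZ; exact: (derivableP (df i y)).
have E y : 'D_(z ord0 i *: delta_mx ord0 i) f y = z ord0 i * 'D_(e_ R i) f y.
  by have [] := dZ y.
rewrite -E; apply: is_derive_dirD => //.
apply/continuousVP => y e e0.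
have a0 : 0 < `|z ord0 i| + 1 by rewrite ltr_wpDl.
have /continuousVP/(_ y _ (divr_gt0 e0 a0))[d d0 dP] := cf i.
exists d => // y' /dP; rewrite !E -mulrBr normrM ltr_pdivlMr//.
by apply: le_lt_trans; rewrite mulrC ler_wpM2l// lerDl.
Qed.

Lemma continuous_bounded_ecball f p r : continuous f ->
  exists2 B, 0 <= B & forall y, ecball p r y -> `|f y| <= B.
Proof.
move=> /continuousVP cf.
have [r0|r0] := leP 0 r; last first.
  by exists 0 => // y; rewrite /ecball /=; have := enorm_ge0 (y - p); lra.
have : \forall B \near +oo, ecball p r `<=` (fun y => `|f y| <= B).
  have /compact_near_coveringP := @compact_ecball R N p r; apply => x _.
  have [d d0 dP] := cf x 1 ltr01.
  near=> y B => /=; apply: (@le_trans _ _ (`|f x| + 1)).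
    have : `|f x - f y| < 1 by apply: dP; near: y; exact: nbhs_eball.
    have := ler_normD (f y - f x) (f x); rewrite subrK distrC; lra.
  by near: B; exact: nbhs_pinfty_ge.
move=> nB; near +oo_R => B; exists B; last by near: B.
by near: B; exact: nbhs_pinfty_ge.
Unshelve. all: by end_near. Qed.

(* Second difference along z, with c in place of f(x). *)
Definition dd f (c : R) x z t : R := f (x + t *: z) + f (x - t *: z) - 2 * c.

(** The constant is uniform in the point, the direction and t within a ball, because the stability
    argument lets point and direction move while passing to the limit. *)
Lemma dd_C2_le f p r : C2 f -> exists2 C, 0 <= C &
  forall x z t, sphere z -> 0 < t -> enorm (x - p) + t <= r ->
    `|dd f (f x) x z t| <= C * t ^+ 2.
Proof.
case=> cf df cdf ddf cddf.
have [B B0 BP] : exists2 B, 0 <= B & forall i j y, ecball p r y ->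
    `|'D_(e_ R j) ('D_(e_ R i) f) y| <= B.
  have h (ij : 'I_N * 'I_N) := continuous_bounded_ecball p r (cddf ij.1 ij.2).
  pose b ij := sval (cid2 (h ij)).
  have bP ij : 0 <= b ij /\ forall y, ecball p r y ->
      `|'D_(e_ R ij.2) ('D_(e_ R ij.1) f) y| <= b ij.
    by rewrite /b; case: cid2.
  exists (\sum_ij b ij); first by apply: sumr_ge0 => ij _; case: (bP ij).
  move=> i j y yr; apply: le_trans ((bP (i, j)).2 y yr) _.
  by rewrite (bigD1 (i, j))//= lerDl; apply: sumr_ge0 => ij _; case: (bP ij).
(* [G z] and [H z] are the first and second derivatives along z; [H z] is bounded by the sum K of
   the bounds B, as coordinates of a unit vector are at most 1 in modulus. *)
pose G z y := \sum_(i < N) z ord0 i * 'D_(e_ R i) f y.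
pose H z y := \sum_(i < N) z ord0 i * \sum_(j < N) z ord0 j * 'D_(e_ R j) ('D_(e_ R i) f) y.
have dG z y : is_derive y z (G z) (H z y).
  rewrite (_ : G z = \sum_(i < N) (fun y => z ord0 i * 'D_(e_ R i) f y)); last first.
    by apply/funext => y'; rewrite fct_sumE.
  rewrite /H; apply: is_derive_sum => i.
  have h := is_derive_partials y z (ddf i) (cddf i).
  by apply: is_derive_eq; rewrite /GRing.scale.
have GN z y : G (- z) y = - G z y.
  by rewrite /G -sumrN; apply: eq_bigr => i _; rewrite mxE mulNr.
pose K := \sum_(i < N) \sum_(j < N) B.
have K0 : 0 <= K by apply: sumr_ge0 => i _; apply: sumr_ge0.
have HK z y : sphere z -> ecball p r y -> `|H z y| <= K.
  move=> z1 yr; have zi i : `|z ord0 i| <= 1.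
    by rewrite -[leRHS](z1 : enorm z = 1) coord_le_enorm.
  apply: le_trans (ler_norm_sum _ _ _) _; apply: ler_sum => i _.
  rewrite normrM -[leRHS]mul1r ler_pM//.
  apply: le_trans (ler_norm_sum _ _ _) _; apply: ler_sum => j _.
  by rewrite normrM -[leRHS]mul1r ler_pM// BP.
exists (2 * K) => [|x z t z1 t0 xt]; first by rewrite mulr_ge0.
have inball c : `|c| <= t -> ecball p r (x + c *: z).
  move=> ct; rewrite /ecball /= addrAC; apply: le_trans (ler_enormD _ _) _.
  by rewrite enormZ (z1 : enorm z = 1) mulr1; lra.
have dg (c : R) : is_derive c 1 (fun c : R => G z (x + c *: z)) (H z (x + c *: z)).
  exact/is_derive_lineP.
have gb c : 0 < c <= t -> `|G z (x + c *: z) - G z (x + (- c) *: z)| <= 2 * K * t.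
  move=> /andP[c0 ct]; have cc : - c < c by lra.
  have [|c' ] := MVT cc (fun c _ => dg c).
    by apply: derivable_within_continuous => t' _; case: (dg t').
  rewrite in_itv /= => /andP[h1 h2] ->.
  rewrite normrM (@ger0_norm _ (c - - c)); last by lra.
  have ctt : `|c'| <= t by rewrite ler_norml; apply/andP; split; lra.
  by have := HK z _ z1 (inball c' ctt); nra.
(* The derivative of P is a difference of first derivatives at x + cz and x - cz, bounded by 2 K t
   through one mean value theorem; a second one, on P itself, supplies the other factor t. *)
pose P c := f (x + c *: z) + f (x + c *: (- z)).
have dP (c : R) : is_derive c 1 P (G z (x + c *: z) - G z (x + (- c) *: z)).
  have h1 : is_derive c 1 (fun c : R => f (x + c *: z)) (G z (x + c *: z)).
    by apply/is_derive_lineP; exact: is_derive_partials.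
  have h2 : is_derive c 1 (fun c : R => f (x + c *: (- z))) (- G z (x + (- c) *: z)).
    rewrite -GN scaleNr -scalerN.
    by apply/is_derive_lineP; exact: is_derive_partials.
  exact: is_deriveD.
have [|c] := MVT t0 (fun c _ => dP c).
  by apply: derivable_within_continuous => t' _; case: (dP t').
rewrite in_itv /= => /andP[c0 ct] E.
have -> : dd f (f x) x z t = P t - P 0.
  by rewrite /dd /P !scale0r !addr0 scalerN; lra.
rewrite E subr0 normrM (gtr0_norm t0) expr2 mulrA ler_pM2r//.
by apply: gb; rewrite c0 ltW.
Qed.

Lemma measurable_dd (w : V -> R) x z (c : R) : usc w \/ lsc w ->
  measurable_fun [set: R] (dd w c x z).
Proof.
move=> h; have m z' : measurable_fun [set: R] (fun t => w (x + t *: z')).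
  by case: h => h; [exact: usc_line|exact: lsc_line].
apply: measurable_funB => //; apply: measurable_funD => //.
by have := m (- z); under eq_fun do rewrite scalerN.
Qed.

Lemma is_derive_coord x (v : V) i : is_derive x v (fun y : V => y ord0 i) (v ord0 i).
Proof.
suff H : h^-1 *: ((h *: v + x) ord0 i - x ord0 i) @[h --> (0:R)^'] --> v ord0 i.
  split; first by apply/cvg_ex; eexists; exact: H.
  exact: cvg_lim H.
apply: cvg_trans (@cvg_cst _ (v ord0 i) _ (0:R)^' _).
apply: near_eq_cvg; near=> h => /=.
have h0 : h != 0 by near: h; exact: nbhs_dnbhs_neq.
by rewrite !mxE addrK /GRing.scale /= mulrA mulVf// mul1r.
Unshelve. all: by end_near. Qed.

Lemma continuous_coord i : continuous (fun y : V => y ord0 i).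
Proof.
apply/continuousVP => x e e0; exists e => // y; rewrite /eball /=.
apply: le_lt_trans; rewrite distrC.
by have := coord_le_enorm (y - x) i; rewrite !mxE.
Qed.

Lemma continuous_dot (b : V) : continuous (dot b).
Proof.
apply/continuousVP => x e e0.
have b0 : 0 < enorm b + 1 by rewrite ltr_wpDl ?enorm_ge0.
exists (e / (enorm b + 1)); first by rewrite divr_gt0.
move=> y; rewrite /eball /= ltr_pdivlMr// => h.
rewrite -dotNr -dotDr; apply: le_lt_trans (cauchy_schwarz _ _) _.
apply: le_lt_trans h; rewrite enormBC mulrC ler_wpM2l ?enorm_ge0//; lra.
Qed.

(** One family for all explicit tests: a = 0 gives the linear tests at the boundary, b = 0 the
    penalties of comparison and stability. *)
Definition quad (a : R) (b p : V) (y : V) : R := a * dot (y - p) (y - p) + dot b y.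

Lemma is_derive_quad a b p y i :
  is_derive y (e_ R i) (quad a b p) (2 * a * (y ord0 i - p ord0 i) + b ord0 i).
Proof.
rewrite (_ : quad a b p = \sum_(j < N) (fun y : V =>
   a * (y ord0 j - p ord0 j) ^+ 2 + b ord0 j * y ord0 j)); last first.
  apply/funext => y'; rewrite fct_sumE /quad /dot mulr_sumr -big_split /=.
  by apply: eq_bigr => j _; rewrite !mxE.
rewrite (_ : 2 * a * _ + _ = \sum_(j < N) ((2 * a * (y ord0 j - p ord0 j) + b ord0 j) * (i == j)%:R)); last first.
  rewrite (bigD1 i)//= eqxx mulr1 big1 ?addr0// => j ij.
  by rewrite eq_sym (negbTE ij) mulr0.
apply: is_derive_sum => j.
have h := is_derive_coord y (e_ R i) j; rewrite /e_ mxE eqxx /= eq_sym in h.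
apply: is_derive_eq; rewrite /GRing.scale /=; ring.
Qed.

Lemma derive_quad a b p i :
  'D_(e_ R i) (quad a b p) = fun y => 2 * a * (y ord0 i - p ord0 i) + b ord0 i.
Proof. by apply/funext => y; have [] := is_derive_quad a b p y i. Qed.

Lemma is_derive_quad2 a b p y i j :
  is_derive y (e_ R j) ('D_(e_ R i) (quad a b p)) (2 * a * (i == j)%:R).
Proof.
rewrite derive_quad.
have h := is_derive_coord y (e_ R j) i; rewrite /e_ mxE eqxx /= in h.
apply: is_derive_eq; rewrite /GRing.scale /=; ring.
Qed.

Lemma C2_quad a b p : C2 (quad a b p).
Proof.
have cc i : continuous (fun y : V => y ord0 i) := @continuous_coord i.
split.
- have E : quad a b p = fun y => a * enorm (y - p) ^+ 2 + dot b y.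
    by apply/funext => y; rewrite /quad enorm_sqr.
  rewrite E => y; have FF : Filter (nbhs y) := nbhs_filter (y : V).
  apply: cvgD; last exact: continuous_dot.
  apply: cvgMl_tmp; rewrite expr2; under eq_cvg do rewrite expr2.
  by apply: cvgM; exact: continuous_enormB.
- by move=> i x; have [] := is_derive_quad a b p x i.
- move=> i; rewrite derive_quad => y.
  have FF : Filter (nbhs y) := nbhs_filter (y : V).
  apply: cvgD; last exact: cvg_cst.
  by apply: cvgMl_tmp; apply: cvgD; [exact: cc|exact: cvg_cst].
- by move=> i j x; have [] := is_derive_quad2 a b p x i j.
- move=> i j; rewrite (_ : 'D_(e_ R j) _ = fun=> 2 * a * (i == j)%:R).
    by apply/continuousVP => x e e0; exists 1 => // y _; rewrite subrr normr0.
  by apply/funext => y; have [] := is_derive_quad2 a b p y i j.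
Qed.

End DirectionalDerivatives.

(** * Directional integrals *)

Section Reflection.
Variables (R : realType) (s : R).
Hypothesis hs : 0 < s < 1.
Local Notation mu := (@lebesgue_measure R).

Lemma ge0_integral_opp (A : set (measurableTypeR R)) (f : R -> \bar R) : measurable A ->
  measurable_fun [set: R] f -> (forall t, 0 <= f t)%E ->
  (\int[mu]_(t in A) f t = \int[mu]_(t in (-%R : _ -> measurableTypeR R) @^-1` A) f (- t)%R)%E.
Proof.
move=> mA mf f0.
transitivity (\int[pushforward mu (-%R : _ -> measurableTypeR R)]_(t in A) f t)%E.
  by apply: eq_measure_integral => //= B mB _; exact/esym/lebesgue_measureN.
by rewrite ge0_integral_pushforward//=; exact: measurable_funS mf.
Qed.

Lemma integral_opp (A : set (measurableTypeR R)) (f : R -> \bar R) : measurable A ->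
  measurable_fun [set: R] f ->
  mu.-integrable ((-%R : _ -> measurableTypeR R) @^-1` A) (f \o -%R) ->
  (\int[mu]_(t in A) f t = \int[mu]_(t in (-%R : _ -> measurableTypeR R) @^-1` A) f (- t)%R)%E.
Proof.
move=> mA mf fi.
transitivity (\int[pushforward mu (-%R : _ -> measurableTypeR R)]_(t in A) f t)%E.
  by apply: eq_measure_integral => //= B mB _; exact/esym/lebesgue_measureN.
by rewrite integral_pushforward.
Qed.

(** The symmetric domain is the union of its positive part A and the reflection of A, and the second
    integral is folded onto A. Admissibility of each half separately makes additivity legitimate. *)
Lemma Rintegral_sym (a : pred R) (F : R -> R) C1 C2 :
  measurable [set t | a t] -> (forall t, a t -> 0 < t) ->
  measurable_fun [set: R] F ->
  adm C1 (fun t => if a t then F t else 0) ->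
  adm C2 (fun t => if a t then F (- t) else 0) ->
  \int[mu]_(t in [set t | a `|t|]) (F t * kern s t) =
  J s (fun t => if a t then F t + F (- t) else 0).
Proof.
move=> mA a0 mF a1 a2.
pose A : set (measurableTypeR R) := [set t | a t].
have {}mA : measurable A := mA.
pose B : set (measurableTypeR R) := (-%R : _ -> measurableTypeR R) @^-1` A.
have mB : measurable B.
  by rewrite -[B]setTI; exact: (@oppr_measurable R setT).
have i1 : mu.-integrable A (EFin \o (fun t => F t * kern s t)).
  have sA : A `<=` `]0, +oo[ by move=> t /a0; rewrite /= in_itv /= andbT.
  have := adm_integrable hs a1.
  move=> /integrableS => /(_ A (measurable_itv _) mA sA).
  apply: eq_integrable => // t; rewrite inE /A /= => at_.
  by rewrite at_.
have i2 : mu.-integrable A (EFin \o (fun t => F (- t) * kern s t)).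
  have sA : A `<=` `]0, +oo[ by move=> t /a0; rewrite /= in_itv /= andbT.
  have := adm_integrable hs a2.
  move=> /integrableS => /(_ A (measurable_itv _) mA sA).
  apply: eq_integrable => // t; rewrite inE /A /= => at_.
  by rewrite at_.
have mFN : measurable_fun [set: R] (fun t => F (- t)).
  by apply: measurableT_comp.
have mk (G : R -> R) : measurable_fun [set: R] G ->
    measurable_fun [set: R] (EFin \o (fun t => G t * kern s t)).
  by move=> mG; apply/measurable_EFinP; exact: measurable_mulkern.
have E : (EFin \o (fun t => F t * kern s t)) =
    (fun t => (EFin \o (fun t => F (- t) * kern s t)) (- t)).
  by apply/funext => t; rewrite /= opprK kernN.
have i3 : mu.-integrable B (EFin \o (fun t => F t * kern s t)).
  apply/integrableP; split; first by apply: measurable_funTS; exact: mk.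
  have /integrableP[_] := i2; apply: le_lt_trans.
  have m2 : measurable_fun [set: R] (fun t => `|(F (- t) * kern s t)%:E|%E).
    by apply: measurableT_comp => //; exact: (mk _ mFN).
  have := ge0_integral_opp mA m2 (fun t => abse_ge0 _) => /= ->.
  by under [leRHS]eq_integral do rewrite opprK kernN.
have -> : [set t | a `|t|] = A `|` B.
  apply/seteqP; split=> t; rewrite /A /B /=.
    by case: (leP 0 t) => t0; [rewrite ger0_norm//; left|rewrite ltr0_norm//; right].
  by case=> [at_|at_]; [rewrite gtr0_norm// a0|rewrite ltr0_norm// -oppr_gt0 a0].
have iU : mu.-integrable (A `|` B) (EFin \o (fun t => F t * kern s t)).
  apply/integrableP; split; first by apply: measurable_funTS; exact: mk.
  have AB0 : [disjoint A & B].
    apply/disj_setPS => t [/= At Bt].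
    have := a0 _ At; have := a0 _ Bt; lra.
  rewrite ge0_integral_setU//; last by apply: measurableT_comp => //; apply: measurable_funTS; exact: mk.
  by apply: lte_add_pinfty; [have /integrableP[] := i1|have /integrableP[] := i3].
rewrite Rintegral_setU//; last first.
  apply/disj_setPS => t [/= At Bt].
  have := a0 _ At; have := a0 _ Bt; lra.
have -> : \int[mu]_(x in B) (F x * kern s x) = \int[mu]_(x in A) (F (- x) * kern s x).
  rewrite /Rintegral; congr fine.
  have i3' := i3; rewrite E in i3'.
  have := integral_opp mA (mk _ mFN) i3' => /= ->.
  by apply: eq_integral => t _; rewrite /= opprK kernN.
rewrite -RintegralD//.
have -> : A = `]0, +oo[ `&` A.
  by apply/esym/setIidPr => t /a0; rewrite /= in_itv /= andbT.
rewrite Rintegral_mkcondr; apply: eq_Rintegral => t _; rewrite patchE.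
case: ifPn => [|]; first by rewrite inE /A /= => ->; rewrite mulrDl.
by move/negP => At; case: ifP => [at_|_]; [case: At; rewrite inE|rewrite mul0r].
Qed.

End Reflection.

Section Symmetrization.
Variables (R : realType) (N : nat) (s : R).
Hypothesis hs : 0 < s < 1.
Local Notation V := 'rV[R]_N.

(* E_{z,d}(w, phi, x) with c = u(x), written without principal value. *)
Definition Esym (w : V -> R) (c : R) (phi : V -> R) (x z : V) (d : R) : R :=
  J s (fun t => if t < d then dd phi (phi x) x z t else dd w c x z t).

Lemma dd_le (w : V -> R) M c x z t : (forall y, `|w y| <= M) -> `|c| <= M ->
  `|dd w c x z t| <= 4 * M.
Proof.
move=> wM cM; rewrite /dd.
have := wM (x + t *: z); have := wM (x - t *: z); move: cM.
rewrite !ler_norml => /andP[? ?] /andP[? ?] /andP[? ?].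
by apply/andP; split; lra.
Qed.

(** The outer integral folds exactly. The inner one, truncated at e, folds onto a second difference
    that differs from the full one by at most C t^2 on (0, e], an error whose integral vanishes with
    e; so the principal value exists and equals the convergent integral. *)
Lemma EzdE (u w phi : V -> R) x z d M : 0 < d -> C2 phi -> usc w \/ lsc w ->
  (forall y, `|w y| <= M) -> `|u x| <= M -> sphere z ->
  Ezd s u w phi x z d = Esym w (u x) phi x z d.
Proof.
move=> d0 cphi wsc wM uM z1.
have [C C0 CP] := dd_C2_le x d cphi.
have M0 : 0 <= M by exact: le_trans (wM x).
have cph : continuous phi by case: cphi.
have pusc : usc phi := continuous_usc cph.
have mline f z' : usc f \/ lsc f -> measurable_fun [set: R] (fun t => f (x + t *: z')).
  by case=> h; [exact: usc_line|exact: lsc_line].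
have mdp : measurable_fun [set: R] (dd phi (phi x) x z) by apply: measurable_dd; left.
have mdw : measurable_fun [set: R] (dd w (u x) x z) by exact: measurable_dd.
have ddC t : 0 < t < d -> `|dd phi (phi x) x z t| <= C * t ^+ 2.
  move=> /andP[t0 td]; apply: CP => //; rewrite subrr enorm0 add0r; exact: ltW.
have out : \int[lebesgue_measure]_(t in [set t : R | d <= `|t|])
       ((w (x + t *: z) - u x) * kern s t) =
    J s (fun t => if t < d then 0 else dd w (u x) x z t).
  have wb y : `|w y - u x| <= 2 * M.
    have := wM y; move: uM; rewrite !ler_norml => /andP[? ?] /andP[? ?].
    by apply/andP; split; lra.
  have ad (f : R -> R) : measurable_fun [set: R] f -> (forall t, `|f t| <= 2 * M) ->
      adm (2 * M * (1 + d ^- 2)) (fun t => if d <= t then f t else 0).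
    move=> mf fM.
    have h := @adm_cut R 0 (2 * M) d (fun=> 0) f d0 (lexx 0) (mulr_ge0 (ler0n R 2) M0).
    rewrite mul0r add0r in h.
    rewrite (_ : (fun t => _) = fun t => if t < d then 0 else f t); last first.
      by apply/funext => t; rewrite leNgt if_neg.
    apply: h => //.
    by move=> t _; rewrite normr0 mul0r.
  rewrite (@Rintegral_sym _ _ hs (fun t => d <= t) (fun t => w (x + t *: z) - u x)
    (2 * M * (1 + d ^- 2)) (2 * M * (1 + d ^- 2))).
  - apply: eq_J => t _; rewrite leNgt if_neg; case: ifP => // _.
    by rewrite /dd scaleNr; lra.
  - by rewrite [X in measurable X](_ : _ = `[d, +oo[%classic)// set_itvcy.
  - by move=> t; exact: lt_le_trans.
  - apply: measurable_funB => //; exact: mline.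
  - by apply: ad => //; apply: measurable_funB => //; exact: mline.
  - apply: ad => //; apply: measurable_funB => //.
    have := mline w (- z) wsc.
    by under eq_fun do rewrite scalerN -scaleNr.
pose h e t := if t < d then (if t <= e then 0 else dd phi (phi x) x z t) else 0.
have ah e : 0 < e -> adm (C * (1 + d ^+ 2)) (h e).
  move=> e0; have := @adm_cut R C 0 d (fun t => if t <= e then 0 else dd phi (phi x) x z t)
     (fun=> 0) d0 C0 (lexx 0).
  rewrite mul0r addr0; apply => //.
  - apply: measurable_fun_ifT => //; exact: measurable_fun_ler.
  - move=> t td; case: ifP => _; last exact: ddC.
    by rewrite normr0 mulr_ge0// sqr_ge0.
  - by move=> t _; rewrite normr0.
pose h0 t := if t < d then dd phi (phi x) x z t else 0.
have ah0 : adm (C * (1 + d ^+ 2)) h0.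
  have := @adm_cut R C 0 d (dd phi (phi x) x z) (fun=> 0) d0 C0 (lexx 0).
  rewrite mul0r addr0; apply => //.
  by move=> t _; rewrite normr0.
have inn e : 0 < e -> \int[lebesgue_measure]_(t in [set t : R | e < `|t| < d])
    ((phi (x + t *: z) - phi x) * kern s t) = J s (h e).
  move=> e0.
  have [B B0 BP] := continuous_bounded_ecball x d cph.
  have ad (f : R -> R) : measurable_fun [set: R] f ->
      (forall t, e < t < d -> `|f t| <= 2 * B) ->
      adm (2 * B * (1 + e ^- 2)) (fun t => if e < t < d then f t else 0).
    move=> mf fM.
    have g := @adm_cut R 0 (2 * B) e (fun=> 0) (fun t => if e < t < d then f t else 0)
       e0 (lexx 0) (mulr_ge0 (ler0n R 2) B0).
    rewrite mul0r add0r in g.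
    rewrite (_ : (fun t => _) = fun t => if t < e then 0 else
      if e < t < d then f t else 0); last first.
      by apply/funext => t; case: (ltgtP e t).
    apply: g => //.
    - apply: measurable_fun_ifT => //; apply: measurable_and; exact: measurable_fun_ltr.
    - by move=> t _; rewrite normr0 mul0r.
    - move=> t _; case: ifP => [/fM//|_]; rewrite normr0; lra.
  have phib t z' : sphere z' -> e < t < d -> `|phi (x + t *: z') - phi x| <= 2 * B.
    move=> z'1 /andP[et td].
    have h1 : `|phi (x + t *: z')| <= B.
      apply: BP; rewrite /ecball /= addrAC subrr add0r enormZ (z'1 : enorm z' = 1) mulr1.
      by rewrite gtr0_norm ?(lt_trans e0)// ltW.
    have h2 : `|phi x| <= B by apply: BP; rewrite /ecball /= subrr enorm0 ltW.
    by apply: le_trans (ler_normB _ _) _; lra.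
  have zN1 : sphere (- z) by rewrite /sphere /= enormN.
  rewrite (@Rintegral_sym _ _ hs (fun t => e < t < d) (fun t => phi (x + t *: z) - phi x)
    (2 * B * (1 + e ^- 2)) (2 * B * (1 + e ^- 2))).
  - apply: eq_J => t t0; rewrite /h; have [td|dt] := ltP t d; last by rewrite andbF.
    rewrite andbT leNgt; case: ifP => //= et.
    by rewrite /dd scaleNr; lra.
  - by rewrite [X in measurable X](_ : _ = `]e, d[%classic)// set_itvoo.
  - by move=> t /andP[et _]; exact: lt_trans et.
  - by apply: measurable_funB => //; apply: mline; left.
  - apply: ad; first by apply: measurable_funB => //; apply: mline; left.
    by move=> t; exact: phib.
  - apply: ad; last by move=> t; rewrite scaleNr -scalerN; exact: phib.
    apply: measurable_funB => //.
    have := mline phi (- z) (or_introl pusc).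
    by under eq_fun do rewrite scalerN -scaleNr.
have lim0 : lim ((fun eps : R => \int[lebesgue_measure]_(t in [set t : R | eps < `|t| < d])
             ((phi (x + t *: z) - phi x) * kern s t)) @ 0^'+) = J s h0.
  apply: cvg_lim => //; apply/cvgrPdist_le => e e0.
  have Ce : 0 < e / (C + 1) by rewrite divr_gt0// ltr_wpDl.
  have [r r0 rP] := J_cutsq_small hs Ce.
  near=> eps.
  have eps0 : 0 < eps by near: eps; exact: nbhs_right_gt.
  (* The error lives on t <= eps whereas [cutsq] cuts strictly, so it is dominated by
     [cutsq (2 * eps)]. *)
  have epsd : 2 * eps < r.
    by rewrite -ltr_pdivlMl//; near: eps; apply: nbhs_right_lt; rewrite mulr_gt0.
  have epsd2 : 2 * eps < d.
    by rewrite -ltr_pdivlMl//; near: eps; apply: nbhs_right_lt; rewrite mulr_gt0.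
  rewrite inn//.
  have ahN : adm (`|-1| * (C * (1 + d ^+ 2))) (fun t => - h eps t).
    by have := adm_scale (-1) (ah _ eps0); under eq_fun do rewrite mulN1r.
  rewrite -(JN hs (ah _ eps0)) -(JD hs ah0 ahN).
  have e20 : 0 < 2 * eps by rewrite mulr_gt0.
  have aq := adm_scale C (adm_cutsq e20).
  have aqN := adm_scale (- C) (adm_cutsq e20).
  have adif := adm_add ah0 ahN.
  have Jc : C * J s (cutsq (2 * eps)) <= e.
    have h1 : J s (cutsq (2 * eps)) <= e / (C + 1) by apply: rP; rewrite e20.
    rewrite ler_pdivlMr in h1; last by rewrite ltr_wpDl.
    by have := J_cutsq_ge0 s (2 * eps); nra.
  have pw t : 0 < t -> `|h0 t - h eps t| <= C * cutsq (2 * eps) t.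
    move=> t0; rewrite /h0 /h /cutsq.
    have [td|dt] := ltP t d; last by rewrite subrr normr0; case: ifP => _; rewrite ?mulr0// mulr_ge0 ?sqr_ge0.
    have [te|et] := leP t eps.
      by rewrite subr0 (_ : t < 2 * eps) ?ddC ?t0//; lra.
    by rewrite subrr normr0; case: ifP => _; rewrite ?mulr0// mulr_ge0 ?sqr_ge0.
  rewrite ler_norml; apply/andP; split.
    apply: (@le_trans _ _ (- (C * J s (cutsq (2 * eps))))); first by rewrite lerN2.
    rewrite -mulNr -(JZ hs _ (adm_cutsq e20)); apply: (le_J hs aqN adif) => t t0.
    by have := pw t t0; rewrite ler_norml mulNr => /andP[].
  apply: le_trans Jc.
  rewrite -(JZ hs _ (adm_cutsq e20)); apply: (le_J hs adif aq) => t t0.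
  by have := pw t t0; rewrite ler_norml => /andP[].
rewrite /Ezd out lim0 /Esym.
have aw : adm (4 * M * (1 + d ^- 2)) (fun t => if t < d then 0 else dd w (u x) x z t).
  have := @adm_cut R 0 (4 * M) d (fun=> 0) (dd w (u x) x z) d0 (lexx 0) (mulr_ge0 (ler0n R 4) M0).
  rewrite mul0r add0r; apply => //.
  - by move=> t _; rewrite normr0 mul0r.
  - by move=> t _; exact: dd_le.
rewrite -(JD hs ah0 aw); apply: eq_J => t _.
by rewrite /h0; case: ifP; rewrite ?add0r ?addr0.
Unshelve. all: by end_near. Qed.

End Symmetrization.

(** * Tails, convex geometry, and extensions by the datum *)

Section Tails.
Variables (R : realType) (N : nat) (s : R).
Hypothesis hs : 0 < s < 1.
Local Notation V := 'rV[R]_N.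

(** The part of [Esym] beyond radius d. It is all of [Esym] for a linear test function, and at d =
    eps it is the operator of the truncated problem. *)
Definition Tail (w : V -> R) (c : R) (x z : V) (d : R) : R :=
  J s (fun t => if t < d then 0 else dd w c x z t).

Lemma adm_Tail (w : V -> R) M c x z d : 0 < d -> usc w \/ lsc w ->
  (forall y, `|w y| <= M) -> `|c| <= M ->
  adm (4 * M * (1 + d ^- 2)) (fun t => if t < d then 0 else dd w c x z t).
Proof.
move=> d0 wsc wM cM; have M0 : 0 <= M by exact: le_trans cM.
have := @adm_cut R 0 (4 * M) d (fun=> 0) (dd w c x z) d0 (lexx 0) (mulr_ge0 (ler0n R 4) M0).
rewrite mul0r add0r; apply => //.
- exact: measurable_dd.
- by move=> t _; rewrite normr0 mul0r.
- by move=> t _; exact: dd_le.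
Qed.

Lemma ddN (w : V -> R) c x z t : dd w c x (- z) t = dd w c x z t.
Proof. by rewrite /dd scalerN opprK (addrC (w _)). Qed.

Lemma dd_quad a (b p x z : V) t : sphere z ->
  dd (quad a b p) (quad a b p x) x z t = 2 * a * t ^+ 2.
Proof.
move=> z1; have zz : dot z z = 1 by rewrite -enorm_sqr (z1 : enorm z = 1) expr1n.
rewrite /dd /quad !(addrAC x _ (- p)) !(dotDr b x) dotNr.
move: (x - p) => y.
by rewrite !(dotDl, dotDr, dotNl, dotNr, dotZl, dotZr) zz (dotC z y); ring.
Qed.

Lemma Esym_quad (w : V -> R) M c a (b p x z : V) d : 0 < d -> usc w \/ lsc w ->
  (forall y, `|w y| <= M) -> `|c| <= M -> sphere z ->
  Esym s w c (quad a b p) x z d = 2 * a * J s (cutsq d) + Tail w c x z d.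
Proof.
move=> d0 wsc wM cM z1; have aT := adm_Tail x z d0 wsc wM cM.
rewrite -(JZ hs _ (adm_cutsq d0)) -(JD hs (adm_scale (2 * a) (adm_cutsq d0)) aT).
apply: eq_J => t _; rewrite /cutsq; case: ifP => _; last by rewrite mulr0 add0r.
by rewrite dd_quad// addr0.
Qed.

Lemma tailm_le a b : 0 < a -> a <= b -> tailm s b <= tailm s a.
Proof.
move=> a0 ab; have /andP[s0 _] := hs; have b0 := lt_le_trans a0 ab.
rewrite /tailm ler_wpM2r// ?invr_ge0; first lra.
rewrite !powRN lef_pV2 ?posrE ?powR_gt0//.
by apply: ge0_ler_powR => //; rewrite ?nnegrE ?(ltW a0) ?(ltW b0)//; lra.
Qed.

Lemma J_cutR2 (a b p q : R) : 0 < p -> 0 < q ->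
  J s (fun t => a * cutR p t + b * cutR q t) = a * tailm s p + b * tailm s q.
Proof.
move=> p0 q0; have ap := adm_scale a (adm_cutR p0); have aq := adm_scale b (adm_cutR q0).
by rewrite (JD hs ap aq) (JZ hs _ (adm_cutR p0)) (JZ hs _ (adm_cutR q0)) !J_cutR.
Qed.

Lemma adm_cutR2 (a b p q : R) : 0 < p -> 0 < q ->
  adm (`|a| * (1 + p ^- 2) + `|b| * (1 + q ^- 2)) (fun t => a * cutR p t + b * cutR q t).
Proof.
by move=> p0 q0; exact: adm_add (adm_scale a (adm_cutR p0)) (adm_scale b (adm_cutR q0)).
Qed.

End Tails.

Section Domain.
Variables (R : realType) (N : nat) (O : set 'rV[R]_N).
Local Notation V := 'rV[R]_N.
Implicit Types (x y z : V).

Lemma closure_eball x : closure O x <-> forall r : R, 0 < r -> exists2 y, O y & eball x r y.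
Proof.
split=> [cx r r0|h A /nbhs_eballP[r r0 rA]].
  by have [y [Oy xy]] := cx _ (nbhs_eball x r0); exists y.
by have [y Oy xy] := h r r0; exists y; split=> //; exact: rA.
Qed.

Lemma open_eball x : open O -> O x -> exists2 r : R, 0 < r & eball x r `<=` O.
Proof. by move=> oO Ox; apply/nbhs_eballP; exact: open_nbhs_nbhs. Qed.

Lemma bounded_ecball : bounded_set O -> exists2 D : R, 0 < D & O `<=` ecball 0 D.
Proof.
move=> [M [_ MP]]; exists (N%:R * (`|M| + 1) + 1).
  by rewrite ltr_wpDl// mulr_ge0// addr_ge0.
move=> x Ox; rewrite /ecball /= subr0; apply: le_trans (enorm_le_norm x) _.
apply: (@le_trans _ _ (N%:R * (`|M| + 1))); last by rewrite lerDl.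
by rewrite ler_wpM2l//; apply: MP => //; have := ler_norm M; lra.
Qed.

Lemma closure_ecball (D : R) : O `<=` ecball 0 D -> closure O `<=` ecball 0 D.
Proof.
move=> OD x /closure_eball cx; rewrite /ecball /= subr0; apply/ler_addgt0Pr => e e0.
have [y /OD] := cx e e0; rewrite /ecball /eball /= subr0 => yD xy.
by have := ler_enormD (x - y) y; rewrite subrK enormBC; lra.
Qed.

Lemma compact_closure_bounded : bounded_set O -> compact (closure O).
Proof.
move=> /bounded_ecball[D _ OD].
by apply: (subclosed_compact (@closed_closure _ O) (@compact_ecball _ _ 0 D) (closure_ecball OD)).
Qed.

Lemma within_eball (g : V -> R) x e : {within ~` O, continuous g} -> ~ O x -> 0 < e ->
  exists2 r : R, 0 < r & forall y, ~ O y -> eball x r y -> `|g x - g y| < e.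
Proof.
move=> cg Ox e0.
have /subspace_continuousP /(_ x Ox) := cg.
have FF : Filter (within (~` O) (nbhs x)) by apply: within_filter; exact: (nbhs_filter (x : V)).
move=> /cvgrPdist_lt /(_ _ e0).
move=> /nbhs_eballP[r r0 rP]; exists r => // y Oy xy.
exact: rP.
Qed.

(** The vector is minus the gradient of the defining function. A negative product would make that
    function increase from x0 towards a point of O, although the segment lies in O, where it is
    negative. Openness makes the inequality strict in O, and strict convexity extends it to the
    closure through the midpoint with x0. *)
Lemma support_dot x0 : open O -> C2_domain O -> strictly_convex O ->
  closure O x0 -> ~ O x0 ->
  exists nu : V, forall y, closure O y -> y != x0 -> 0 < dot nu (y - x0).
Proof.
move=> oO [rho [[cr dr cdr _ _] OE nz]] sc cx0 Ox0.
have OP y : O y <-> rho y < 0 by rewrite OE.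
have r0 : rho x0 = 0.
  apply/eqP; rewrite eq_le; apply/andP; split; last first.
    by rewrite leNgt; apply/negP => /OP.
  rewrite leNgt; apply/negP => r0.
  have /continuousVP/(_ x0 _ r0)[r r1 rP] := cr.
  have /closure_eball/(_ r r1)[y /OP y0 /rP] := cx0.
  by rewrite ltr_norml; lra.
have [i ni] := nz _ r0.
pose nu : V := \row_j (- 'D_(e_ R j) rho x0).
have dnu z : is_derive x0 z rho (- dot nu z).
  rewrite (_ : - dot nu z = \sum_(j < N) z ord0 j * 'D_(e_ R j) rho x0).
    exact: is_derive_partials.
  by rewrite /dot -sumrN; apply: eq_bigr => j _; rewrite mxE mulNr opprK mulrC.
have ge0 y : O y -> 0 <= dot nu (y - x0).
  move=> Oy; rewrite leNgt; apply/negP; rewrite -oppr_gt0 => l0.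
  have [d dl] := dnu (y - x0).
  have lim : h^-1 *: (rho (h *: (y - x0) + x0) - rho x0) @[h --> (0:R)^'] --> - dot nu (y - x0).
    by rewrite -dl; exact: d.
  have nxy : y != x0 by apply/eqP => yx; apply: Ox0; rewrite -yx.
  have /cvgrPdist_lt/(_ _ l0)[e /= e0 eP] := lim.
  pose h := Num.min (e / 2) (1 / 2).
  have h0 : 0 < h by rewrite lt_min !divr_gt0.
  have he : h < e by rewrite gt_min; apply/orP; left; lra.
  have h1 : h < 1 by rewrite gt_min; apply/orP; right; lra.
  have := eP h; rewrite /ball_ /= sub0r normrN gtr0_norm// => /(_ he).
  rewrite gt_eqF// => /(_ isT); rewrite r0 subr0 /GRing.scale /= ltr_norml => /andP[_].
  have Oh : O (h *: y + (1 - h) *: x0).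
    by apply: sc => //; [exact: subset_closure|rewrite h0 h1].
  have hE : h *: (y - x0) + x0 = h *: y + (1 - h) *: x0.
    by rewrite scalerBr scalerBl scale1r addrA addrAC.
  rewrite hE; move/OP: Oh => Oh; rewrite -subr_gt0.
  have : h^-1 * rho (h *: y + (1 - h) *: x0) < 0.
    by rewrite pmulr_rlt0// invr_gt0.
  lra.
have nu0 : 0 < dot nu nu.
  rewrite /dot (bigD1 i)//= ltr_pwDl//; last first.
    by apply: sumr_ge0 => j _; rewrite -expr2 sqr_ge0.
  by rewrite mxE mulrNN -expr2 lt_def sqr_ge0 sqrf_eq0 ni.
have gt0 y : O y -> 0 < dot nu (y - x0).
  move=> Oy; rewrite lt_def ge0// andbT; apply/eqP => y0.
  have [r r1 rP] := open_eball oO Oy.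
  have n0 : 0 < enorm nu + 1 by rewrite ltr_wpDl ?enorm_ge0.
  (* Small enough for y - h nu to stay in O; a zero product at y would become negative there. *)
  pose h := r / (enorm nu + 1).
  have h0 : 0 < h by rewrite divr_gt0.
  have /ge0 : O (y - h *: nu).
    apply: rP; rewrite /eball /= addrAC subrr add0r enormN enormZ gtr0_norm//.
    rewrite /h mulrAC ltr_pdivrMr// ltr_pM2l//; lra.
  by rewrite addrAC dotDr y0 add0r dotNr dotZr; have := mulr_gt0 h0 nu0; lra.
exists nu => y cy yx.
have := gt0 (2^-1 *: y + (1 - 2^-1) *: x0).
have -> : 2^-1 *: y + (1 - 2^-1) *: x0 - x0 = 2^-1 *: (y - x0).
  by rewrite scalerBr scalerBl scale1r addrA addrAC addrK.
rewrite dotZr pmulr_rgt0//; apply; apply: sc => //.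
by apply/andP; split; lra.
Qed.

(** Caps cut off by hyperplanes parallel to the supporting one shrink to x0: away from x0 the
    functional has a positive minimum on the compact closure. This is what localizes the minimum of
    a steeply tilted function. *)
Lemma cap_small x0 (nu : V) (r : R) : bounded_set O -> 0 < r ->
  (forall y, closure O y -> y != x0 -> 0 < dot nu (y - x0)) ->
  exists2 h : R, 0 < h & forall y, closure O y -> dot nu (y - x0) <= h -> enorm (y - x0) < r.
Proof.
move=> bO r0 hnu.
have : \forall h \near 0^'+, closure O `<=` (fun y => dot nu (y - x0) <= h -> enorm (y - x0) < r).
  have /compact_near_coveringP := compact_closure_bounded bO; apply => y cy.
  have [->|yx] := eqVneq y x0.
    by near=> y' h => /= _; near: y'; exact: nbhs_eball.
  have p0 := hnu _ cy yx.
  have p2 : 0 < dot nu (y - x0) / 2 by rewrite divr_gt0.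
  have /continuousVP/(_ y _ p2)[e e0 eP] := @continuous_dot R N nu.
  near=> y' h => /= hle; exfalso.
  have : `|dot nu y - dot nu y'| < dot nu (y - x0) / 2.
    by apply: eP; near: y'; exact: nbhs_eball.
  have : h < dot nu (y - x0) / 2 by near: h; exact: nbhs_right_lt.
  move: hle; rewrite !dotDr dotNr ltr_norml => ? ? /andP[_]; lra.
move=> near_h; near (0:R)^'+ => h; exists h => // y cy.
by apply: (_ : closure O `<=` (fun y => dot nu (y - x0) <= h -> enorm (y - x0) < r)) => //; near: h.
Unshelve. all: by end_near. Qed.


Section Extensions.
Variables (g : V -> R).
Hypotheses (oO : open O) (cg : {within ~` O, continuous g}).

Lemma upper_ext_in u x : O x -> upper_ext O g u x = u x.
Proof. by move=> Ox; rewrite /upper_ext; case: asboolP. Qed.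

Lemma upper_ext_bd u x : closure O x -> ~ O x -> upper_ext O g u x = Num.max (u x) (g x).
Proof. by move=> cx Ox; rewrite /upper_ext; case: asboolP => // _; case: asboolP. Qed.

Lemma upper_ext_out u x : ~ closure O x -> upper_ext O g u x = g x.
Proof.
move=> cx; rewrite /upper_ext; case: asboolP => [Ox|_]; last by case: asboolP.
by exfalso; apply: cx; exact: subset_closure.
Qed.

Lemma lower_ext_in u x : O x -> lower_ext O g u x = u x.
Proof. by move=> Ox; rewrite /lower_ext; case: asboolP. Qed.

Lemma lower_ext_bd u x : closure O x -> ~ O x -> lower_ext O g u x = Num.min (u x) (g x).
Proof. by move=> cx Ox; rewrite /lower_ext; case: asboolP => // _; case: asboolP. Qed.

Lemma lower_ext_out u x : ~ closure O x -> lower_ext O g u x = g x.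
Proof.
move=> cx; rewrite /lower_ext; case: asboolP => [Ox|_]; last by case: asboolP.
by exfalso; apply: cx; exact: subset_closure.
Qed.

(** Changing signs exchanges the two extensions, which transfers results between sub- and
    supersolutions. *)
Lemma upper_extN u : upper_ext O (fun y => - g y) (fun y => - u y) = (fun y => - lower_ext O g u y).
Proof.
apply/funext => y; rewrite /upper_ext /lower_ext; case: asboolP => // _.
by case: asboolP => // _; rewrite oppr_min.
Qed.

Lemma lower_extN u : lower_ext O (fun y => - g y) (fun y => - u y) = (fun y => - upper_ext O g u y).
Proof.
apply/funext => y; rewrite /upper_ext /lower_ext; case: asboolP => // _.
by case: asboolP => // _; rewrite oppr_max.
Qed.

Lemma closure_outside x : ~ closure O x -> ~ O x.
Proof. by move=> cx Ox; apply: cx; exact: subset_closure. Qed.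

Lemma upper_ext_le_bound u M : (forall x, `|u x| <= M) -> (forall x, ~ O x -> `|g x| <= M) ->
  forall x, `|upper_ext O g u x| <= M.
Proof.
move=> uM gM x; rewrite /upper_ext; case: asboolP => // Ox.
by case: asboolP => [cx|_]; [rewrite maxEle; case: ifP => _|]; rewrite ?gM.
Qed.

Lemma lower_ext_le_bound u M : (forall x, `|u x| <= M) -> (forall x, ~ O x -> `|g x| <= M) ->
  forall x, `|lower_ext O g u x| <= M.
Proof.
move=> uM gM x; rewrite /lower_ext; case: asboolP => // Ox.
by case: asboolP => [cx|_]; [rewrite minEle; case: ifP => _|]; rewrite ?gM.
Qed.

(** Near a boundary point the extension takes values of u, of g or of their maximum; the maximum
    prescribed at the point dominates all three up to e. *)
Lemma usc_upper_ext u : usc u -> usc (upper_ext O g u).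
Proof.
move=> uu x e e0; have [Ox|Ox] := pselect (O x).
  have [r r0 rP] := uu x e e0; have [r' r'0 rO] := open_eball oO Ox.
  exists (Num.min r r'); first by rewrite lt_min r0.
  move=> y; rewrite /eball /= lt_min => /andP[yr yr'].
  by rewrite !upper_ext_in//; [exact: rP|exact: rO].
have [rg rg0 rgP] := within_eball cg Ox e0.
have [cx|cx] := pselect (closure O x).
  have [r r0 rP] := uu x e e0.
  exists (Num.min r rg); first by rewrite lt_min r0.
  move=> y; rewrite /eball /= lt_min => /andP[yr yrg].
  have h1 := rP _ yr.
  have h2 : ~ O y -> g y < g x + e.
    by move=> Oy; have := rgP _ Oy yrg; rewrite ltr_norml => /andP[]; lra.
  rewrite (upper_ext_bd _ cx Ox).
  have m1 : u x <= Num.max (u x) (g x) by rewrite le_max lexx.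
  have m2 : g x <= Num.max (u x) (g x) by rewrite le_max lexx orbT.
  have [Oy|Oy] := pselect (O y); first by rewrite upper_ext_in//; lra.
  have := h2 Oy; have [cy|cy] := pselect (closure O y) => h3.
    by rewrite (upper_ext_bd _ cy Oy) gt_max; apply/andP; split; lra.
  by rewrite upper_ext_out//; lra.
have [r r0 rC] : exists2 r : R, 0 < r & eball x r `<=` ~` closure O.
  apply/nbhs_eballP; apply: open_nbhs_nbhs; split => //.
  by apply/closed_openC/closed_closure.
exists (Num.min r rg); first by rewrite lt_min r0.
move=> y; rewrite /eball /= lt_min => /andP[yr yrg].
have cy := rC _ yr; rewrite !upper_ext_out//.
by have := rgP _ (closure_outside cy) yrg; rewrite ltr_norml => /andP[]; lra.
Qed.

End Extensions.

Lemma within_contN (g : V -> R) : {within ~` O, continuous g} ->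
  {within ~` O, continuous (fun y => - g y)}.
Proof. by move=> cg x; apply: cvgN; exact: cg. Qed.

Lemma lsc_lower_ext (g : V -> R) u : open O -> {within ~` O, continuous g} ->
  lsc u -> lsc (lower_ext O g u).
Proof.
move=> oO cg lu; have := usc_upper_ext oO (within_contN cg) (lscN lu).
rewrite upper_extN => /uscN h x e e0.
by have [r r0 rP] := h x e e0; exists r => // y /rP; rewrite !opprK.
Qed.

End Domain.

(** * Attainment of the boundary datum *)

Section Boundary.
Variables (R : realType) (N : nat) (s : R) (O : set 'rV[R]_N).
Local Notation V := 'rV[R]_N.
Hypotheses (hs : 0 < s < 1) (oO : open O) (bO : bounded_set O)
  (dO : C2_domain O) (scO : strictly_convex O).

(** The slopes kap t and - kap t on the two sides cancel; past tau one side has jumped by 3 c while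
    the other has lost at most c. Beyond 2 L tau only the bound - 4 M is left, and the scaling of
    the kernel makes that part cost at most half of the gain. *)
Lemma tail_exit_lower (w : V -> R) (M e c L d tau kap : R) (x z : V) :
  lsc w -> (forall y, `|w y| <= M) -> `|e| <= M -> 0 < c -> 1 < L ->
  (2 * c + 4 * M) * L `^ (- (2 * s)) <= c ->
  0 < d -> d <= tau -> 0 <= kap -> 2 * L * (kap * tau) <= c ->
  (forall t, 0 <= t -> t <= 2 * L * tau -> - (kap * t) <= w (x + t *: z) - e) ->
  (forall t, 0 <= t -> t <= 2 * L * tau -> kap * t <= w (x - t *: z) - e) ->
  (forall t, tau < t -> t <= 2 * L * tau -> 3 * c <= w (x - t *: z) - e) ->
  c * tailm s (2 * tau) <= Tail s w e x z d.
Proof.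
move=> wl wM eM c0 L1 cL d0 dtau kap0 kc up dn ex.
have M0 : 0 <= M by exact: le_trans eM.
have L0 : 0 < L by lra.
have tau0 : 0 < tau by lra.
pose T := 2 * tau.
have T0 : 0 < T by rewrite mulr_gt0.
have LT0 : 0 < L * T by rewrite mulr_gt0.
have LTE : L * T = 2 * L * tau by rewrite /T; ring.
have TLT : T <= L * T by rewrite ler_peMl// ltW.
have kapt t : t <= 2 * L * tau -> kap * t <= c.
  move=> t2; apply: le_trans kc.
  rewrite (_ : 2 * L * (kap * tau) = kap * (2 * L * tau)); last by ring.
  by rewrite ler_wpM2l.
(* The step function equals 0 below T, 2 c on [T, L T) and - 4 M after L T. *)
have ddlow t : d <= t -> 2 * c * cutR T t + - (2 * c + 4 * M) * cutR (L * T) t <= dd w e x z t.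
  move=> dt; have t0 : 0 <= t by lra.
  rewrite /cutR; have [tL|tL] := ltP t (L * T); last first.
    rewrite (_ : t < T = false); last by apply/negbTE; rewrite -leNgt; lra.
    have := dd_le x z t wM eM; rewrite ler_norml => /andP[]; lra.
  rewrite LTE in tL; have {}tL := ltW tL.
  have k1 := kapt t tL; have p1 := up t t0 tL; have p2 := dn t t0 tL.
  have ddE : dd w e x z t = (w (x + t *: z) - e) + (w (x - t *: z) - e).
    by rewrite /dd; lra.
  rewrite ddE; have [tT|tT] := ltP t T; first lra.
  have tt : tau < t by rewrite /T in tT; lra.
  by have := ex t tt tL; lra.
have aT := adm_Tail x z d0 (or_intror wl) wM eM.
have := le_J hs (adm_cutR2 (2 * c) (- (2 * c + 4 * M)) T0 LT0) aT.
rewrite (J_cutR2 hs)// -/(Tail s w e x z d) => lowb.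
have : 2 * c * tailm s T + - (2 * c + 4 * M) * tailm s (L * T) <= Tail s w e x z d.
  apply: lowb => t t0; case: ifP => [td|]; last by move/negbT; rewrite -leNgt => /ddlow.
  have tT : t < T by rewrite /T; lra.
  by rewrite /cutR tT (lt_le_trans tT TLT) !mulr0 addr0.
rewrite (tailmM s L0 T0).
have := tailm_gt0 hs T0.
move: (L `^ _) (tailm s T) cL => la mT; clear; nra.
Qed.

(** Moving backwards along z lowers the supporting functional at rate a, so the domain is left by t
    = lx / a; if a is too small for this to help, it is left by t = 2 r for lack of room. In both
    cases K a tau stays below sg, however large K is. *)
Lemma exit_scale (P : R -> Prop) (K a r d sg lx : R) : 0 < K -> 0 <= a ->
  0 < d -> d <= 2 * r -> K * a * d <= sg -> 0 <= lx -> K * lx <= sg ->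
  (forall t, 0 <= t -> P t -> t * a <= lx /\ t < 2 * r) ->
  exists tau, [/\ d <= tau, tau <= 2 * r, K * a * tau <= sg & forall t, tau < t -> ~ P t].
Proof.
move=> K0 a0 d0 d2r Kd lx0 Kl ex.
have [ar|ar] := leP (a * (2 * r)) lx.
  exists (2 * r); split=> //; last by move=> t rt /ex; case; lra.
  by apply: le_trans Kl; rewrite -mulrA ler_pM2l.
have ap : 0 < a.
  by rewrite lt_def a0 andbT; apply/eqP => a00; rewrite a00 mul0r in ar; lra.
have la : lx / a * a = lx by rewrite divfK// gt_eqF.
exists (Num.max d (lx / a)); split.
- by rewrite le_max lexx.
- by rewrite ge_max d2r/= ler_pdivrMr// ltW// mulrC.
- by rewrite maxEle; case: ifP => _ //; rewrite -mulrA (mulrC a) la.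
- move=> t; rewrite gt_max => /andP[dt lt_] /ex[]; first lra.
  by rewrite -ler_pdivlMr// leNgt lt_.
Qed.

(* At a minimum point x of u + K l over the closure, l a supporting functional
   at x0, the graph of u lies above a plane of slope K while every line through x
   leaves O on one side at a scale tau with K l-slope * tau small; the jump
   g - u > 0 past tau then makes all the directional integrals positive. *)
Lemma lsc_boundary (g u : V -> R) (M : R) (x0 : V) : {within ~` O, continuous g} ->
  lsc u -> (forall x, `|u x| <= M) -> (forall x, ~ O x -> `|g x| <= M) ->
  (forall x : V, ~ closure O x -> g x <= u x) ->
  (forall d (b x : V), 0 < d -> closure O x -> (O x \/ u x < g x) ->
     (forall y, eball x d y -> u x - dot b x <= u y - dot b y) ->
     forall eta, 0 < eta -> exists2 z, sphere z &
       Tail s (lower_ext O g u) (u x) x z d <= eta) ->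
  closure O x0 -> ~ O x0 -> g x0 <= u x0.
Proof.
move=> cg lu uM gM gu hsup cx0 Ox0; rewrite leNgt; apply/negP => ug.
have [nu nuP] := support_dot oO dO scO cx0 Ox0.
pose l (y : V) := dot nu (y - x0).
have l_ge0 (y : V) : closure O y -> 0 <= l y.
  move=> cy; have [->|yx] := eqVneq y x0; last exact/ltW/nuP.
  by rewrite /l subrr dot0r.
have M0 : 0 <= M by exact: le_trans (uM x0).
pose w := lower_ext O g u.
have wM y : `|w y| <= M by exact: lower_ext_le_bound.
have wl : lsc w by exact: lsc_lower_ext.
(* A quarter of the gap: one c is lost to the oscillation of g near x0, leaving the jump of 3 c. *)
pose c := (g x0 - u x0) / 4.
have c0 : 0 < c by rewrite divr_gt0// subr_gt0.
have cE : g x0 = u x0 + 4 * c by rewrite /c; lra.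
clearbody c.
have e0 : 0 < c / (2 * c + 4 * M) by rewrite divr_gt0//; lra.
have [L L1 LP] := tailm_small hs e0.
have L0 : 0 < L by lra.
(* Chosen so that K a tau <= sg bounds the effect of the slope by c up to distance 2 L tau. *)
pose sg := c / (2 * L).
have sg0 : 0 < sg by rewrite divr_gt0// mulr_gt0.
have sgL : 2 * L * sg = c by rewrite /sg; field; lra.
clearbody sg.
have sgc : sg < c by nra.
have [rho0 rho00 gP] := within_eball cg Ox0 c0.
have [r1 r10 r1P] := lu x0 _ sg0.
have Lr0 : 0 < 4 * L + 1 by lra.
(* From a point within r of x0, moving by at most 4 L r stays within rho0, where g is close to
   [g x0]. *)
pose r := Num.min r1 (rho0 / (4 * L + 1)).
have r0 : 0 < r by rewrite lt_min r10 divr_gt0.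
have rr1 : r <= r1 by rewrite ge_min lexx.
have rrho : r * (4 * L + 1) <= rho0.
  by rewrite -ler_pdivlMr// ge_min lexx orbT.
clearbody r.
have [h h0 hP] := cap_small bO r0 nuP.
(* K h > 2 M forces l x < h at the minimum, hence x within r of x0 by [cap_small]. *)
pose K := 2 * M / h + 1.
have K0 : 0 < K by rewrite ltr_wpDl// divr_ge0// ?mulr_ge0// ltW.
have Kh : 2 * M < K * h by rewrite (_ : K * h = 2 * M + h) ?ltrDl// /K; field; rewrite gt_eqF.
clearbody K.
have [x cx xmin] : exists2 x : V, closure O x & forall y : V, closure O y -> u x + K * l x <= u y + K * l y.
  have [||y a cy ya|x cx xP] := @usc_max_compact R _ (closure O) (fun y => - u y - K * l y)
    M (compact_closure_bounded bO).
  - by exists x0.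
  - move=> y cy; have := uM y; rewrite ler_norml => /andP[? ?].
    have := mulr_ge0 (ltW K0) (l_ge0 _ cy); lra.
  - apply: usc_near ya => {}y {cy a} e1 e10.
    have e2 : 0 < e1 / 2 by rewrite divr_gt0.
    have [ra ra0 raP] := lscN lu y e2.
    have e3 : 0 < e1 / 2 / K by rewrite divr_gt0.
    have /continuousVP/(_ y _ e3)[rb rb0 rbP] := @continuous_dot R N nu.
    exists (Num.min ra rb); first by rewrite lt_min ra0.
    move=> y'; rewrite /eball /= lt_min => /andP[/raP h1 /rbP].
    rewrite ltr_pdivlMr// => h2; rewrite /l !dotDr.
    have h3 : `|dot nu y - dot nu y'| * K = `|(dot nu y - dot nu y') * K|.
      by rewrite normrM (gtr0_norm K0).
    by rewrite h3 ltr_norml in h2; case/andP: h2; lra.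
  - by exists x => // y cy; have := xP y cy; lra.
have lx0 : l x0 = 0 by rewrite /l subrr dot0r.
have xx0 := xmin x0 cx0; rewrite lx0 mulr0 addr0 in xx0.
have lx := l_ge0 _ cx.
have ulex : u x <= u x0 by have := mulr_ge0 (ltW K0) lx; lra.
have lxh : l x < h.
  rewrite -(ltr_pM2l K0); apply: le_lt_trans Kh.
  have := uM x; have := uM x0; rewrite !ler_norml => /andP[? ?] /andP[? ?]; lra.
have xr : enorm (x - x0) < r by apply: hP => //; exact: ltW.
(* Comparing with x0 bounds K l x by u x0 - u x, which lower semicontinuity at x0 makes small
   although K is large. *)
have Kl : K * l x <= sg.
  by have := r1P x (lt_le_trans xr rr1); lra.
have gnear (y : V) : ~ O y -> enorm (y - x0) < rho0 -> u x + 3 * c <= g y.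
  move=> Oy /(gP _ Oy); rewrite ltr_norml => /andP[_].
  by move: cE ulex; clear -hs oO bO dO scO; lra.
have nun : 0 < K * enorm nu + 1 by rewrite ltr_wpDl// mulr_ge0 ?enorm_ge0// ltW.
(* Over distance d the slope varies by at most sg < c, so outside the closure the jump of g prevails
   and x is a minimum on the whole ball. *)
pose d := Num.min (2 * r) (sg / (K * enorm nu + 1)).
have d0 : 0 < d by rewrite lt_min mulr_gt0//= divr_gt0.
have d2r : d <= 2 * r by rewrite ge_min lexx.
have Kd : K * enorm nu * d <= sg.
  have : d * (K * enorm nu + 1) <= sg by rewrite -ler_pdivlMr// ge_min lexx orbT.
  by move: (d0); rewrite mulrDr mulr1 (mulrC d); clear -hs oO bO dO scO; lra.
clearbody d.
have rL : 3 * r <= rho0.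
  by apply: le_trans rrho; rewrite mulrC ler_pM2l//; move: L1; clear -hs oO bO dO scO; lra.
have rrho' : r <= rho0 by move: rL r0; clear -hs oO bO dO scO; lra.
have xout : ~ O x -> u x < g x.
  by move=> Ox; have := gnear x Ox (lt_le_trans xr rrho'); move: c0; clear -hs oO bO dO scO; lra.
have ldiff (y : V) t : l (x + t *: y) = l x + t * dot nu y.
  by rewrite /l (addrAC x (t *: y)) (dotDr nu (x - x0)) dotZr.
(* Since tau <= 2 r in every direction, the lower bound proved below is at least c
   [tailm s (4 * r)]; half of it is a contradiction. *)
have [v v1 Tv] : exists2 z, sphere z & Tail s w (u x) x z d <= c * tailm s (4 * r) / 2.
  apply: (hsup d (- K *: nu)) => //.
  - by have [|Ox] := pselect (O x); [left|right; exact: xout].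
  - move=> y; rewrite /eball /= => yd; rewrite !dotZl.
    have lyx : dot nu y - dot nu x = l y - l x by rewrite /l !dotDr; clear -hs oO bO dO scO; lra.
    have [cy|cy] := pselect (closure O y); first by have := xmin y cy; move: lyx; clear -hs oO bO dO scO; nra.
    have yr : enorm (y - x0) < rho0.
      by have := ler_enormB y x x0; move: yd xr d2r rL; rewrite /eball /=; clear -hs oO bO dO scO; lra.
    have h1 := gu _ cy; have h2 := gnear y (closure_outside cy) yr.
    have h3 : `|l y - l x| <= enorm nu * d.
      rewrite -lyx -dotNr -dotDr; apply: le_trans (cauchy_schwarz _ _) _.
      by rewrite ler_wpM2l ?enorm_ge0// ltW.
    have h4 : - (enorm nu * d) <= l y - l x by move: h3; rewrite ler_norml => /andP[].
    have h5 := ler_wpM2l (ltW K0) h4.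
    rewrite -subr_ge0 in h5; move: h1 h2 h5 Kd sgc c0 lyx; clear -hs oO bO dO scO; nra.
  - by rewrite divr_gt0// mulr_gt0// tailm_gt0// mulr_gt0.
(* [Tail] is even in the direction, so z may be oriented away from the supporting hyperplane. *)
have {v v1 Tv}[z [z1 a0 Tz]] : exists z, [/\ sphere z, 0 <= dot nu z &
    Tail s w (u x) x z d <= c * tailm s (4 * r) / 2].
  have [za|za] := leP 0 (dot nu v); first by exists v.
  exists (- v); split; first by rewrite /sphere /= enormN.
    by rewrite dotNr oppr_ge0 ltW.
  by rewrite /Tail; under [X in J s X]eq_fun do rewrite ddN.
have zz : enorm z = 1 := z1.
set a := dot nu z in a0.
have anu : a <= enorm nu.
  by apply: le_trans (ler_norm _) _; have := cauchy_schwarz nu z; rewrite zz mulr1.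
have exit1 t : 0 <= t -> closure O (x - t *: z) -> t * a <= l x /\ t < 2 * r.
  move=> t0 ct; have := l_ge0 _ ct; rewrite -scaleNr ldiff -/a mulNr subr_ge0 => h1.
  split=> //.
  have h2 : enorm (x - t *: z - x0) < r.
    apply: hP => //; rewrite -/(l _) -scaleNr ldiff -/a mulNr.
    by apply/ltW; apply: le_lt_trans lxh; rewrite lerBlDr lerDl mulr_ge0.
  have := ler_enormD (x - x0) (- (x - t *: z - x0)).
  rewrite (_ : x - x0 - (x - t *: z - x0) = t *: z); last first.
    by apply/rowP => i; rewrite !mxE; ring.
  rewrite enormN enormZ zz mulr1 ger0_norm// => h3; apply: le_lt_trans h3 _.
  by rewrite mulr_natl mulr2n ltrD.
have Kad : K * a * d <= sg.
  by apply: le_trans Kd; rewrite ler_pM2r// ler_pM2l.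
have [tau [dtau taur Ktau texit]] := exit_scale K0 a0 d0 d2r Kad lx Kl exit1.
have tau0 : 0 < tau by exact: lt_le_trans dtau.
have inb t (v : V) : 0 <= t -> enorm v = 1 -> t <= 4 * L * r -> enorm (x + t *: v - x0) < rho0.
  move=> t0 v1 tL; rewrite addrAC; apply: le_lt_trans (ler_enormD _ _) _.
  rewrite enormZ v1 mulr1 ger0_norm//; apply: lt_le_trans rrho.
  by move: tL xr; clear -hs oO bO dO scO; nra.
have zN : enorm (- z) = 1 by rewrite enormN.
have wlow (y : V) : enorm (y - x0) < rho0 -> Num.min (- K * (l y - l x)) (3 * c) <= w y - u x.
  move=> yr; rewrite ge_min; have [Oy|Oy] := pselect (O y).
    rewrite /w lower_ext_in//; apply/orP; left.
    by have := xmin y (subset_closure Oy); clear -hs oO bO dO scO; lra.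
  have h1 := gnear y Oy yr; have [cy|cy] := pselect (closure O y); last first.
    by rewrite /w lower_ext_out//; apply/orP; right; move: h1; clear -hs oO bO dO scO; lra.
  rewrite /w lower_ext_bd// minEle; case: ifP => _; apply/orP; [left|right]; last by move: h1; clear -hs oO bO dO scO; lra.
  by have := xmin y cy; clear -hs oO bO dO scO; lra.
have wout (y : V) : enorm (y - x0) < rho0 -> ~ closure O y -> 3 * c <= w y - u x.
  move=> yr cy; rewrite /w lower_ext_out//.
  by have := gnear y (closure_outside cy) yr; clear -hs oO bO dO scO; lra.
have := @tail_exit_lower w M (u x) c L d tau (K * a) x z wl wM (uM x) c0 L1.
have := tailm_le hs (mulr_gt0 (ltr0n R 2) tau0) (_ : 2 * tau <= 4 * r).
have m4 := tailm_gt0 hs (mulr_gt0 (ltr0n R 4) r0).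
have LPL := LP L (lexx _); rewrite ler_pdivlMr in LPL; last by move: c0 M0; clear -hs oO bO dO scO; lra.
have Ka0 : 0 <= K * a by rewrite mulr_ge0// ltW.
have kaptau : 2 * L * (K * a * tau) <= c.
  by rewrite -sgL ler_pM2l// mulr_gt0.
move=> /(_ _)h1 /(_ _ d0 dtau Ka0 kaptau _ _ _)h2.
have {}h1 : tailm s (4 * r) <= tailm s (2 * tau) by apply: h1; move: taur; clear -hs oO bO dO scO; lra.
suff : c * tailm s (2 * tau) <= Tail s w (u x) x z d.
  move=> h3; have := ler_wpM2l (ltW c0) h1; have := mulr_gt0 c0 m4; move: Tz h3.
  clear; lra.
have tL t : t <= 2 * L * tau -> t <= 4 * L * r.
  move=> h3; apply: le_trans h3 _.
  rewrite -(mulrA 4) -(mulrA 2) (_ : 4 * (L * r) = 2 * (L * (2 * r))); last by ring.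
  by rewrite ler_pM2l// ler_pM2l.
have kapt t : 0 <= t -> t <= 2 * L * tau -> K * (t * a) <= c.
  move=> t0 t2; apply: le_trans kaptau.
  rewrite (_ : K * (t * a) = t * (K * a)); last by ring.
  rewrite (_ : 2 * L * (K * a * tau) = 2 * L * tau * (K * a)); last by ring.
  by rewrite ler_wpM2r.
apply: h2.
- by rewrite mulrC.
- move=> t t0 t2.
  apply: le_trans (wlow _ (inb t z t0 zz (tL _ t2))); rewrite le_min ldiff -/a.
  have := mulr_ge0 (ltW K0) (mulr_ge0 t0 a0); move: (l x) c0 => lx'; clear => ? ?.
  by apply/andP; split; lra.
- move=> t t0 t2.
  rewrite -scalerN; apply: le_trans (wlow _ (inb t (- z) t0 zN (tL _ t2))).
  rewrite le_min ldiff dotNr -/a.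
  have := kapt t t0 t2; move: (l x) c0 => lx'; clear => ? ?.
  by apply/andP; split; lra.
- move=> t tt t2; apply: wout; last exact: texit.
  by rewrite -scalerN; apply: inb => //; [exact/ltW/(lt_trans tau0)|exact: tL].
Qed.

End Boundary.

(** * Comparison *)

Section Comparison.
Variables (R : realType) (N : nat) (s : R) (O : set 'rV[R]_N).
Local Notation V := 'rV[R]_N.
Hypotheses (hs : 0 < s < 1) (oO : open O) (bO : bounded_set O).

(** A radius uniform on a ball, by compactness: near a point of O both arguments lie in O and
    nothing is claimed; near any other point semicontinuity perturbs u <= v by less than th. *)
Lemma usc_lsc_gap (u v : V -> R) (p : V) (th rad : R) : usc u -> lsc v -> 0 < th ->
  (forall x, ~ O x -> u x <= v x) ->
  exists2 r : R, 0 < r & forall x y : V, ecball p rad x -> enorm (y - x) < r ->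
    ~ (O x /\ O y) -> u x - v y < th.
Proof.
move=> uu lv th0 uv.
have : \forall r \near (0:R)^'+, ecball p rad `<=` (fun x => forall y : V,
    enorm (y - x) < r -> ~ (O x /\ O y) -> u x - v y < th).
  have /compact_near_coveringP := @compact_ecball R N p rad; apply => x _.
  have [Ox|Ox] := pselect (O x).
    have [e e0 eO] := open_eball oO Ox.
    have e2 : 0 < e / 2 by rewrite divr_gt0.
    near=> x' r => /= y yr nO; exfalso; apply: nO.
    have x'e : enorm (x' - x) < e / 2 by near: x'; exact: nbhs_eball.
    have re : r < e / 2 by near: r; exact: nbhs_right_lt.
    split; apply: eO; rewrite /eball /=; first by lra.
    by have := ler_enormB y x' x; lra.
  have th2 : 0 < th / 2 by rewrite divr_gt0.
  have [e1 e10 e1P] := uu x _ th2; have [e2 e20 e2P] := lv x _ th2.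
  have e22 : 0 < e2 / 2 by rewrite divr_gt0.
  near=> x' r => /= y yr _.
  have x'e : enorm (x' - x) < e2 / 2 by near: x'; exact: nbhs_eball.
  have re : r < e2 / 2 by near: r; exact: nbhs_right_lt.
  have h1 : u x' < u x + th / 2 by apply: e1P; near: x'; exact: nbhs_eball.
  have h2 : v x - th / 2 < v y.
    by apply: e2P; rewrite /eball /=; have := ler_enormB y x' x; lra.
  by have := uv x Ox; lra.
move=> near_r; near (0:R)^'+ => r; exists r => // x y xp.
have : ecball p rad `<=` (fun x => forall y : V,
    enorm (y - x) < r -> ~ (O x /\ O y) -> u x - v y < th) by near: r.
by move=> /(_ x xp); apply.
Unshelve. all: by end_near. Qed.

Lemma doubling_max (u v : V -> R) (M A rad : R) (p : V) : usc u -> lsc v ->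
  (forall x, `|u x| <= M) -> (forall x, `|v x| <= M) -> 0 < A -> 0 <= rad ->
  exists x y : V, [/\ ecball p rad x, ecball p rad y &
    forall x' y', ecball p rad x' -> ecball p rad y' ->
      u x' - v y' - A * dot (x' - y') (x' - y') <= u x - v y - A * dot (x - y) (x - y)].
Proof.
move=> uu lv uM vM A0 rad0.
pose F (q : V * V) := u q.1 - v q.2 - A * dot (q.1 - q.2) (q.1 - q.2).
have cK : compact (ecball p rad `*` ecball p rad).
  by apply: compact_setX; exact: compact_ecball.
have cF : forall q a, (ecball p rad `*` ecball p rad) q -> F q < a -> \forall q' \near q, F q' < a.
  move=> [x y] a _ Fa.
  pose e := (a - F (x, y)) / 3.
  have e0 : 0 < e by rewrite divr_gt0// subr_gt0.
  have aE : a = F (x, y) + 3 * e by rewrite /e; lra.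
  have [r1 r10 r1P] := uu x e e0; have [r2 r20 r2P] := lv y e e0.
  have e0A : 0 < e / A by rewrite divr_gt0.
  have cn : continuous (quad 1 0 (0 : V)) by case: (C2_quad 1 0 (0 : V)).
  have /continuousVP/(_ (x - y) _ e0A)[r3 r30 r3P] := cn.
  have r32 : 0 < r3 / 2 by rewrite divr_gt0.
  near=> q'.
  have h1 : u q'.1 < u x + e.
    by apply: r1P; near: q'; exact: (cvg_fst (nbhs_eball x r10)).
  have h2 : v y - e < v q'.2.
    by apply: r2P; near: q'; exact: (cvg_snd (nbhs_eball y r20)).
  have h3 : enorm (q'.1 - x) < r3 / 2.
    by near: q'; exact: (cvg_fst (nbhs_eball x r32)).
  have h4 : enorm (q'.2 - y) < r3 / 2.
    by near: q'; exact: (cvg_snd (nbhs_eball y r32)).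
  have : `|quad 1 0 0 (x - y) - quad 1 0 0 (q'.1 - q'.2)| < e / A.
    apply: r3P; rewrite /eball /=.
    rewrite (_ : q'.1 - q'.2 - (x - y) = (q'.1 - x) - (q'.2 - y)); last first.
      by apply/rowP => i; rewrite !mxE; ring.
    by have := ler_enormD (q'.1 - x) (- (q'.2 - y)); rewrite enormN; lra.
  rewrite /quad !subr0 !mul1r !(dotC 0) !dot0r !addr0 ltr_pdivlMr// => h5.
  have h6 : (dot (x - y) (x - y) - dot (q'.1 - q'.2) (q'.1 - q'.2)) * A < e.
    apply: le_lt_trans h5; rewrite ler_pM2r//; exact: ler_norm.
  rewrite aE /F /=; move: h1 h2 h6; clear -hs oO bO; lra.
have ne : ecball p rad `*` ecball p rad !=set0.
  by exists (p, p); split; rewrite /ecball /= subrr enorm0.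
have bd q : (ecball p rad `*` ecball p rad) q -> F q <= 2 * M.
  move=> _; rewrite /F; have := uM q.1; have := vM q.2; rewrite !ler_norml.
  move=> /andP[? ?] /andP[? ?]; have := mulr_ge0 (ltW A0) (dot_ge0 (q.1 - q.2)); lra.
have [[x y] [/= cx cy] xyP] := usc_max_compact cK ne bd cF.
by exists x, y; split=> // x' y' cx' cy'; exact: (xyP (x', y')).
Unshelve. all: by end_near. Qed.

(** With m the tail mass, the two inequalities bound the difference of tails in direction z below by
    - 2 eta = - th m(D) / 4. Pointwise estimates bound it above by - th m(D) + (th + 8 M) m(T), at
    most - th m(D) / 2: a contradiction. *)
Lemma comparison (u v : V -> R) (M : R) : usc u -> lsc v ->
  (forall x, `|u x| <= M) -> (forall x, `|v x| <= M) ->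
  (forall x, ~ O x -> u x <= v x) ->
  (forall d a (p x : V), 0 < d -> eball x d `<=` O ->
    (forall y, eball x d y -> u y - quad a 0 p y <= u x - quad a 0 p x) ->
    forall z, sphere z -> 0 <= Esym s u (u x) (quad a 0 p) x z d) ->
  (forall d a (p x : V), 0 < d -> eball x d `<=` O ->
    (forall y, eball x d y -> v x - quad a 0 p x <= v y - quad a 0 p y) ->
    forall eta, 0 < eta -> exists2 z, sphere z & Esym s v (v x) (quad a 0 p) x z d <= eta) ->
  forall x, u x <= v x.
Proof.
move=> uu lv uM vM uv hu hv x1; rewrite leNgt; apply/negP => vu.
have M0 : 0 <= M by exact: le_trans (uM x1).
pose th := u x1 - v x1.
have th0 : 0 < th by rewrite subr_gt0.
have [D0 D00 OD] := bounded_ecball bO.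
(* More than the diameter of O, so a point of O moved by D or more in any direction has left O. *)
pose D := 2 * D0 + 1.
have D_gt0 : 0 < D by rewrite /D; lra.
have mD := tailm_gt0 hs D_gt0.
have Ox1 : O x1 by apply: contrapT => /uv; lra.
(* Past T only the crude bound 8 M is available; T is far enough for this to cost at most half of
   the gain th made from D on. *)
have [T DT mT] : exists2 T, D < T & (th + 8 * M) * tailm s T <= th * tailm s D / 2.
  have /andP[s0 _] := hs.
  have q0 : 0 < th + 8 * M by lra.
  have e0 : 0 < th * tailm s D / 2 / (th + 8 * M) * (2 * s).
    apply: mulr_gt0; last exact: mulr_gt0.
    by apply: divr_gt0 => //; apply: divr_gt0 => //; exact: mulr_gt0.
  have [L L1 LP] := tailm_small hs e0.
  exists (L + D); first by lra.
  have := LP (L + D); rewrite lerDl (ltW D_gt0) => /(_ isT).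
  rewrite -ler_pdivrMr; last by lra.
  by rewrite -/(tailm s (L + D)) ler_pdivlMr// mulrC.
have T0 : 0 < T by lra.
have th2 : 0 < th / 2 by rewrite divr_gt0.
have [r r0 rP] := @usc_lsc_gap u v 0 _ (D0 + T) uu lv th2 uv.
(* The penalty at a maximum is below 2 M < A r^2, so the two points are closer than r. *)
pose A := (2 * M + 1) / r ^+ 2.
have r20 : 0 < r ^+ 2 by rewrite exprn_gt0.
have A0 : 0 < A by rewrite divr_gt0//; lra.
have Ar : A * r ^+ 2 = 2 * M + 1 by rewrite /A divfK// gt_eqF.
clearbody A.
have DT0 : 0 <= D0 + T by lra.
(* The maximum is over a ball of radius D0 + T and not over the closure of O, so that it can be
   tested at points moved along lines up to distance T. *)
have [x [y [cx cy xyP]]] := doubling_max 0 uu lv uM vM A0 DT0.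
have D0T : D0 <= D0 + T by lra.
have OK (q : V) : O q -> ecball 0 (D0 + T) q.
  by move=> /OD; rewrite /ecball /= => /le_trans; apply.
have max1 : th <= u x - v y - A * dot (x - y) (x - y).
  by have := xyP x1 x1 (OK _ Ox1) (OK _ Ox1); rewrite subrr dot0r mulr0 subr0.
have dxy0 := mulr_ge0 (ltW A0) (dot_ge0 (x - y)).
have S0 : th <= u x - v y by lra.
have xy_r : enorm (y - x) < r.
  rewrite enormBC -(@ltr_pXn2r _ 2) ?nnegrE ?enorm_ge0 ?(ltW r0)// enorm_sqr.
  rewrite -(ltr_pM2l A0) Ar.
  have := uM x; have := vM y; rewrite !ler_norml => /andP[v1 v2] /andP[u1 u2].
  move: max1 th0 v1 v2 u1 u2; rewrite /th; clear -hs oO bO; lra.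
have [Ox Oy] : O x /\ O y.
  by apply: contrapT => /(rP _ _ cx xy_r); lra.
have OD' (q : V) : O q -> enorm q <= D0 by move=> /OD; rewrite /ecball /= subr0.
have xD := OD' _ Ox; have yD := OD' _ Oy.
have line (q z : V) t : sphere z -> enorm q <= D0 -> 0 <= t -> t <= T -> ecball 0 (D0 + T) (q + t *: z).
  move=> z1 qD t0 tT; rewrite /ecball /= subr0; apply: le_trans (ler_enormD _ _) _.
  by rewrite enormZ (z1 : enorm z = 1) mulr1 ger0_norm//; lra.
have lout (q z : V) t : sphere z -> enorm q <= D0 -> D <= t -> ~ O (q + t *: z).
  move=> z1 qD tD /OD; rewrite /ecball /= subr0 => h1.
  have := ler_enormD (q + t *: z) (- q); rewrite enormN addrAC subrr add0r enormZ.
  rewrite (z1 : enorm z = 1) mulr1 ger0_norm//; move: qD tD h1 D00; rewrite /D; clear -hs oO bO; lra.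
(* Translating both points by the same vector leaves the penalty unchanged. *)
have br (z : V) t : sphere z -> 0 <= t -> t <= T ->
    u (x + t *: z) - v (y + t *: z) <= u x - v y.
  move=> z1 t0 tT; have := xyP _ _ (line x z t z1 xD t0 tT) (line y z t z1 yD t0 tT).
  rewrite (_ : x + t *: z - (y + t *: z) = x - y); last first.
    by apply/rowP => i; rewrite !mxE; ring.
  clear -hs oO bO; lra.
(* Out of O the gap is below th / 2 whereas it is at least th at (x, y); the two orientations of z
   together gain th. *)
have bo (z : V) t : sphere z -> D <= t -> t <= T ->
    u (x + t *: z) - v (y + t *: z) <= u x - v y - th / 2.
  move=> z1 tD tT; have t0 : 0 <= t by lra.
  have h1 : enorm (y + t *: z - (x + t *: z)) < r.
    rewrite (_ : y + t *: z - (x + t *: z) = y - x)//.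
    by apply/rowP => i; rewrite !mxE; ring.
  have := rP _ _ (line x z t z1 xD t0 tT) h1.
  have nO : ~ (O (x + t *: z) /\ O (y + t *: z)) by move=> [/(lout x z t z1 xD tD)].
  by move=> /(_ nO); move: S0; clear -hs oO bO; lra.
have [d1 d10 d1O] := open_eball oO Ox; have [d2 d20 d2O] := open_eball oO Oy.
pose eta := th * tailm s D / 8.
have eta0 : 0 < eta by rewrite divr_gt0// mulr_gt0.
have eA : 0 < eta / (4 * A) by rewrite divr_gt0// mulr_gt0.
have [d3 d30 d3P] := J_cutsq_small hs eA.
pose d := Num.min (Num.min d1 d2) (Num.min (d3 / 2) 1).
have d0 : 0 < d by rewrite !lt_min d10 d20 ltr01 andbT /= divr_gt0.
have dd1 : d <= d1 by rewrite !ge_min lexx.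
have dd2 : d <= d2 by rewrite !ge_min lexx orbT.
have dd3 : d < d3.
  have h1 : d <= d3 / 2 by rewrite !ge_min lexx /= !orbT.
  by move: d30 h1; clear -hs oO bO; lra.
have dd4 : d <= 1 by rewrite !ge_min lexx !orbT.
clearbody d.
have Jd : J s (cutsq d) * (4 * A) <= eta.
  by rewrite -ler_pdivlMr ?mulr_gt0//; apply: d3P; rewrite d0.
have dot0 (q : V) : dot 0 q = 0 by rewrite dotC dot0r.
have bx : eball x d `<=` O by move=> q h; apply: d1O; exact: lt_le_trans h dd1.
have by_ : eball y d `<=` O by move=> q h; apply: d2O; exact: lt_le_trans h dd2.
have Eu z : sphere z -> 0 <= Esym s u (u x) (quad A 0 y) x z d.
  move=> z1; apply: hu => // x' /bx /OK cx'; rewrite /quad !dot0 !addr0.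
  by have := xyP x' y cx' cy; clear -hs oO bO; lra.
have [z z1 Ev] : exists2 z, sphere z & Esym s v (v y) (quad (- A) 0 x) y z d <= eta.
  apply: hv => // y' /by_ /OK cy'; rewrite /quad !dot0 !addr0.
  have := xyP x y' cx cy'; rewrite -(opprB y x) -(opprB y' x) !dotNl !dotNr !opprK.
  by clear -hs oO bO; lra.
have zN : sphere (- z) by rewrite /sphere /= enormN.
have := Eu z z1.
rewrite (Esym_quad hs _ _ _ _ d0 (or_introl uu) uM (uM x) z1).
rewrite (Esym_quad hs _ _ _ _ d0 (or_intror lv) vM (vM y) z1) in Ev.
have aU := adm_Tail x z d0 (or_introl uu) uM (uM x).
have aV := adm_Tail y z d0 (or_intror lv) vM (vM y).
have aVN := adm_scale (-1) aV.
have aC := adm_cutR2 (- th) (th + 8 * M) D_gt0 T0.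
have := le_J hs (adm_add aU aVN) aC.
rewrite (JD hs aU aVN) (JZ hs _ aV) (J_cutR2 hs)//.
rewrite -/(Tail s u (u x) x z d) -/(Tail s v (v y) y z d) => /(_ _)lowb.
suff lo : forall t, 0 < t -> (if t < d then 0 else dd u (u x) x z t) +
    -1 * (if t < d then 0 else dd v (v y) y z t) <= - th * cutR D t + (th + 8 * M) * cutR T t.
  have := lowb lo; rewrite (mulNr th); move: Ev Jd mT eta0; rewrite /eta.
  move: (Tail s u _ _ _ _) (Tail s v _ _ _ _) (J s _) (tailm s T) (th * tailm s D) => tu tv j mt mth.
  clear -hs oO bO; lra.
move=> t t0; rewrite /cutR.
have dD : d < D by rewrite /D; lra.
have [td|dt] := ltP t d.
  rewrite (lt_trans td dD) (lt_trans td (lt_trans dD DT)); clear -hs oO bO; lra.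
have t0' := ltW t0.
rewrite (_ : dd u _ _ _ _ + -1 * _ =
  (u (x + t *: z) - v (y + t *: z) - (u x - v y)) +
  (u (x + t *: (- z)) - v (y + t *: (- z)) - (u x - v y))); last first.
  by rewrite /dd !scalerN; ring.
have [tT|Tt] := ltP t T; last first.
  rewrite ltNge (le_trans (ltW DT) Tt) /=.
  have := uM (x + t *: z); have := vM (y + t *: z).
  have := uM (x + t *: (- z)); have := vM (y + t *: (- z)).
  have := uM x; have := vM y; rewrite !ler_norml; clear -hs oO bO.
  by do 6 case/andP => ? ?; lra.
have [tD|Dt] := ltP t D.
  have := br z t z1 t0' (ltW tT); have := br (- z) t zN t0' (ltW tT); clear -hs oO bO; lra.
have := bo z t z1 Dt (ltW tT); have := bo (- z) t zN Dt (ltW tT); clear -hs oO bO; lra.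
Qed.

End Comparison.

(** * Truncated problems *)

Section Discrete.
Variables (R : realType) (N : nat) (s : R) (O : set 'rV[R]_N).
Local Notation V := 'rV[R]_N.
Variables (g : V -> R) (M eps : R).
Hypotheses (N0 : (0 < N)%N) (hs : 0 < s < 1) (oO : open O)
  (cg : {within ~` O, continuous g}) (gM : forall x, ~ O x -> `|g x| <= M)
  (M0 : 0 <= M) (eps0 : 0 < eps).

Let admissible (u : V -> R) := usc u /\ forall x, `|u x| <= M.

Lemma TailE (u : V -> R) c x z : admissible u -> `|c| <= M ->
  Tail s u c x z eps = Tail s u 0 x z eps - 2 * c * tailm s eps.
Proof.
move=> [uu uM] cM.
have z0 : `|0 : R| <= M by rewrite normr0.
rewrite -(J_cutR hs eps0) -mulNr -(JZ hs _ (adm_cutR eps0)).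
rewrite -(JD hs (adm_Tail x z eps0 (or_introl uu) uM z0) (adm_scale _ (adm_cutR eps0))).
apply: eq_J => t _; rewrite /cutR /dd; case: ifP => _; ring.
Qed.

Lemma sphere_nonempty : exists z : V, sphere z.
Proof.
case: N N0 => // n _; exists (delta_mx ord0 ord0); rewrite /sphere /= enormE /dot.
rewrite big_ord_recl big1 ?addr0 => [|i _]; first by rewrite mxE eqxx /= mulr1 sqrtr1.
by rewrite mxE /= mulr0.
Qed.

(** The mean of u along the line for the normalized truncated kernel. The truncated operator is a
    positive multiple of [avg u x z] - u x, so the equation becomes the fixed point u = inf of [avg]
    over directions. *)
Let avg (u : V -> R) (x z : V) := Tail s u 0 x z eps / (2 * tailm s eps).

Let m0 := tailm_gt0 hs eps0.
Let m20 : 0 < 2 * tailm s eps. Proof. by rewrite mulr_gt0. Qed.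

Let avgE (u : V -> R) c x z : admissible u -> `|c| <= M ->
  Tail s u c x z eps = 2 * tailm s eps * (avg u x z - c).
Proof.
move=> ua cM; rewrite TailE// /avg; by field; rewrite gt_eqF.
Qed.

Let adm0 u x z : admissible u ->
  adm (4 * M * (1 + eps ^- 2)) (fun t => if t < eps then 0 else dd u 0 x z t).
Proof. by move=> [uu uM]; apply: adm_Tail => //; [left|rewrite normr0]. Qed.

Let le_avg u v x z : admissible u -> admissible v -> (forall y, u y <= v y) ->
  avg u x z <= avg v x z.
Proof.
move=> ua va uv; rewrite /avg ler_pM2r ?invr_gt0//.
apply: (le_J hs (adm0 x z ua) (adm0 x z va)) => t _; case: ifP => // _.
by rewrite /dd lerD2r lerD.
Qed.

Let avg_le u x z : admissible u -> `|avg u x z| <= M.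
Proof.
move=> ua; have [uu uM] := ua.
have ub := adm0 x z ua; have ac := adm_cutR eps0.
rewrite /avg normrM (@ger0_norm _ (_^-1)) ?invr_ge0 ?(ltW m20)// ler_pdivrMr//.
have E : M * (2 * tailm s eps) = 2 * M * tailm s eps by ring.
have bd t : `|if t < eps then 0 else dd u 0 x z t| <= 2 * M * cutR eps t.
  rewrite /cutR; case: ifP => _; first by rewrite normr0 mulr0.
  rewrite /dd mulr0 subr0 mulr1; apply: le_trans (ler_normD _ _) _.
  by have := uM (x + t *: z); have := uM (x - t *: z); lra.
rewrite E -(J_cutR hs eps0) ler_norml -mulNr; apply/andP; split.
  rewrite -(JZ hs _ ac); apply: (le_J hs (adm_scale _ ac) ub) => t _.
  by have := bd t; rewrite ler_norml mulNr => /andP[].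
rewrite -(JZ hs _ ac); apply: (le_J hs ub (adm_scale _ ac)) => t _.
by have := bd t; rewrite ler_norml => /andP[].
Qed.

(** Points violating the bound would form a sequence converging to x, and the reverse Fatou lemma
    would give an average at x exceeding itself. *)
Let avg_usc u x z e : admissible u -> 0 < e ->
  exists2 r : R, 0 < r & forall y, eball x r y -> avg u y z < avg u x z + e.
Proof.
move=> ua e0; have [uu uM] := ua; apply: contrapT => nr.
have : forall n : nat, exists y : V, eball x (n.+1%:R^-1) y /\ avg u x z + e <= avg u y z.
  move=> n; apply: contrapT => ny; apply: nr; exists (n.+1%:R^-1); first by rewrite invr_gt0.
  by move=> y xy; rewrite ltNge; apply/negP => h; apply: ny; exists y.
move=> /choice[y yP].
have : Tail s u 0 x z eps + e * (2 * tailm s eps) <= Tail s u 0 x z eps.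
  apply: (@J_reverse_fatou R s hs (4 * M * (1 + eps ^- 2)) _
     (fun n t => if t < eps then 0 else dd u 0 (y n) z t)
     (fun t => if t < eps then 0 else dd u 0 x z t)).
  - by move=> n; exact: adm0.
  - exact: adm0.
  - move=> t t0 e1 e10; case: ifP => _; first by exists 0%N => n _; lra.
    have e2 : 0 < e1 / 2 by rewrite divr_gt0.
    have [r1 r10 r1P] := uu (x + t *: z) _ e2; have [r2 r20 r2P] := uu (x - t *: z) _ e2.
    pose r := Num.min r1 r2.
    have r0 : 0 < r by rewrite lt_min r10.
    exists (Num.trunc (r^-1)) => n nr0.
    have yr : enorm (y n - x) < r.
      apply: lt_trans (yP n).1 _; rewrite -[ltRHS]invrK ltf_pV2 ?posrE ?invr_gt0//.
      by apply: lt_le_trans (truncnS_gt _) _; rewrite ler_nat.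
    have h1 : u (y n + t *: z) < u (x + t *: z) + e1 / 2.
      apply: r1P; rewrite /eball /= (_ : _ - _ = y n - x); last first.
        by apply/rowP => i; rewrite !mxE; ring.
      by apply: lt_le_trans yr _; rewrite ge_min lexx.
    have h2 : u (y n - t *: z) < u (x - t *: z) + e1 / 2.
      apply: r2P; rewrite /eball /= (_ : _ - _ = y n - x); last first.
        by apply/rowP => i; rewrite !mxE; ring.
      by apply: lt_le_trans yr _; rewrite ge_min lexx orbT.
    by rewrite /dd; lra.
  - move=> e1 e10; exists 0%N => n _; have := (yP n).2.
    rewrite /avg -(ler_pM2r m20) mulrDl !divfK ?gt_eqF// /Tail; lra.
by have := mulr_gt0 e0 m20; lra.
Qed.

Let H (u : V -> R) x := inf [set avg u x z | z in @sphere R N].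

Let has_infH u x : admissible u -> has_inf [set avg u x z | z in @sphere R N].
Proof.
move=> ua; split; first by have [z z1] := sphere_nonempty; exists (avg u x z), z.
by exists (- M) => _ [z _ <-]; have := avg_le x z ua; rewrite ler_norml => /andP[].
Qed.

Let H_le u x z : admissible u -> sphere z -> H u x <= avg u x z.
Proof. by move=> ua z1; apply: ge_inf; [case: (has_infH x ua)|exists z]. Qed.

Let H_lt u x a : admissible u -> H u x < a -> exists2 z, sphere z & avg u x z < a.
Proof.
move=> ua /(inf_lt (has_infH x ua).1)[_ [z z1 <-] za]; by exists z.
Qed.

Let H_bd u x : admissible u -> `|H u x| <= M.
Proof.
move=> ua; rewrite ler_norml; apply/andP; split.
  apply: lb_le_inf; first by case: (has_infH x ua).
  by move=> _ [z _ <-]; have := avg_le x z ua; rewrite ler_norml => /andP[].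
have [z z1] := sphere_nonempty.
apply: le_trans (H_le x ua z1) _.
by have := avg_le x z ua; rewrite ler_norml => /andP[].
Qed.

Let H_usc u : admissible u -> usc (H u).
Proof.
move=> ua x e e0.
have e2 : 0 < e / 2 by rewrite divr_gt0.
have /(H_lt ua)[z z1 za] : H u x < H u x + e / 2 by rewrite ltrDl.
have [r r0 rP] := avg_usc x z ua e2; exists r => // y /rP ya.
apply: le_lt_trans (H_le y ua z1) _; apply: lt_trans ya _.
by rewrite [X in _ < _ + X](splitr e) addrA ltrD2r.
Qed.

Let le_H u v x : admissible u -> admissible v -> (forall y, u y <= v y) -> H u x <= H v x.
Proof.
move=> ua va uv; apply: lb_le_inf; first by case: (has_infH x va).
by move=> _ [z z1 <-]; apply: le_trans (H_le x ua z1) (le_avg _ _ ua va uv).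
Qed.

(** On the boundary the maximum of [H u] and g is taken, which keeps T inside the class of upper
    semicontinuous functions. *)
Let T u := upper_ext O g (H u).

Let T_adm u : admissible u -> admissible (T u).
Proof.
move=> ua; split; first by apply: usc_upper_ext => //; exact: H_usc.
by apply: upper_ext_le_bound => // x; exact: H_bd.
Qed.

Let le_T u v x : admissible u -> admissible v -> (forall y, u y <= v y) -> T u x <= T v x.
Proof.
move=> ua va uv; have := le_H x ua va uv; rewrite /T; move: (H u) (H v) => a b h.
rewrite /upper_ext.
case: asboolP => // _; case: asboolP => // _.
by rewrite ge_max !le_max h lexx orbT.
Qed.

(* Knaster-Tarski: upper semicontinuity survives arbitrary infima, so the
   infimum of all supersolutions of the truncated problem is a fixed point. *)
Let C v := admissible v /\ forall x, T v x <= v x.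
Let ue x := inf [set v x | v in C].

Let C_cst : C (fun=> M).
Proof.
have ca : admissible (fun=> M).
  by split=> [x e e0|x]; [exists 1 => // y _; rewrite ltrDl|rewrite ger0_norm].
by split=> // x; have [_ /(_ x)] := T_adm ca; rewrite ler_norml => /andP[].
Qed.

Let has_inf_ue x : has_inf [set v x | v in C].
Proof.
split; first by exists M, (fun=> M) => //; exact: C_cst.
by exists (- M) => _ [v [[_ vM] _] <-]; have := vM x; rewrite ler_norml => /andP[].
Qed.

Let ue_le v x : C v -> ue x <= v x.
Proof. by move=> Cv; apply: ge_inf; [case: (has_inf_ue x)|exists v]. Qed.

Let ue_adm : admissible ue.
Proof.
split.
  apply: near_usc => x a /(inf_lt (has_inf_ue x).1)[_ [v Cv <-] va]; have [[vu _] _] := Cv.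
  apply: filterS (usc_near vu va) => y; apply: le_lt_trans; exact: ue_le.
move=> x; rewrite ler_norml; apply/andP; split; last exact: (ue_le x C_cst).
apply: lb_le_inf; first by case: (has_inf_ue x).
by move=> _ [v [[_ vM] _] <-]; have := vM x; rewrite ler_norml => /andP[].
Qed.

Let Tue_le x : T ue x <= ue x.
Proof.
apply: lb_le_inf; first by case: (has_inf_ue x).
move=> _ [v Cv <-]; have [va Tv] := Cv; apply: le_trans (Tv x).
by apply: le_T => // y; exact: ue_le.
Qed.

Let ueE x : T ue x = ue x.
Proof.
apply/eqP; rewrite eq_le Tue_le /=; apply: ue_le; split; first exact: T_adm ue_adm.
by move=> y; apply: le_T => //; exact: T_adm ue_adm.
Qed.

(** The boundary conditions are relaxed: where u > g on the boundary, the fixed point is the infimum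
    of averages and the subsolution inequality holds. Supersolution inequalities are stated in O
    only, because u >= g elsewhere. *)
Lemma truncated_solution : exists u : V -> R, [/\ usc u, (forall x, `|u x| <= M),
    (forall x : V, ~ O x -> g x <= u x),
    (forall x : V, ~ closure O x -> u x = g x) &
    (forall x : V, closure O x -> (O x \/ g x < u x) ->
       forall z, sphere z -> 0 <= Tail s u (u x) x z eps) /\
    (forall x : V, O x -> forall b, 0 < b ->
       exists2 z, sphere z & Tail s u (u x) x z eps <= b)].
Proof.
have [uu uM] := ue_adm.
exists ue; split=> //.
- move=> x Ox; rewrite -ueE /T; have [cx|cx] := pselect (closure O x).
    by rewrite upper_ext_bd// le_max lexx orbT.
  by rewrite upper_ext_out.
- by move=> x cx; rewrite -ueE /T upper_ext_out.
split.
- move=> x cx Ogx z z1; rewrite avgE// mulr_ge0 ?(ltW m20)// subr_ge0.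
  apply: le_trans (H_le x ue_adm z1).
  have [Ox|Ox] := pselect (O x); first by rewrite -ueE /T upper_ext_in.
  case: Ogx => // gx; have := ueE x; rewrite /T upper_ext_bd// => mx.
  have : g x < Num.max (H ue x) (g x) by rewrite mx.
  by rewrite lt_max ltxx orbF => hg; rewrite -mx ge_max lexx ltW.
- move=> x Ox b b0.
  have : H ue x < ue x + b / (2 * tailm s eps).
    by rewrite -ueE /T upper_ext_in// ltrDl divr_gt0.
  move=> /(H_lt ue_adm)[z z1 za]; exists z => //.
  by rewrite avgE// -ler_pdivlMl// lerBlDl mulrC ltW.
Qed.

End Discrete.

(** * Half-relaxed limits and stability *)

Section Stability.
Variables (R : realType) (N : nat) (s : R).
Local Notation V := 'rV[R]_N.
Hypothesis hs : 0 < s < 1.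

Definition nu_ (n : nat) : R := n.+1%:R^-1.

Lemma nu_gt0 n : 0 < nu_ n.
Proof. by rewrite /nu_ invr_gt0. Qed.

Lemma nu_le m n : (m <= n)%N -> nu_ n <= nu_ m.
Proof. by move=> mn; rewrite /nu_ lef_pV2 ?posrE// ler_nat. Qed.

Lemma nu_small (e : R) : 0 < e -> exists n0, forall n, (n0 <= n)%N -> nu_ n < e.
Proof.
move=> e0; exists (Num.trunc e^-1) => n nn0.
rewrite /nu_ -[ltRHS]invrK ltf_pV2 ?posrE ?invr_gt0//.
by apply: lt_le_trans (truncnS_gt _) _; rewrite ler_nat.
Qed.

Lemma compact_subseq (Z : set V) (zs : nat -> V) : compact Z -> (forall m, Z (zs m)) ->
  exists2 z, Z z & forall k, exists m, (k <= m)%N /\ eball z (nu_ k) (zs m).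
Proof.
move=> cZ Zz.
have FZ : (zs @ \oo) Z by exists 0%N => // m _; exact: Zz.
have [z [Zzz cl]] := cZ (zs @ \oo) _ FZ.
exists z => // k.
have kA : (zs @ \oo) [set y | exists2 m, (k <= m)%N & y = zs m].
  by exists k => // m /= km; exists m.
have [y [[m km ->] yz]] := cl _ _ kA (nbhs_eball z (nu_gt0 k)).
by exists m.
Qed.

Section Limsup.
Variables (M : R) (un : nat -> V -> R).
Hypothesis uM : forall n x, `|un n x| <= M.

(** One parameter r governs both the ball and the indices n >= 1/r, so a single infimum expresses
    the joint limit in n and y. *)
Let hset (x : V) (r : R) := [set v | exists n y, [/\ r^-1 <= n%:R, eball x r y & v = un n y]].

(* upper half-relaxed limit *)
Definition Ls (x : V) : R := inf [set sup (hset x r) | r in [set r : R | 0 < r]].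

Let hset_ne x r : 0 < r -> has_sup (hset x r).
Proof.
move=> r0; split.
  exists (un (Num.trunc r^-1).+1 x), (Num.trunc r^-1).+1, x; split => //.
    exact/ltW/truncnS_gt.
  exact: eball_center.
by exists M => _ [n [y [_ _ ->]]]; have := uM n y; rewrite ler_norml => /andP[].
Qed.

Let has_infLs x : has_inf [set sup (hset x r) | r in [set r : R | 0 < r]].
Proof.
split; first by exists (sup (hset x 1)), 1 => //=.
exists (- M) => _ [r /= r0 <-]; have hs' := hset_ne x r0.
have [v Sv] := hs'.1; apply: le_trans (ub_le_sup hs'.2 Sv).
by have [n [y [_ _ ->]]] := Sv; have := uM n y; rewrite ler_norml => /andP[].
Qed.

Lemma Ls_lt x a : Ls x < a -> exists2 r, 0 < r &
  forall n y, r^-1 <= n%:R -> eball x r y -> un n y < a.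
Proof.
move=> /(inf_lt (has_infLs x).1)[_ [r /= r0 <-] ra]; exists r => // n y rn xy.
apply: le_lt_trans ra; apply: ub_le_sup; first by case: (hset_ne x r0).
by exists n, y.
Qed.

Lemma Ls_gt x a r : a < Ls x -> 0 < r ->
  exists n y, [/\ r^-1 <= n%:R, eball x r y & a < un n y].
Proof.
move=> ax r0; have : a < sup (hset x r).
  by apply: lt_le_trans ax _; apply: ge_inf; [case: (has_infLs x)|exists r].
move=> /(sup_gt (hset_ne x r0).1)[_ [n [y [rn xy ->]]] ay].
by exists n, y.
Qed.

Lemma Ls_bd x : `|Ls x| <= M.
Proof.
rewrite ler_norml; apply/andP; split; rewrite leNgt; apply/negP.
  move=> /Ls_lt[r r0 rP].
  have := rP (Num.trunc r^-1).+1 x (ltW (truncnS_gt _)) (eball_center _ r0).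
  by have := uM (Num.trunc r^-1).+1 x; rewrite ler_norml => /andP[]; lra.
move=> /Ls_gt/(_ ltr01)[n [y [_ _]]].
by have := uM n y; rewrite ler_norml => /andP[]; lra.
Qed.

Lemma usc_Ls : usc Ls.
Proof.
apply: near_usc => x a xa.
have [r r0 rP] := Ls_lt (midf_lt xa).1.
have r2 : 0 < r / 2 by rewrite divr_gt0.
apply: filterS (nbhs_eball x r2) => y; rewrite /eball /= => xy.
rewrite ltNge; apply/negP => ay.
have /Ls_gt/(_ r2)[n [y' [rn yy' ]]] : (Ls x + a) / 2 < Ls y.
  exact: lt_le_trans (midf_lt xa).2 ay.
apply/negP; rewrite -leNgt; apply/ltW; apply: rP.
  apply: le_trans rn; rewrite lef_pV2 ?posrE//.
  by rewrite ler_pdivrMr// ler_peMr ?(ltW r0)// ler1n.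
rewrite /eball /= in yy' *; apply: le_lt_trans (ler_enormB y' y x) _.
by rewrite (splitr r) ltrD.
Qed.

End Limsup.

(** Everything moves: functions, points, directions, truncation radii [ek] and penalty weights [hk].
    Points stay within 1 of x0, so one constant bounds all second differences of phi; the penalty
    term 2 [hk] t^2 and the truncation disappear pointwise for each t > 0. *)
Lemma Esym_reverse_fatou (U phi : V -> R) (M d c : R) (x0 z : V)
    (fk : nat -> V -> R) (xk zk : nat -> V) (ck ek hk : nat -> R) :
  0 < d -> C2 phi -> usc U -> (forall x, `|U x| <= M) -> `|c| <= M ->
  (forall k, usc (fk k) \/ lsc (fk k)) -> (forall k x, `|fk k x| <= M) ->
  (forall k, `|ck k| <= M) ->
  (forall k, eball x0 (nu_ k) (xk k)) -> (forall k, eball z (nu_ k) (zk k)) ->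
  sphere z -> (forall k, sphere (zk k)) -> (forall k, `|ck k - c| < nu_ k) ->
  (forall k, 0 < ek k <= nu_ k) -> (forall k, 0 < hk k <= nu_ k) ->
  (forall y a, U y < a -> exists2 r, 0 < r & exists k0, forall k y', (k0 <= k)%N ->
     eball y r y' -> fk k y' < a) ->
  (forall k, - nu_ k <= J s (fun t => if t < d then
      (if t < ek k then 0 else dd phi (phi (xk k)) (xk k) (zk k) t + 2 * hk k * t ^+ 2)
      else (if t < ek k then 0 else dd (fk k) (ck k) (xk k) (zk k) t))) ->
  0 <= Esym s U c phi x0 z d.
Proof.
move=> d0 cphi uU UM cM fsc fM ckM xkP zkP z1 zk1 ckP ekP hkP LS JP.
have M0 : 0 <= M by exact: le_trans cM.
have [C C0 CP] := dd_C2_le x0 (1 + d) cphi.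
have cph : continuous phi by case: cphi.
have nu1 k : nu_ k <= 1 by rewrite /nu_ invf_le1// ler1n.
pose C' := (C + 2) * (1 + d ^+ 2) + 4 * M * (1 + d ^- 2).
have md (f : V -> R) c' x z' : usc f \/ lsc f -> measurable_fun [set: R] (dd f c' x z').
  exact: measurable_dd.
have mcut e (f : R -> R) : measurable_fun [set: R] f ->
    measurable_fun [set: R] (fun t => if t < e then 0 else f t).
  by move=> mf; apply: measurable_cut.
have C20 : 0 <= C + 2 by rewrite addr_ge0.
have M40 : 0 <= 4 * M by rewrite mulr_ge0.
have phisc : usc phi \/ lsc phi by left; exact: continuous_usc.
have conv t sg r : `|sg| = 1 -> 0 < t -> 0 < r -> exists k0, forall k, (k0 <= k)%N ->
    eball (x0 + (sg * t) *: z) r (xk k + (sg * t) *: zk k).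
  move=> sg1 t0 r0; have t1 : 0 < 1 + t by lra.
  have [k0 k0P] := nu_small (divr_gt0 r0 t1).
  exists k0 => k /k0P; rewrite ltr_pdivlMr// => kr; rewrite /eball /=.
  rewrite (_ : _ - _ = (xk k - x0) + (sg * t) *: (zk k - z)); last first.
    by apply/rowP => i; rewrite !mxE; ring.
  apply: le_lt_trans (ler_enormD _ _) _; rewrite enormZ normrM sg1 mul1r (gtr0_norm t0).
  apply: lt_trans kr; rewrite mulrDr mulr1 ltrD//; first exact: xkP.
  by rewrite mulrC ltr_pM2r//; exact: zkP.
have cphik : forall sg t, `|sg| = 1 -> 0 < t -> forall e, 0 < e -> exists k0, forall k, (k0 <= k)%N ->
    `|phi (x0 + (sg * t) *: z) - phi (xk k + (sg * t) *: zk k)| < e.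
  move=> sg t sg1 t0 e e0.
  have /continuousVP/(_ (x0 + (sg * t) *: z) _ e0)[r r0 rP] := cph.
  by have [k0 k0P] := conv t sg r sg1 t0 r0; exists k0 => k /k0P /rP.
have fkk : forall sg t, `|sg| = 1 -> 0 < t -> forall e, 0 < e -> exists k0, forall k, (k0 <= k)%N ->
    fk k (xk k + (sg * t) *: zk k) < U (x0 + (sg * t) *: z) + e.
  move=> sg t sg1 t0 e e0.
  have [|r r0 [k1 k1P]] := LS (x0 + (sg * t) *: z) (U (x0 + (sg * t) *: z) + e).
    by rewrite ltrDl.
  have [k0 k0P] := conv t sg r sg1 t0 r0; exists (maxn k0 k1) => k.
  by rewrite geq_max => /andP[/k0P h1 /k1P]; apply.
apply: (@J_reverse_fatou R s hs C' 0
  (fun k t => if t < d then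
      (if t < ek k then 0 else dd phi (phi (xk k)) (xk k) (zk k) t + 2 * hk k * t ^+ 2)
      else (if t < ek k then 0 else dd (fk k) (ck k) (xk k) (zk k) t))).
- move=> k; apply: adm_cut => //.
  + apply: mcut; apply: measurable_funD; first exact: md.
    by apply: measurable_funM => //; exact: measurable_funX.
  + by apply: mcut; exact: md.
  + move=> t /andP[t0 td]; case: ifP => _.
      by rewrite normr0 mulr_ge0// sqr_ge0.
    rewrite (mulrDl C); apply: le_trans (ler_normD _ _) _; apply: lerD.
      apply: CP => //; apply: lerD; last exact: ltW.
      exact/ltW/(lt_le_trans (xkP k)).
    have /andP[h0 hnu] := hkP k.
    rewrite ger0_norm; last by rewrite mulr_ge0 ?sqr_ge0// mulr_ge0// ltW.
    rewrite ler_wpM2r ?sqr_ge0// -[leRHS]mulr1 ler_pM2l//.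
    exact: le_trans hnu (nu1 k).
  + move=> t _; case: ifP => _; first by rewrite normr0.
    exact: dd_le.
- have := @adm_cut R (C + 2) (4 * M) d (dd phi (phi x0) x0 z) (dd U c x0 z) d0 C20 M40.
  apply; [exact: md|by apply: md; left| |].
    move=> t /andP[t0 td]; apply: (@le_trans _ _ (C * t ^+ 2)).
      by apply: CP => //; rewrite subrr enorm0; lra.
    by rewrite ler_wpM2r ?sqr_ge0// lerDl.
  by move=> t _; exact: dd_le.
- move=> t t0 e e0.
  have e5 : 0 < e / 5 by rewrite divr_gt0.
  have n1 : `|1 : R| = 1 by rewrite normr1.
  have n2 : `|-1 : R| = 1 by rewrite normrN1.
  case: ifP => td.
    have [k1 k1P] := cphik 1 t n1 t0 _ e5.
    have [k2 k2P] := cphik (-1) t n2 t0 _ e5.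
    have /continuousVP/(_ x0 _ e5)[r r0 rP] := cph.
    have [k3 k3P] := nu_small r0.
    have t20 : 0 < 2 * t ^+ 2 by rewrite mulr_gt0// exprn_gt0.
    have [k4 k4P] := nu_small (divr_gt0 e5 t20).
    have [k5 k5P] := nu_small t0.
    exists (maxn (maxn k1 k2) (maxn k3 (maxn k4 k5))) => k.
    rewrite !geq_max => /andP[/andP[/k1P h1 /k2P h2] /andP[/k3P h3 /andP[/k4P h4 /k5P h5]]].
    have {}h4 : hk k < e / 5 / (2 * t ^+ 2) by apply: le_lt_trans h4; case/andP: (hkP k).
    rewrite (_ : t < ek k = false); last first.
      by apply/negbTE; rewrite -leNgt; apply: le_trans (ltW h5); case/andP: (ekP k).
    have h6 := rP _ (lt_trans (xkP k) h3).
    rewrite ltr_pdivlMr// in h4.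
    rewrite /dd; move: h1 h2 h4 h6; rewrite !mul1r !mulN1r !scaleNr !ltr_norml.
    move=> /andP[h1 _] /andP[h2 _] h4 /andP[h6 h6'].
    by move: h1 h2 h4 h6 h6'; clear -hs; lra.
  have [k1 k1P] := fkk 1 t n1 t0 _ e5.
  have [k2 k2P] := fkk (-1) t n2 t0 _ e5.
  have [k3 k3P] := nu_small e5.
  have [k5 k5P] := nu_small t0.
  exists (maxn (maxn k1 k2) (maxn k3 k5)) => k.
  rewrite !geq_max => /andP[/andP[/k1P h1 /k2P h2] /andP[/k3P h3 /k5P h5]].
  rewrite (_ : t < ek k = false); last first.
    by apply/negbTE; rewrite -leNgt; apply: le_trans (ltW h5); case/andP: (ekP k).
  have h6 := lt_trans (ckP k) h3.
  rewrite /dd; move: h1 h2 h6; rewrite !mul1r !mulN1r !scaleNr !ltr_norml.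
  move=> h1 h2 /andP[h6 _].
  by move: h1 h2 h6 e0; clear -hs; lra.
- move=> e e0; have [k0 k0P] := nu_small e0; exists k0 => k /k0P ke.
  by apply: le_trans (JP k); lra.
Qed.


(* The penalty eta |y - x0|^2 makes x0 a strict maximum, so near-maximum points
   of un n - psi are trapped near x0 for large n. *)
Lemma near_max (M : R) (un : nat -> V -> R) (phi : V -> R) (d rho eta : R) (x0 : V)
    (alpha : nat -> R) :
  (forall n x, `|un n x| <= M) -> continuous phi -> 0 < d -> 0 < rho -> 0 < eta ->
  (forall n, 0 < alpha n) ->
  (forall y, eball x0 d y -> Ls un y - phi y <= Ls un x0 - phi x0) ->
  exists n x, [/\ rho^-1 <= n%:R, eball x0 rho x, `|un n x - Ls un x0| < rho &
    forall y, ecball x0 (3 / 4 * d) y ->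
      un n y - (phi y + eta * dot (y - x0) (y - x0)) <=
      un n x - (phi x + eta * dot (x - x0) (x - x0)) + alpha n].
Proof.
move=> uM cphi d0 rho0 eta0 alpha0 mx.
pose psi y := phi y + eta * dot (y - x0) (y - x0).
have cpsi : continuous psi.
  rewrite (_ : psi = fun y => phi y + quad eta 0 x0 y); last first.
    by apply/funext => y; rewrite /psi /quad (dotC 0) dot0r addr0.
  move=> y; have FF : Filter (nbhs y) := nbhs_filter (y : V).
  by apply: cvgD; [exact: cphi|case: (C2_quad eta 0 x0) => c _ _ _ _; exact: c].
have psi0 : psi x0 = phi x0 by rewrite /psi subrr dot0r mulr0 addr0.
have rho4 : 0 < rho / 4 by rewrite divr_gt0.
have [r1 r10 r1P] : exists2 r, 0 < r & forall n y, r^-1 <= n%:R -> eball x0 r y ->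
    un n y < Ls un x0 + rho.
  by apply: (Ls_lt uM); rewrite ltrDl.
have /continuousVP/(_ x0 _ rho4)[r2 r20 r2P] := cpsi.
pose m := Num.min (Num.min r1 r2) rho.
have m0 : 0 < m by rewrite !lt_min r10 r20.
have mr1 : m <= r1 by rewrite !ge_min lexx.
have mr2 : m <= r2 by rewrite !ge_min lexx orbT.
have mrho : m <= rho by rewrite !ge_min lexx orbT.
clearbody m.
have em : 0 < eta * m ^+ 2 by rewrite mulr_gt0// exprn_gt0.
pose S0 := Ls un x0 - psi x0.
(* At distance m or more the penalty costs eta m^2; compactness transfers half of this loss
   uniformly from [Ls un] to [un n] for large n. *)
have [n1 [n1P n1P']] : exists r : R, 0 < r /\ forall n (y : V), r^-1 <= n%:R -> ecball x0 (3 / 4 * d) y ->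
    m <= enorm (y - x0) -> un n y - psi y < S0 - eta * m ^+ 2 / 2.
  have : \forall r \near (0:R)^'+, ecball x0 (3 / 4 * d) `<=` (fun y => forall n,
      r^-1 <= n%:R -> m <= enorm (y - x0) -> un n y - psi y < S0 - eta * m ^+ 2 / 2).
    have /compact_near_coveringP := @compact_ecball R N x0 (3 / 4 * d); apply => y yd.
    have [ym|my] := ltP (enorm (y - x0)) m.
      have [e e0 eP] : exists2 e, 0 < e & forall y', eball y e y' -> enorm (y' - x0) < m.
        exists (m - enorm (y - x0)); first by rewrite subr_gt0.
        move=> y'; rewrite /eball /= ltrBrDr; apply: le_lt_trans; exact: ler_enormB.
      near=> y' r => /= n _; rewrite leNgt => /negP; case.
      by apply: eP; near: y'; exact: nbhs_eball.
    have yd' : eball x0 d y.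
      by apply: le_lt_trans yd _; rewrite -[ltRHS]mul1r ltr_pM2r//; lra.
    have U0 : Ls un y < psi y + S0 - 3 / 4 * (eta * m ^+ 2).
      have h2 : eta * m ^+ 2 <= eta * dot (y - x0) (y - x0).
        by rewrite -enorm_sqr ler_pM2l// lerXn2r ?nnegrE ?enorm_ge0 ?(ltW m0).
      have := mx _ yd'; rewrite /S0 psi0 /psi; move: h2 em.
      move: (Ls un y) (Ls un x0) (phi y) (phi x0) (eta * m ^+ 2) (eta * dot _ _); clear -hs => *; lra.
    have [r r0 rP] := Ls_lt uM U0.
    have em8 : 0 < eta * m ^+ 2 / 8 by rewrite divr_gt0.
    have /continuousVP/(_ y _ em8)[e e0 eP] := cpsi.
    near=> y' r' => /= n rn _.
    have h1 : un n y' < psi y + S0 - 3 / 4 * (eta * m ^+ 2).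
      apply: rP; last by near: y'; exact: nbhs_eball.
      apply: le_trans rn; rewrite lef_pV2 ?posrE//.
      by near: r'; exact: nbhs_right_le.
    have : `|psi y - psi y'| < eta * m ^+ 2 / 8.
      by apply: eP; near: y'; exact: nbhs_eball.
    rewrite ltr_norml => /andP[_]; move: h1 em; clear -hs; lra.
  move=> near_r; near (0:R)^'+ => r; exists r; split=> // n y rn yd.
  have : ecball x0 (3 / 4 * d) `<=` (fun y => forall n,
      r^-1 <= n%:R -> m <= enorm (y - x0) -> un n y - psi y < S0 - eta * m ^+ 2 / 2) by near: r.
  by move=> /(_ y yd n rn); apply.
(* Spent three times: in the choice of y, in the variation of psi, in the near-supremum. 3 tau < eta
   m^2 / 2 excludes points at distance m, and 3 tau + rho / 4 < rho controls the value at x. *)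
pose tau := Num.min (eta * m ^+ 2 / 8) (rho / 8).
have tau0 : 0 < tau by rewrite lt_min !divr_gt0.
have tau1 : tau <= eta * m ^+ 2 / 8 by rewrite ge_min lexx.
have tau2 : tau <= rho / 8 by rewrite ge_min lexx orbT.
clearbody tau.
have /continuousVP/(_ x0 _ tau0)[r3 r30 r3P] := cpsi.
have d34 : 0 < 3 / 4 * d by rewrite mulr_gt0.
pose r4 := Num.min (Num.min r1 n1) (Num.min (Num.min r3 (3 / 4 * d)) rho).
have r40 : 0 < r4 by rewrite !lt_min r10 n1P r30 d34 rho0.
have V4 r' : 0 < r' -> r4 <= r' -> forall n : nat, r4^-1 <= n%:R -> r'^-1 <= n%:R.
  by move=> r'0 h n; apply: le_trans; rewrite lef_pV2 ?posrE.
have [n [y [rn x0y uy]]] : exists n y, [/\ r4^-1 <= n%:R, eball x0 r4 y & Ls un x0 - tau < un n y].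
  by apply: (Ls_gt uM) => //; rewrite ltrBlDr ltrDl.
have yball : ecball x0 (3 / 4 * d) y.
  by rewrite /ecball /=; apply/ltW/(lt_le_trans x0y); rewrite !ge_min lexx !orbT.
pose A := [set un n y' - psi y' | y' in ecball x0 (3 / 4 * d)].
have [B B0 BP] := continuous_bounded_ecball x0 (3 / 4 * d) cpsi.
have hA : has_sup A.
  split; first by exists (un n y - psi y), y.
  exists (M + B) => _ [y' yb <-]; apply: lerD.
    exact: le_trans (ler_norm _) (uM _ _).
  by apply: le_trans (ler_norm _) _; rewrite normrN; exact: BP.
(* No semicontinuity of [un n] is assumed here, so the supremum is only approached, with an error
   that may depend on n. *)
pose al := Num.min tau (alpha n).
have al0 : 0 < al by rewrite lt_min tau0 alpha0.
have al1 : al <= tau by rewrite ge_min lexx.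
have al2 : al <= alpha n by rewrite ge_min lexx orbT.
clearbody al.
have [_ [x xb <-] xal] : exists2 v, A v & sup A - al < v.
  by apply: sup_gt; [case: hA|rewrite ltrBlDr ltrDl].
have Asup y' : ecball x0 (3 / 4 * d) y' -> un n y' - psi y' <= sup A.
  by move=> yb; apply: ub_le_sup; [case: hA|exists y'].
have r4r3 : r4 <= r3 by rewrite !ge_min lexx !orbT.
have psiy : `|psi x0 - psi y| < tau by apply: r3P; exact: lt_le_trans x0y r4r3.
have low : S0 - 3 * tau < un n x - psi x.
  have := Asup y yball; move: psiy; rewrite ltr_norml /S0 => /andP[h _].
  by move: h uy xal al1; clear -hs; lra.
have r4n1 : r4 <= n1 by rewrite !ge_min lexx !orbT.
have r4r1 : r4 <= r1 by rewrite !ge_min lexx.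
have r4rho : r4 <= rho by rewrite !ge_min lexx !orbT.
have xm : enorm (x - x0) < m.
  rewrite ltNge; apply/negP => mx'.
  have := n1P' n x (V4 _ n1P r4n1 n rn) xb mx'; move: low tau1 em; clear -hs; lra.
exists n, x; split.
- exact: (V4 _ rho0 r4rho).
- exact: lt_le_trans xm mrho.
- have u1 : un n x < Ls un x0 + rho.
    apply: r1P; first exact: (V4 _ r10 r4r1).
    exact: lt_le_trans xm mr1.
  have := r2P x (lt_le_trans xm mr2); rewrite ltr_norml => /andP[p1 p2].
  rewrite ltr_norml; move: low u1 p1 p2 tau2; rewrite /S0; clear -hs.
  by move=> *; apply/andP; split; lra.
- move=> y' /Asup; rewrite -/(psi y') -/(psi x); move: xal al2; clear -hs; lra.
Unshelve. all: by end_near. Qed.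

Lemma adm_Esym (U phi : V -> R) (M d c : R) (x z : V) : 0 < d -> C2 phi ->
  usc U \/ lsc U -> (forall x, `|U x| <= M) -> `|c| <= M -> sphere z ->
  exists C, adm C (fun t => if t < d then dd phi (phi x) x z t else dd U c x z t).
Proof.
move=> d0 cphi Usc UM cM z1; have M0 : 0 <= M by exact: le_trans cM.
have [C C0 CP] := dd_C2_le x d cphi; eexists; apply: (@adm_cut R C (4 * M) d) => //.
- exact: mulr_ge0.
- by apply: measurable_dd; left; apply: continuous_usc; case: cphi.
- exact: measurable_dd.
- by move=> t /andP[t0 td]; apply: CP => //; rewrite subrr enorm0 add0r ltW.
- by move=> t _; exact: dd_le.
Qed.

(** Between d' and d the increments of U are replaced by those of phi, which are larger because phi
    touches U from above at x; further out U is replaced by W. *)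
Lemma le_Esym (U W phi : V -> R) (M d d' : R) (x z : V) : 0 < d' -> d' <= d -> C2 phi ->
  usc U \/ lsc U -> (forall x, `|U x| <= M) ->
  usc W \/ lsc W -> (forall x, `|W x| <= M) -> sphere z ->
  (forall y, U y <= W y) ->
  (forall y, eball x d y -> U y - phi y <= U x - phi x) ->
  Esym s U (U x) phi x z d' <= Esym s W (U x) phi x z d.
Proof.
move=> d'0 d'd cphi Usc UM Wsc WM z1 UW mx.
have d0 := lt_le_trans d'0 d'd.
have [C1 a1] := adm_Esym x d'0 cphi Usc UM (UM x) z1.
have [C2 a2] := adm_Esym x d0 cphi Wsc WM (UM x) z1.
apply: (le_J hs a1 a2) => t t0.
have [td'|d't] := ltP t d'; first by rewrite (lt_le_trans td' d'd).
have [td|dt] := ltP t d; last by rewrite /dd lerD2r lerD.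
have h1 : U (x + t *: z) - phi (x + t *: z) <= U x - phi x.
  by apply: mx; rewrite /eball /= addrAC subrr add0r enormZ (z1 : enorm z = 1) mulr1 gtr0_norm.
have h2 : U (x - t *: z) - phi (x - t *: z) <= U x - phi x.
  by apply: mx; rewrite /eball /= addrAC subrr add0r enormN enormZ (z1 : enorm z = 1) mulr1 gtr0_norm.
by rewrite /dd; move: h1 h2; clear -hs; lra.
Qed.

(** Near-maximum points provide truncated inequalities for [un n], whose inner part is replaced by
    the penalized test function; directions in Z converge along a subsequence. A singleton Z yields
    a prescribed direction, the sphere yields some direction. *)
Lemma stability (M : R) (un : nat -> V -> R) (phi : V -> R) (d : R) (x0 : V) (Z : set V) :
  (forall n x, `|un n x| <= M) -> (forall n, usc (un n) \/ lsc (un n)) ->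
  C2 phi -> 0 < d -> compact Z -> Z `<=` @sphere R N ->
  (forall y, eball x0 d y -> Ls un y - phi y <= Ls un x0 - phi x0) ->
  (exists2 rho, 0 < rho & forall n x, rho^-1 <= n%:R -> eball x0 rho x ->
     `|un n x - Ls un x0| < rho -> forall b, 0 < b ->
     exists2 z, Z z & - b <= Tail s (un n) (un n x) x z (nu_ n)) ->
  exists2 z, Z z & 0 <= Esym s (Ls un) (Ls un x0) phi x0 z d.
Proof.
move=> uM usc_ cphi d0 cZ Zs mx [rho rho0 hrho].
have cph : continuous phi by case: cphi.
(* Half the radius: a point within d/4 of x0, moved by less than d/2, stays in the ball of radius
   3d/4 where near-maximality is known. *)
have d20 : 0 < d / 2 by rewrite divr_gt0.
have M0 : 0 <= M by exact: le_trans (uM 0%N x0).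
have step k : exists q : nat * V * V, let: (n, x, z) := q in
   [/\ (nu_ k)^-1 <= n%:R, eball x0 (nu_ k) x, `|un n x - Ls un x0| < nu_ k, Z z &
    - nu_ k <= J s (fun t => if t < d / 2 then
      (if t < nu_ n then 0 else dd phi (phi x) x z t + 2 * nu_ k * t ^+ 2)
      else (if t < nu_ n then 0 else dd (un n) (un n x) x z t))].
  have nk := nu_gt0 k.
  pose rk := Num.min (Num.min rho (nu_ k)) (Num.min (d / 4) 1).
  have rk0 : 0 < rk by rewrite !lt_min rho0 nk ltr01 divr_gt0.
  (* The error of the near-maximum enters twice against the truncated kernel, whose mass blows up
     with n; this choice makes the total nu_ k / 2, the other half being the tolerance on the
     equation. *)
  pose alpha n := nu_ k / (4 * tailm s (nu_ n)).
  have mn n : 0 < tailm s (nu_ n) by apply: tailm_gt0 => //; exact: nu_gt0.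
  have alpha0 n : 0 < alpha n by rewrite divr_gt0// mulr_gt0.
  have [n [x [rn xr ur xmax]]] := near_max uM cph d0 rk0 nk alpha0 mx.
  have rk1 : rk <= rho by rewrite !ge_min lexx.
  have rk2 : rk <= nu_ k by rewrite !ge_min lexx orbT.
  have rk3 : rk <= d / 4 by rewrite !ge_min lexx !orbT.
  have rk4 : rk <= 1 by rewrite !ge_min lexx !orbT.
  clearbody rk.
  have Vr r' : 0 < r' -> rk <= r' -> r'^-1 <= n%:R.
    by move=> r'0 h; apply: le_trans rn; rewrite lef_pV2 ?posrE.
  have nk2 : 0 < nu_ k / 2 by rewrite divr_gt0.
  have [z Zz zT] := hrho n x (Vr _ rho0 rk1) (lt_le_trans xr rk1) (lt_le_trans ur rk1) _ nk2.
  exists (n, x, z); split=> //.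
  - exact: Vr.
  - exact: lt_le_trans xr rk2.
  - exact: lt_le_trans ur rk2.
  have z1 := Zs _ Zz; have zz : enorm z = 1 := z1.
  have nn := nu_gt0 n.
  have aT := adm_Tail x z nn (usc_ n) (uM n) (uM n x).
  have aR := adm_cutR nn.
  have aL := adm_add aT (adm_scale (- 2 * alpha n) aR).
  have [C C0 CP] := dd_C2_le x0 (1 + d / 2) cphi.
  have aH : exists C', adm C' (fun t => if t < d / 2 then
      (if t < nu_ n then 0 else dd phi (phi x) x z t + 2 * nu_ k * t ^+ 2)
      else (if t < nu_ n then 0 else dd (un n) (un n x) x z t)).
    eexists; apply: (@adm_cut R (C + 2 * nu_ k) (4 * M)) => //.
    - by rewrite addr_ge0// mulr_ge0// ltW.
    - exact: mulr_ge0.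
    - apply: measurable_cut => //; apply: measurable_funD.
        by apply: measurable_dd; left; exact: continuous_usc.
      by apply: measurable_funM => //; exact: measurable_funX.
    - by apply: measurable_cut => //; exact: measurable_dd.
    - move=> t /andP[t0 td]; case: ifP => _.
        by rewrite normr0 mulr_ge0 ?sqr_ge0// addr_ge0// mulr_ge0// ltW.
      rewrite (mulrDl C); apply: le_trans (ler_normD _ _) _; apply: lerD.
        apply: CP => //; apply: lerD; last exact: ltW.
        exact/ltW/(lt_le_trans xr rk4).
      by rewrite ger0_norm// mulr_ge0 ?sqr_ge0// mulr_ge0// ltW.
    - move=> t _; case: ifP => _; first by rewrite normr0 mulr_ge0.
      by apply: dd_le.
  have {aH}[C' aH] := aH.
  have := le_J hs aL aH.
  rewrite (JD hs aT (adm_scale _ aR)) (JZ hs _ aR) (J_cutR hs nn) -/(Tail _ _ _ _ _ _).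
  have am : 2 * alpha n * tailm s (nu_ n) = nu_ k / 2.
    by rewrite /alpha; field; rewrite gt_eqF.
  move=> /(_ _)Jle.
  apply: (@le_trans _ _ (Tail s (un n) (un n x) x z (nu_ n) + - 2 * alpha n * tailm s (nu_ n))).
    by move: zT am; clear -hs; lra.
  apply: Jle => t t0; rewrite /cutR; have a0 := alpha0 n.
  have [tn|nt] := ltP t (nu_ n); first by rewrite mulr0 addr0; case: ifP.
  case: ifP => td; last by move: a0; clear -hs; lra.
  have inb (v : V) : enorm v = 1 -> ecball x0 (3 / 4 * d) (x + t *: v).
    move=> v1; rewrite /ecball /= addrAC; apply: le_trans (ler_enormD _ _) _.
    rewrite enormZ v1 mulr1 gtr0_norm//; have := lt_le_trans xr rk3; move: td.
    by rewrite /eball /=; clear -hs; lra.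
  have zN : enorm (- z) = 1 by rewrite enormN.
  have h1 := xmax _ (inb z zz); have h2 := xmax _ (inb (- z) zN).
  have := dd_quad (nu_ k) 0 x0 x t z1.
  rewrite /dd /quad !(dotC 0) !dot0r !addr0; rewrite scalerN in h2.
  by move: h1 h2; clear -hs; lra.
have [q qP] := choice step.
pose nq k := (q k).1.1; pose xq k := (q k).1.2; pose zq k := (q k).2.
have {}qP k : [/\ (nu_ k)^-1 <= (nq k)%:R, eball x0 (nu_ k) (xq k),
   `|un (nq k) (xq k) - Ls un x0| < nu_ k, Z (zq k) &
    - nu_ k <= J s (fun t => if t < d / 2 then
      (if t < nu_ (nq k) then 0 else dd phi (phi (xq k)) (xq k) (zq k) t + 2 * nu_ k * t ^+ 2)
      else (if t < nu_ (nq k) then 0 else dd (un (nq k)) (un (nq k) (xq k)) (xq k) (zq k) t))].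
  by have := qP k; rewrite /nq /xq /zq; case: (q k) => [[]].
clearbody nq xq zq.
have Zq k : Z (zq k) by case: (qP k).
have [z Zz /choice[mk mkP]] := compact_subseq cZ Zq.
have mk1 k : (k <= mk k)%N by case: (mkP k).
have nqk k : (k < nq (mk k))%N.
  have [h _ _ _ _] := qP (mk k); rewrite /nu_ invrK ler_nat in h.
  exact: leq_ltn_trans (mk1 k) h.
exists z => //; apply: (@le_trans _ _ (Esym s (Ls un) (Ls un x0) phi x0 z (d / 2))).
  apply: (@Esym_reverse_fatou _ phi M _ _ x0 z (fun k => un (nq (mk k)))
    (fun k => xq (mk k)) (fun k => zq (mk k)) (fun k => un (nq (mk k)) (xq (mk k)))
    (fun k => nu_ (nq (mk k))) (fun k => nu_ (mk k))) => //.
  - exact: usc_Ls uM.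
  - exact: Ls_bd.
  - exact: Ls_bd.
  - by move=> k; have [_ h _ _ _] := qP (mk k); apply: lt_le_trans h (nu_le (mk1 k)).
  - by move=> k; case: (mkP k).
  - exact: Zs.
  - by move=> k; exact: Zs.
  - by move=> k; have [_ _ h _ _] := qP (mk k); apply: lt_le_trans h (nu_le (mk1 k)).
  - by move=> k; rewrite nu_gt0 nu_le// ltnW.
  - by move=> k; rewrite nu_gt0 nu_le.
  - move=> y a /(Ls_lt uM)[r r0 rP]; exists r => //; exists (Num.trunc r^-1) => k y' kr yy'.
    apply: rP => //; apply/ltW; apply: lt_le_trans (truncnS_gt _) _.
    by rewrite ler_nat; apply: leq_ltn_trans kr (nqk k).
  - move=> k; have [_ _ _ _ h] := qP (mk k); apply: le_trans h.
    by rewrite lerN2 nu_le.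
apply: (@le_Esym _ _ _ M) => //.
- by rewrite ler_pdivrMr// ler_peMr ?(ltW d0)// ler1n.
- by left; exact: usc_Ls uM.
- exact: Ls_bd.
- by left; exact: usc_Ls uM.
- exact: Ls_bd.
- exact: Zs.
Qed.

End Stability.

(** * Viscosity sub- and supersolutions *)

Section Viscosity.
Variables (R : realType) (N : nat) (s : R) (O : set 'rV[R]_N).
Local Notation V := 'rV[R]_N.
Hypotheses (N0 : (0 < N)%N) (hs : 0 < s < 1) (oO : open O) (bO : bounded_set O)
  (dO : C2_domain O) (scO : strictly_convex O).

Lemma Ed_le0P (u w phi : V -> R) x d : (Ed s u w phi x d <= 0)%E <->
  forall z, sphere z -> 0 <= Ezd s u w phi x z d.
Proof.
rewrite /Ed oppe_le0; split=> [h z z1|h].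
  by rewrite -lee_fin; apply: le_trans h _; apply: ereal_inf_lbound; exists z.
by apply: le_ereal_inf_tmp => _ [z z1 <-]; rewrite lee_fin; exact: h.
Qed.

(** The infimum over directions is not known to be attained, hence the tolerance eta. *)
Lemma Ed_ge0 (u w phi : V -> R) x d eta : (0 <= Ed s u w phi x d)%E -> 0 < eta ->
  exists2 z, sphere z & Ezd s u w phi x z d <= eta.
Proof.
rewrite /Ed oppe_ge0 => h e0.
have /ereal_inf_lt[_ [z z1 <-]] :
    (ereal_inf [set (Ezd s u w phi x z d)%:E | z in @sphere R N] < eta%:E)%E.
  by apply: le_lt_trans h _; rewrite lte_fin.
by rewrite lte_fin => /ltW; exists z.
Qed.

Lemma ge0_Ed (u w phi : V -> R) x d z : sphere z -> Ezd s u w phi x z d <= 0 ->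
  (0 <= Ed s u w phi x d)%E.
Proof.
move=> z1 h; rewrite /Ed oppe_ge0; apply: ge_ereal_inf.
by exists (Ezd s u w phi x z d)%:E; [exists z|rewrite lee_fin].
Qed.

Lemma EsymN (w phi : V -> R) (M c d : R) (x z : V) : 0 < d -> C2 phi ->
  usc w \/ lsc w -> (forall x, `|w x| <= M) -> `|c| <= M -> sphere z ->
  Esym s (fun y => - w y) (- c) (fun y => - phi y) x z d = - Esym s w c phi x z d.
Proof.
move=> d0 cphi wsc wM cM z1; have [C a] := adm_Esym x d0 cphi wsc wM cM z1.
rewrite /Esym -(JN hs a); apply: eq_J => t _; case: ifP => _; rewrite /dd; ring.
Qed.

Lemma TailN (w : V -> R) (M c d : R) (x z : V) : 0 < d -> usc w \/ lsc w ->
  (forall x, `|w x| <= M) -> `|c| <= M ->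
  Tail s (fun y => - w y) (- c) x z d = - Tail s w c x z d.
Proof.
move=> d0 wsc wM cM; have a := adm_Tail x z d0 wsc wM cM.
rewrite /Tail -(JN hs a); apply: eq_J => t _; case: ifP => _; rewrite /dd; ring.
Qed.

Lemma C2N (phi : V -> R) : C2 phi -> C2 (fun y => - phi y).
Proof.
case=> c d cd dd_ cdd.
have E f (v : V) : (forall x, derivable f x v) ->
    'D_v (fun y => - f y : R) = fun y => - 'D_v f y.
  by move=> df; apply/funext => y; rewrite deriveN.
have cN (f : V -> R) : continuous f -> continuous (fun y => - f y).
  move=> cf y; have FF : Filter (nbhs y) := nbhs_filter (y : V).
  by apply: cvgN; exact: cf.
split.
- exact: cN.
- by move=> i x; apply: derivableN.
- by move=> i; rewrite E//; exact: cN.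
- by move=> i j x; rewrite E//; apply: derivableN.
- by move=> i j; rewrite E// E//; exact: cN.
Qed.

Section Data.
Variables (g : V -> R) (M : R).
Hypotheses (cg : {within ~` O, continuous g}) (gM : forall x, ~ O x -> `|g x| <= M).

(** The opposite functions satisfy the requirements of [lsc_boundary]: the inequality holds in every
    direction, so any fixed one will do, and a linear test has no inner integral. *)
Lemma subsol_boundary (u : V -> R) : usc u -> (forall x, `|u x| <= M) ->
  subsol_usc s O g u -> forall x : V, closure O x -> ~ O x -> u x <= g x.
Proof.
move=> uu uM [uout usub] x cx Ox; rewrite -lerN2.
have [z0 z01] := @sphere_nonempty R N N0.
have wu := usc_upper_ext oO cg uu.
have wM := upper_ext_le_bound uM gM.
apply: (@lsc_boundary R N s O hs oO bO dO scO (fun y => - g y) (fun y => - u y) M x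
  (within_contN cg) (uscN uu)) => //.
- by move=> y; rewrite normrN.
- by move=> y Oy; rewrite normrN gM.
- by move=> y cy; rewrite lerN2 uout.
- move=> d b y d0 cy Oy tst eta eta0; exists z0 => //.
  have phiE y' : quad 0 (- b) 0 y' = - dot b y' by rewrite /quad mul0r add0r dotNl.
  have tst' y' : eball y d y' -> u y' - quad 0 (- b) 0 y' <= u y - quad 0 (- b) 0 y.
    by move=> /tst; rewrite !phiE; lra.
  have [h1 h2] := usub d _ y d0 (C2_quad 0 (- b) 0) tst'.
  have /Ed_le0P/(_ z0 z01) : (Ed s u (upper_ext O g u) (quad 0 (- b) 0) y d <= 0)%E.
    have [Oy'|Oy'] := pselect (O y); first exact: h1.
    case: Oy => // gu; have := h2 cy Oy'; rewrite ge_min => /orP[//|].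
    by rewrite lee_fin => h; exfalso; lra.
  rewrite (EzdE hs d0 (C2_quad _ _ _) (or_introl wu) wM (uM y) z01).
  rewrite (Esym_quad hs _ _ _ _ d0 (or_introl wu) wM (uM y) z01) mulr0 mul0r add0r.
  rewrite lower_extN (TailN _ _ d0 (or_introl wu) wM (uM y)).
  by move: eta0; lra.
Qed.

Lemma supersol_boundary (u : V -> R) : lsc u -> (forall x, `|u x| <= M) ->
  supersol_lsc s O g u -> forall x : V, closure O x -> ~ O x -> g x <= u x.
Proof.
move=> lu uM [uout usup] x cx Ox.
have wl := lsc_lower_ext oO cg lu.
have wM := lower_ext_le_bound uM gM.
apply: (@lsc_boundary R N s O hs oO bO dO scO g u M x cg lu) => //.
move=> d b y d0 cy Oy tst eta eta0.
have phiE y' : quad 0 b 0 y' = dot b y' by rewrite /quad mul0r add0r.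
have tst' y' : eball y d y' -> u y - quad 0 b 0 y <= u y' - quad 0 b 0 y'.
  by move=> /tst; rewrite !phiE.
have [h1 h2] := usup d _ y d0 (C2_quad 0 b 0) tst'.
have /Ed_ge0/(_ eta0)[z z1] : (0 <= Ed s u (lower_ext O g u) (quad 0 b 0) y d)%E.
  have [Oy'|Oy'] := pselect (O y); first exact: h1.
  case: Oy => // gu; have := h2 cy Oy'; rewrite le_max => /orP[//|].
  by rewrite lee_fin => h; exfalso; lra.
rewrite (EzdE hs d0 (C2_quad _ _ _) (or_intror wl) wM (uM y) z1).
rewrite (Esym_quad hs _ _ _ _ d0 (or_intror wl) wM (uM y) z1) mulr0 mul0r add0r.
by exists z.
Qed.

(** [comparison] is applied to the two extensions. Attainment of the datum gives u <= g <= v on the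
    boundary, so the extensions are ordered off O; inside O they agree with u and v. *)
Lemma visc_comparison (u v : V -> R) : usc u -> lsc v ->
  (forall x, `|u x| <= M) -> (forall x, `|v x| <= M) ->
  subsol_usc s O g u -> supersol_lsc s O g v -> forall x, u x <= v x.
Proof.
move=> uu lv uM vM su sv.
have bu := subsol_boundary uu uM su; have bv := supersol_boundary lv vM sv.
have wu := usc_upper_ext oO cg uu; have uwM := upper_ext_le_bound uM gM.
have wv := lsc_lower_ext oO cg lv; have vwM := lower_ext_le_bound vM gM.
have [uout usub] := su; have [vout vsup] := sv.
have cmp : forall x, upper_ext O g u x <= lower_ext O g v x.
  apply: (comparison hs oO bO wu wv uwM vwM).
  - move=> x Ox; have [cx|cx] := pselect (closure O x).
      rewrite upper_ext_bd// lower_ext_bd// ge_max !le_min lexx.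
      by rewrite (bu x cx Ox) (bv x cx Ox) (le_trans (bu x cx Ox) (bv x cx Ox)).
    by rewrite upper_ext_out// lower_ext_out.
  - move=> d a p x d0 dx tst z z1.
    have Ox : O x by apply: dx; exact: eball_center.
    have tst' y : eball x d y -> u y - quad a 0 p y <= u x - quad a 0 p x.
      by move=> xy; have := tst y xy; rewrite !upper_ext_in//; exact: dx.
    have [/(_ Ox)/Ed_le0P/(_ z z1) h _] := usub d _ x d0 (C2_quad a 0 p) tst'.
    move: h; rewrite (EzdE hs d0 (C2_quad _ _ _) (or_introl wu) uwM (uM x) z1).
    by rewrite upper_ext_in.
  - move=> d a p x d0 dx tst eta eta0.
    have Ox : O x by apply: dx; exact: eball_center.
    have tst' y : eball x d y -> v x - quad a 0 p x <= v y - quad a 0 p y.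
      by move=> xy; have := tst y xy; rewrite !lower_ext_in//; exact: dx.
    have [/(_ Ox)/Ed_ge0/(_ eta0)[z z1 h] _] := vsup d _ x d0 (C2_quad a 0 p) tst'.
    exists z => //; move: h.
    rewrite (EzdE hs d0 (C2_quad _ _ _) (or_intror wv) vwM (vM x) z1).
    by rewrite lower_ext_in.
move=> x; have [Ox|Ox] := pselect (O x).
  by have := cmp x; rewrite upper_ext_in// lower_ext_in.
have [cx|cx] := pselect (closure O x).
  exact: le_trans (bu x cx Ox) (bv x cx Ox).
exact: le_trans (uout x cx) (vout x cx).
Qed.

Lemma Ls_outside (un : nat -> V -> R) : (forall n x, `|un n x| <= M) ->
  (forall n (x : V), ~ closure O x -> un n x = g x) ->
  forall x : V, ~ closure O x -> Ls un x <= g x.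
Proof.
move=> uM unE x cx; rewrite leNgt; apply/negP => gU.
pose e := (Ls un x - g x) / 2.
have e0 : 0 < e by rewrite divr_gt0// subr_gt0.
have [r1 r10 r1P] := within_eball cg (closure_outside cx) e0.
have [r2 r20 r2C] : exists2 r : R, 0 < r & eball x r `<=` ~` closure O.
  apply/nbhs_eballP; apply: open_nbhs_nbhs; split => //.
  by apply/closed_openC/closed_closure.
have r0 : 0 < Num.min r1 r2 by rewrite lt_min r10.
have UE : Ls un x - e < Ls un x by rewrite ltrBlDr ltrDl.
have [n [y [_ ]]] := Ls_gt uM UE r0.
rewrite /eball /= lt_min => /andP[y1 y2].
have cy := r2C _ y2; rewrite unE//.
have := r1P _ (closure_outside cy) y1; rewrite ltr_norml => /andP[h _].
by move: h; rewrite /e; lra.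
Qed.

(** Stability gives the inequality for [Ls un] itself, which lies below its upper extension;
    enlarging the outer function preserves a lower bound. *)
Lemma Ls_upper_ext_sub (un : nat -> V -> R) (Z : set V) (phi : V -> R) d (x0 : V) :
  (forall n x, `|un n x| <= M) -> (forall n, usc (un n) \/ lsc (un n)) ->
  (forall n (x : V), ~ closure O x -> un n x = g x) ->
  compact Z -> Z `<=` @sphere R N ->
  (forall n x, closure O x -> (O x \/ g x < un n x) -> forall b, 0 < b ->
     exists2 z, Z z & - b <= Tail s (un n) (un n x) x z (nu_ R n)) ->
  0 < d -> C2 phi -> closure O x0 -> (O x0 \/ g x0 < Ls un x0) ->
  (forall y, eball x0 d y -> Ls un y - phi y <= Ls un x0 - phi x0) ->
  exists2 z, Z z & 0 <= Esym s (upper_ext O g (Ls un)) (Ls un x0) phi x0 z d.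
Proof.
move=> uM usc_ unE cZ Zs unT d0 cphi cx0 Ox0 tst.
have UM := Ls_bd uM; have Uu := usc_Ls uM.
have wu := usc_upper_ext oO cg Uu; have wM := upper_ext_le_bound UM gM.
have [|z Zz E0] := stability hs uM usc_ cphi d0 cZ Zs tst; last first.
  exists z => //; apply: le_trans E0 _.
  apply: (@le_Esym R N s hs _ _ _ M) => //; [by left|by left|exact: Zs|].
  move=> y; have [Oy|Oy] := pselect (O y); first by rewrite upper_ext_in.
  have [cy|cy] := pselect (closure O y); first by rewrite upper_ext_bd// le_max lexx.
  by rewrite upper_ext_out//; exact: Ls_outside.
have [Ox|Ox] := pselect (O x0).
  have [r r0 rO] := open_eball oO Ox; exists r => // n x _ /rO Ox' _ b b0.
  by apply: unT => //; [exact: subset_closure|left].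
have {Ox0} gU : g x0 < Ls un x0 by case: Ox0.
pose e := (Ls un x0 - g x0) / 2.
have e0 : 0 < e by rewrite divr_gt0// subr_gt0.
have [r1 r10 r1P] := within_eball cg Ox e0.
exists (Num.min r1 e); first by rewrite lt_min r10.
move=> n x _; rewrite /eball /= !lt_min => /andP[xr1 _] /andP[_ ue] b b0.
(* The gap 2 e at x0 survives at nearby points of the graphs. As [un n] equals g outside the
   closure, it also forces x into the closure. *)
have gux : ~ O x -> g x < un n x.
  move=> Ox'; have := r1P _ Ox' xr1; rewrite ltr_norml => /andP[h _].
  move: ue; rewrite ltr_norml => /andP[h' _].
  by move: h h'; rewrite /e; lra.
apply: unT => //.
  apply: contrapT => cx; have := gux (closure_outside cx).
  by rewrite unE// ltxx.
by have [|Ox'] := pselect (O x); [left|right; exact: gux].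
Qed.

End Data.
End Viscosity.

(** * Existence and uniqueness *)

Section Envelopes.
Variables (R : realType) (N : nat).
Local Notation V := 'rV[R]_N.

(** The envelope is the half-relaxed limit of a constant sequence, so its semicontinuity and bounds
    come from those of [Ls]. *)
Lemma usc_envE (u : V -> R) : usc_env u = Ls (fun=> u).
Proof.
apply/funext => x; congr inf; apply: eq_imagel => r /= r0; congr sup.
apply/seteqP; split=> [_ [y xy <-]|_ [n [y [_ xy ->]]]]; last by exists y.
exists (Num.trunc r^-1).+1, y; split=> //; exact/ltW/truncnS_gt.
Qed.

Lemma lsc_envE (u : V -> R) x : lsc_env u x = - usc_env (fun y => - u y) x.
Proof.
rewrite /usc_env /inf opprK; congr sup.
rewrite image_comp; apply: eq_imagel => r _ /=; congr (- sup _).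
by rewrite image_comp.
Qed.

Lemma le_Ls_cst (u : V -> R) M x : (forall y, `|u y| <= M) -> u x <= Ls (fun=> u) x.
Proof.
move=> uM; rewrite leNgt; apply/negP => /(Ls_lt (fun=> uM))[r r0 rP].
have := rP (Num.trunc r^-1).+1 x (ltW (truncnS_gt _)) (eball_center _ r0).
by rewrite ltxx.
Qed.

Lemma usc_envP (u : V -> R) M : (forall y, `|u y| <= M) ->
  let v := if `[< usc u >] then u else usc_env u in
  [/\ usc v, (forall y, `|v y| <= M) & forall y, u y <= v y].
Proof.
move=> uM; case: asboolP => // _ /=; rewrite usc_envE; split.
- exact: (usc_Ls (fun=> uM)).
- exact: (Ls_bd (fun=> uM)).
- by move=> y; exact: le_Ls_cst uM.
Qed.

Lemma lsc_envP (u : V -> R) M : (forall y, `|u y| <= M) ->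
  let v := if `[< lsc u >] then u else lsc_env u in
  [/\ lsc v, (forall y, `|v y| <= M) & forall y, v y <= u y].
Proof.
move=> uM; case: asboolP => // _ /=.
have uM' y : `|- u y| <= M by rewrite normrN.
have -> : lsc_env u = fun y => - Ls (fun=> fun y => - u y) y.
  by apply/funext => y; rewrite lsc_envE usc_envE.
split.
- exact: uscN (usc_Ls (fun=> uM')).
- by move=> y; rewrite normrN; exact: (Ls_bd (fun=> uM')).
- by move=> y; rewrite lerNl; exact: (@le_Ls_cst (fun y => - u y) M).
Qed.

End Envelopes.

Section Existence.
Variables (R : realType) (N : nat) (s : R) (O : set 'rV[R]_N).
Local Notation V := 'rV[R]_N.
Hypotheses (N0 : (0 < N)%N) (hs : 0 < s < 1) (oO : open O) (bO : bounded_set O)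
  (dO : C2_domain O) (scO : strictly_convex O).
Variables (g : V -> R) (M : R).
Hypotheses (cg : {within ~` O, continuous g}) (gM : forall x, ~ O x -> `|g x| <= M)
  (M0 : 0 <= M).

Lemma sub_super_solution : exists u : V -> R, [/\ continuous u, (forall x, `|u x| <= M),
  subsol_usc s O g u & supersol_lsc s O g u].
Proof.
have [un unP] := choice (fun n => truncated_solution N0 hs oO cg gM M0 (nu_gt0 R n)).
have uM n x : `|un n x| <= M by case: (unP n).
have uu n : usc (un n) by case: (unP n).
have uN n x : `|- un n x| <= M by rewrite normrN.
pose vn n x := - un n x.
pose U := Ls un; pose W := Ls vn; pose L x := - W x.
have Uu : usc U := usc_Ls uM; have UM : forall x, `|U x| <= M := Ls_bd uM.
have Wu : usc W := usc_Ls uN; have WM : forall x, `|W x| <= M := Ls_bd uN.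
have unE n (x : V) : ~ closure O x -> un n x = g x by case: (unP n) => _ _ _ h _; exact: h.
have vnE n (x : V) : ~ closure O x -> vn n x = - g x by move=> cx; rewrite /vn unE.
have cgN := within_contN cg.
have gNM x : ~ O x -> `|- g x| <= M by rewrite normrN; exact: gM.
have subU : subsol_usc s O g U.
  split; first by move=> x; apply: (Ls_outside cg uM unE).
  move=> d phi x0 d0 cphi tst.
  have sub : closure O x0 -> (O x0 \/ g x0 < U x0) ->
      (Ed s U (upper_ext O g U) phi x0 d <= 0)%E.
    move=> cx0 Ox0; apply/Ed_le0P => z z1.
    have wu := usc_upper_ext oO cg Uu; have wM := upper_ext_le_bound UM gM.
    rewrite (EzdE hs d0 cphi (or_introl wu) wM (UM x0) z1).
    (* With a singleton the limiting direction is the arbitrary z fixed above. *)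
    have [| |z' -> //] := @Ls_upper_ext_sub R N s O hs oO g M cg gM un [set z] phi d x0 uM
      (fun n => or_introl (uu n)) unE (@compact_set1 _ z) _ _ d0 cphi cx0 Ox0 tst.
    - by move=> _ ->.
    - move=> n x cx Ox b b0; exists z => //.
      have [_ _ _ _ [h _]] := unP n.
      by apply: le_trans (h x cx Ox z z1); rewrite oppr_le0 ltW.
  split=> [Ox0|cx0 Ox0]; first by apply: sub; [exact: subset_closure|left].
  rewrite ge_min; have [gU|Ug] := ltP (g x0) (U x0).
    by rewrite sub//; right.
  by rewrite lee_fin subr_le0 Ug orbT.
have superW : supersol_lsc s O g L.
  split.
    by move=> x cx; rewrite lerNr; exact: (Ls_outside cgN uN vnE).
  move=> d phi x0 d0 cphi tst.
  have sup : closure O x0 -> (O x0 \/ L x0 < g x0) ->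
      (0 <= Ed s L (lower_ext O g L) phi x0 d)%E.
    move=> cx0 Ox0.
    have wl := lsc_lower_ext oO cg (uscN Wu).
    have WNM x : `|L x| <= M by rewrite normrN.
    have wM := lower_ext_le_bound WNM gM.
    have Ox0' : O x0 \/ - g x0 < W x0 by case: Ox0 => h; [left|right; rewrite ltrNl].
    have tst' y : eball x0 d y -> W y - - phi y <= W x0 - - phi x0.
      by move=> /tst h; rewrite !opprK -lerN2 !opprD.
    (* The nearly optimal directions vary with n, so the whole sphere is needed. *)
    have [| |z z1] := @Ls_upper_ext_sub R N s O hs oO (fun x => - g x) M cgN gNM vn
      (@sphere R N) (fun y => - phi y) d x0 uN (fun n => or_intror (uscN (uu n))) vnE
      (@compact_sphere R N) _ _ d0 (C2N cphi) cx0 Ox0' tst'.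
    - by [].
    - move=> n x cx Ox b b0.
      have [_ _ h3 _ [_ h]] := unP n.
      (* Off O the truncated solution is at least g, which excludes the boundary alternative. *)
      have {}Ox : O x.
        case: Ox => // gu; apply: contrapT => Ox; have := h3 x Ox.
        by move: gu; rewrite /vn ltrN2 => /lt_le_trans /[apply]; rewrite ltxx.
      have [z z1 zb] := h x Ox b b0; exists z => //.
      rewrite /vn (TailN hs _ _ (nu_gt0 R n) (or_introl (uu n)) (uM n) (uM n x)).
      by rewrite lerN2.
    - move=> E0; apply: (ge0_Ed z1).
      rewrite (EzdE hs d0 cphi (or_intror wl) wM (WNM x0) z1).
      rewrite -oppr_ge0 -(EsymN hs _ d0 cphi (or_intror wl) wM (WNM x0) z1) opprK.
      move: E0; rewrite -/W.
      have -> // : upper_ext O (fun x => - g x) W =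
          fun y => - lower_ext O g (fun x => - W x) y.
      rewrite -upper_extN; congr upper_ext.
      by apply/funext => x; rewrite opprK.
  split=> [Ox0|cx0 Ox0]; first by apply: sup; [exact: subset_closure|left].
  rewrite le_max; have [gU|Ug] := ltP (L x0) (g x0).
    by rewrite sup//; right.
  by rewrite lee_fin subr_ge0 Ug orbT.
have UW x : U x <= - W x.
  apply: (visc_comparison N0 hs oO bO dO scO cg gM Uu (uscN Wu) UM _ subU superW).
  by move=> y; rewrite normrN.
(* Otherwise, for a strictly between U x and - W x, a single value [un n x] with n large would lie
   both below and above a. *)
have WU x : - W x <= U x.
  rewrite leNgt; apply/negP => /midf_lt[m1 m2]; set a := (_ / 2) in m1 m2.
  have [r1 r10 r1P] := Ls_lt uM m1.
  have m2' : W x < - a by rewrite ltrNr.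
  have [r2 r20 r2P] := Ls_lt uN m2'.
  pose r := Num.min r1 r2.
  have r0 : 0 < r by rewrite lt_min r10.
  pose n := (Num.trunc r^-1).+1.
  have rn : r^-1 <= n%:R by exact/ltW/truncnS_gt.
  have rV r' : 0 < r' -> r <= r' -> r'^-1 <= n%:R.
    by move=> r'0 h; apply: le_trans rn; rewrite lef_pV2 ?posrE.
  have := r1P n x (rV _ r10 _) (eball_center _ r10); rewrite ge_min lexx => /(_ isT) h1.
  have := r2P n x (rV _ r20 _) (eball_center _ r20); rewrite ge_min lexx orbT => /(_ isT).
  by rewrite ltrN2 => /(lt_trans h1); rewrite ltxx.
have WE : (fun x => - W x) = U.
  by apply/funext => x; apply/eqP; rewrite eq_le WU UW.
exists U; split=> //; last by rewrite -WE.
by apply: usc_lsc_continuous => //; rewrite -WE; exact: uscN.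
Qed.

End Existence.

Theorem theorem2p3 (R : realType) (N : nat) (s : R) (O : set 'rV[R]_N)
    (g : 'rV[R]_N -> R) :
  (0 < N)%N -> 0 < s < 1 ->
  O !=set0 -> open O -> connected O -> bounded_set O ->
  C2_domain O -> strictly_convex O ->
  {within ~` O, continuous g} ->
  (exists M : R, forall x, ~ O x -> `|g x| <= M) ->
  exists u : 'rV[R]_N -> R,
    [/\ visc_solution s O g u,
        (forall v, visc_solution s O g v -> v = u),
        {within closure O, continuous u} &
        (forall x, closure O x -> ~ O x -> u x = g x)].
Proof.
move=> N0 hs _ oO _ bO dO scO cg [M1 gM1].
pose M := Num.max 0 M1.
have M0 : 0 <= M by rewrite le_max lexx.
have gM x : ~ O x -> `|g x| <= M by move=> /gM1 h; rewrite le_max h orbT.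
have [u [cu uM su sv]] := sub_super_solution N0 hs oO bO dO scO cg gM M0.
have uu := continuous_usc cu; have ul := continuous_lsc cu.
exists u; split.
- split; (split; first by exists M); case: asboolP => //.
- move=> v [[[Mv vMv] vsub] [_ vsup]].
  (* A competing solution has its own bound; comparison needs one bound for u, v and g. It then
     gives v <= usc envelope <= u <= lsc envelope <= v, without assuming v semicontinuous. *)
  pose M' := Num.max M Mv.
  have gM' x : ~ O x -> `|g x| <= M' by move=> /gM h; rewrite le_max h.
  have uM' x : `|u x| <= M' by rewrite le_max uM.
  have vM' x : `|v x| <= M' by rewrite le_max vMv orbT.
  have [v1u v1M v1] := usc_envP vM'; have [v2l v2M v2] := lsc_envP vM'.
  have h1 := visc_comparison N0 hs oO bO dO scO cg gM' v1u ul v1M uM' vsub sv.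
  have h2 := visc_comparison N0 hs oO bO dO scO cg gM' uu v2l uM' v2M su vsup.
  apply/funext => x; apply/eqP; rewrite eq_le; apply/andP; split.
    exact: le_trans (v1 x) (h1 x).
  exact: le_trans (h2 x) (v2 x).
- exact: continuous_subspaceT.
- move=> x cx Ox; apply/eqP; rewrite eq_le.
  rewrite (subsol_boundary N0 hs oO bO dO scO cg gM uu uM su cx Ox).
  by rewrite (supersol_boundary hs oO bO dO scO cg gM ul uM sv cx Ox).
Qed.
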